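(* Let $\Bbbk$ be a field and let $p,q\in\Bbbk$ be arbitrary scalars (possibly zero). Let $\mathbf{h}$ be a connected $p$-Hopf monoid, and let $\mathbf{k}$ be a $q$-Hopf monoid that is free as a monoid. Then the Hadamard product $\mathbf{h}\times\mathbf{k}$ is a connected $pq$-Hopf monoid that is free as a monoid.
   Context: **Species.** Fix a field $\Bbbk$. A species is a functor from the category of finite sets and bijections to the category of $\Bbbk$-vector spaces; a morphism of species is a natural transformation. The value of a species $\mathbf{p}$ on a finite set $I$ is $\mathbf{p}[I]$. The notation $I=S\sqcup T$ means $I=S\cup T$ and $S\cap T=\emptyset$ (ordered pair $(S,T)$, parts possibly empty). A species $\mathbf{p}$ is connected if $\dim_\Bbbk\mathbf{p}[\emptyset]=1$, and positive if $\mathbf{p}[\emptyset]=0$. **Monoids and comonoids.** A monoid (in species) is a species $\mathbf{p}$ with linear maps $\mu_{S,T}:\mathbf{p}[S]\otimes\mathbf{p}[T]\to\mathbf{p}[I]$, one for each $I=S\sqcup T$, natural with respect to bijections of $I$, and a linear map $\iota_\emptyset:\Bbbk\to\mathbf{p}[\emptyset]$, which are associative ($\mu_{R\sqcup S,T}(\mu_{R,S}\otimes\mathrm{id})=\mu_{R,S\sqcup T}(\mathrm{id}\otimes\mu_{S,T})$) and unital ($\mu_{\emptyset,I}(\iota_\emptyset\otimes\mathrm{id})=\mathrm{id}=\mu_{I,\emptyset}(\mathrm{id}\otimes\iota_\emptyset)$). Morphisms of monoids are morphisms of species commuting with products and units. Dually, a comonoid has natural maps $\Delta_{S,T}:\mathbf{p}[I]\to\mathbf{p}[S]\otimes\mathbf{p}[T]$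 and $\epsilon_\emptyset:\mathbf{p}[\emptyset]\to\Bbbk$, coassociative and counital. **$q$-bimonoids and $q$-Hopf monoids.** For $q\in\Bbbk$, a $q$-bimonoid is a species $\mathbf{h}$ which is a monoid and a comonoid such that (i) for any $I=S\sqcup T=S'\sqcup T'$, with $A=S\cap S'$, $B=S\cap T'$, $C=T\cap S'$, $D=T\cap T'$, $$\Delta_{S',T'}\,\mu_{S,T}=(\mu_{A,C}\otimes\mu_{B,D})(\mathrm{id}\otimes\beta_q\otimes\mathrm{id})(\Delta_{A,B}\otimes\Delta_{C,D}),$$ where $\beta_q:\mathbf{h}[B]\otimes\mathbf{h}[C]\to\mathbf{h}[C]\otimes\mathbf{h}[B]$ is $x\otimes y\mapsto q^{|B||C|}\,y\otimes x$ (with $0^0=1$); and (ii) the unit/counit compatibilities hold: $\epsilon_\emptyset\iota_\emptyset=\mathrm{id}$, $\epsilon_\emptyset\mu_{\emptyset,\emptyset}=\epsilon_\emptyset\otimes\epsilon_\emptyset$, $\Delta_{\emptyset,\emptyset}\iota_\emptyset=\iota_\emptyset\otimes\iota_\emptyset$. A $q$-Hopf monoid is a $q$-bimonoid with an antipode, i.e. a morphism of species $s:\mathbf{h}\to\mathbf{h}$ such that for every $I$ both $\sum_{I=S\sqcup T}\mu_{S,T}(\mathrm{id}\otimes s_T)\Delta_{S,T}$ and $\sum_{I=S\sqcup T}\mu_{S,T}(s_S\otimes\mathrm{id})\Delta_{S,T}$ equal $\iota_\emptyset\epsilon_\emptyset$ if $I=\emptyset$ and $0$ if $I\ne\emptyset$.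 (A connected $q$-bimonoid is automatically a $q$-Hopf monoid.) **Free monoids.** A composition $F=(I_1,\dots,I_k)$ of a finite set $I$ (written $F\vDash I$) is an ordered sequence of disjoint nonempty subsets with union $I$; the empty set has exactly one composition, with no blocks. For a positive species $\mathbf{q}$, put $\mathbf{q}(F)=\mathbf{q}[I_1]\otimes\cdots\otimes\mathbf{q}[I_k]$ ($=\Bbbk$ for the empty composition) and $\mathcal{T}(\mathbf{q})[I]=\bigoplus_{F\vDash I}\mathbf{q}(F)$, with bijections acting in the evident way. It is a monoid, with product the sum of the canonical isomorphisms $\mathbf{q}(F)\otimes\mathbf{q}(G)\cong\mathbf{q}(F\cdot G)$, $F\vDash S$, $G\vDash T$, where $F\cdot G$ is concatenation. A monoid is free if it is isomorphic, as a monoid, to $\mathcal{T}(\mathbf{q})$ for some positive species $\mathbf{q}$. **Hadamard product.** $(\mathbf{p}\times\mathbf{q})[I]=\mathbf{p}[I]\otimes\mathbf{q}[I]$, and similarly on bijections. If $\mathbf{h}$ is a $p$-bimonoid and $\mathbf{k}$ is a $q$-bimonoid, the product of $\mathbf{h}\times\mathbf{k}$ is $(\mathbf{h}[S]\otimes\mathbf{k}[S])\otimes(\mathbf{h}[T]\otimes\mathbf{k}[T])\cong(\mathbf{h}[S]\otimes\mathbf{h}[T])\otimes(\mathbf{k}[S]\otimes\mathbf{k}[T])\xrightarrow{\mu_{S,T}\otimes\mu_{S,T}}\mathbf{h}[I]\otimes\mathbf{k}[I]$, where the first map switches the middle tensor factors (without any power of $p$ or $q$); the coproduct, unit and counit are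 defined similarly. *)

(* Defs.v *)
From HB Require Import structures.
From mathcomp Require Import all_boot all_algebra.
From mathcomp Require Import boolp.

Set Implicit Arguments.
Unset Strict Implicit.
Unset Printing Implicit Defensive.

Import GRing.Theory.
Local Open Scope ring_scope.
Local Open Scope quotient_scope.

(* Keeps simplification from exposing the functions underlying the linear maps
   defined below. *)
Fact linear_key : unit. Proof. exact: tt. Qed.

Definition bilin (K : fieldType) (V W U : lmodType K) (b : V -> W -> U) : Prop :=
  (forall w, linear (b^~ w)) /\ (forall v, linear (b v)).

Section Tensor.
Variables (K : fieldType) (V W : lmodType K).
Implicit Types (s t : seq (V * W)) (U : lmodType K).

Definition fsum U (b : V -> W -> U) s : U := \sum_(x <- s) b x.1 x.2.

(* A finite sequence of pairs [(v_i, w_i)] stands for the sum of the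
   [v_i (x) w_i]; two such sums are equal in the tensor product iff every
   bilinear map, into any vector space, takes the same value on both. *)
Definition tens_eq : rel (seq (V * W)) := fun s t =>
  `[< forall U (b : V -> W -> U), bilin b -> fsum b s = fsum b t >].

Lemma tens_eq_refl : reflexive tens_eq.
Proof. by move=> s; apply/asboolP. Qed.
Lemma tens_eq_sym : symmetric tens_eq.
Proof.
by move=> s t; apply/asboolP/asboolP => h U b hb; rewrite h.
Qed.
Lemma tens_eq_trans : transitive tens_eq.
Proof.
move=> t s r /asboolP h1 /asboolP h2; apply/asboolP => U b hb.
by rewrite h1 // h2.
Qed.

Canonical tens_equiv := EquivRel tens_eq tens_eq_refl tens_eq_sym tens_eq_trans.

Definition tensor_type := {eq_quot tens_eq}.
HB.instance Definition _ := Choice.on tensor_type.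

Definition tpi s : tensor_type := \pi_{eq_quot tens_eq} s.
Definition trepr (x : tensor_type) : seq (V * W) := repr x.

Lemma treprK x : tpi (trepr x) = x.
Proof. exact: reprK. Qed.

Lemma tpiP s t :
  (forall U (b : V -> W -> U), bilin b -> fsum b s = fsum b t) <-> tpi s = tpi t.
Proof.
split=> [h|/eqmodP/asboolP //]; by apply/eqmodP/asboolP.
Qed.

Lemma fsum_trepr U (b : V -> W -> U) s : bilin b -> fsum b (trepr (tpi s)) = fsum b s.
Proof. by move: U b; apply/tpiP; rewrite treprK. Qed.

Definition tadd (x y : tensor_type) := tpi (trepr x ++ trepr y).
Definition tscale (a : K) (x : tensor_type) :=
  tpi [seq (a *: v.1, v.2) | v <- trepr x].
Definition topp := tscale (-1).
Definition tzero := tpi [::].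

Lemma fsum_cat U (b : V -> W -> U) s t : fsum b (s ++ t) = fsum b s + fsum b t.
Proof. by rewrite /fsum big_cat. Qed.

Lemma bilinDl U (b : V -> W -> U) : bilin b -> forall x y w, b (x + y) w = b x w + b y w.
Proof. by case=> h _ x y w; have:= h w 1 x y; rewrite !scale1r. Qed.
Lemma bilinDr U (b : V -> W -> U) : bilin b -> forall v x y, b v (x + y) = b v x + b v y.
Proof. by case=> _ h v x y; have:= h v 1 x y; rewrite !scale1r. Qed.
Lemma bilin0l U (b : V -> W -> U) : bilin b -> forall w, b 0 w = 0.
Proof. by move=> h w; apply: (addrI (b 0 w)); rewrite -bilinDl // !addr0. Qed.
Lemma bilin0r U (b : V -> W -> U) : bilin b -> forall v, b v 0 = 0.
Proof. by move=> h v; apply: (addrI (b v 0)); rewrite -bilinDr // !addr0. Qed.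
Lemma bilinZl U (b : V -> W -> U) : bilin b -> forall a v w, b (a *: v) w = a *: b v w.
Proof.
by move=> hb a v w; have:= hb.1 w a v 0; rewrite /= addr0 (bilin0l hb) addr0.
Qed.
Lemma bilinZr U (b : V -> W -> U) : bilin b -> forall a v w, b v (a *: w) = a *: b v w.
Proof.
by move=> hb a v w; have:= hb.2 v a w 0; rewrite addr0 (bilin0r hb) addr0.
Qed.

Lemma fsum_scale U (b : V -> W -> U) (a : K) s : bilin b ->
  fsum b [seq (a *: v.1, v.2) | v <- s] = a *: fsum b s.
Proof.
move=> hb; rewrite /fsum big_map scaler_sumr; apply: eq_bigr => v _ /=.
exact: bilinZl.
Qed.

Lemma fsum_tadd U (b : V -> W -> U) x y : bilin b ->
  fsum b (trepr (tadd x y)) = fsum b (trepr x) + fsum b (trepr y).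
Proof. by move=> hb; rewrite fsum_trepr // fsum_cat. Qed.
Lemma fsum_tscale U (b : V -> W -> U) a x : bilin b ->
  fsum b (trepr (tscale a x)) = a *: fsum b (trepr x).
Proof. by move=> hb; rewrite fsum_trepr // fsum_scale. Qed.
Lemma fsum_tzero U (b : V -> W -> U) : bilin b -> fsum b (trepr tzero) = 0.
Proof. by move=> hb; rewrite fsum_trepr // /fsum big_nil. Qed.

Lemma tensP x y :
  (forall U (b : V -> W -> U), bilin b -> fsum b (trepr x) = fsum b (trepr y)) ->
  x = y.
Proof. by move=> h; rewrite -[x]treprK -[y]treprK; apply/tpiP. Qed.

Lemma taddA : associative tadd.
Proof. by move=> x y z; apply: tensP => U b hb; rewrite !fsum_tadd // addrA. Qed.
Lemma taddC : commutative tadd.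
Proof. by move=> x y; apply: tensP => U b hb; rewrite !fsum_tadd // addrC. Qed.
Lemma tadd0 : left_id tzero tadd.
Proof.
by move=> x; apply: tensP => U b hb; rewrite fsum_tadd // fsum_tzero // add0r.
Qed.
Lemma taddN : left_inverse tzero topp tadd.
Proof.
move=> x; apply: tensP => U b hb.
by rewrite fsum_tadd // fsum_tzero // fsum_tscale // scaleN1r addNr.
Qed.

HB.instance Definition _ := GRing.isZmodule.Build tensor_type taddA taddC tadd0 taddN.

Lemma tscaleA a b x : tscale a (tscale b x) = tscale (a * b) x.
Proof. by apply: tensP => U c hc; rewrite !fsum_tscale // scalerA. Qed.
Lemma tscale1 : left_id 1 tscale.
Proof. by move=> x; apply: tensP => U c hc; rewrite !fsum_tscale // scale1r. Qed.
Lemma tscaleDr : right_distributive tscale +%R.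
Proof.
move=> a x y; apply: tensP => U c hc.
by rewrite fsum_tscale // !fsum_tadd // !fsum_tscale // scalerDr.
Qed.
Lemma tscaleDl x : {morph tscale^~ x : a b / a + b}.
Proof.
move=> a b; apply: tensP => U c hc.
by rewrite fsum_tscale // !fsum_tadd // !fsum_tscale // scalerDl.
Qed.

HB.instance Definition _ := GRing.Zmodule_isLmodule.Build K tensor_type
  tscaleA tscale1 tscaleDr tscaleDl.

Definition tensor : lmodType K := tensor_type.

Definition tpure (v : V) (w : W) : tensor := tpi [:: (v, w)].

Lemma fsum_tpure U (b : V -> W -> U) v w : bilin b -> fsum b (trepr (tpure v w)) = b v w.
Proof. by move=> hb; rewrite fsum_trepr // /fsum big_seq1. Qed.

Lemma tpure_bilin : bilin tpure.
Proof.
split=> [w|v] a x y; apply: tensP => U b hb;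
  rewrite fsum_tadd // fsum_tscale // !fsum_tpure //.
- exact: (hb.1 w).
- exact: (hb.2 v).
Qed.

Section Lift.
Variables (U : lmodType K) (b : V -> W -> U) (hb : bilin b).

Definition tlift_fun (hb' : bilin b) (x : tensor) : U := fsum b (trepr x).

Lemma tlift_is_linear : linear (tlift_fun hb).
Proof. by move=> a x y; rewrite /tlift_fun fsum_tadd // fsum_tscale. Qed.

HB.instance Definition _ :=
  GRing.isLinear.Build K tensor U *:%R (tlift_fun hb) tlift_is_linear.

Definition tlift : {linear tensor -> U} :=
  locked_with linear_key (tlift_fun hb : {linear tensor -> U}).

Lemma tliftE v w : tlift (tpure v w) = b v w.
Proof. by rewrite /tlift unlock; exact: fsum_tpure. Qed.
End Lift.

Lemma tensor_sum (x : tensor) : x = \sum_(v <- trepr x) tpure v.1 v.2.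
Proof.
apply: tensP => U b hb.
rewrite -[RHS]/(tlift_fun hb _) linear_sum.
by apply: eq_bigr => v _; rewrite /= /tlift_fun fsum_tpure.
Qed.

Lemma tensor_ind (P : tensor -> Prop) :
  P 0 -> (forall v w x, P x -> P (tpure v w + x)) -> forall x, P x.
Proof.
move=> P0 PD x; rewrite (tensor_sum x).
by elim: (trepr x) => [|v s ih]; rewrite ?big_nil // big_cons; apply: PD.
Qed.

Lemma tensor_ext U (f g : {linear tensor -> U}) :
  (forall v w, f (tpure v w) = g (tpure v w)) -> f =1 g.
Proof.
move=> h x; rewrite (tensor_sum x) !linear_sum.
by apply: eq_bigr => v _; exact: h.
Qed.
End Tensor.

Notation "V ⊗ W" := (tensor V W) (at level 40, left associativity) : type_scope.
Notation "v ⊠ w" := (tpure v w) (at level 40, left associativity) : ring_scope.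

Section TensorMaps.
Variable K : fieldType.
Implicit Types A B C D U V W : lmodType K.

Lemma tmap_bilin V V' W W' (f : {linear V -> V'}) (g : {linear W -> W'}) :
  bilin (fun v w => f v ⊠ g w).
Proof.
split=> [w|v] a x y; rewrite linearP.
- exact: (tpure_bilin V' W').1.
- exact: (tpure_bilin V' W').2.
Qed.

Definition tmap V V' W W' (f : {linear V -> V'}) (g : {linear W -> W'}) :
  {linear V ⊗ W -> V' ⊗ W'} := tlift (tmap_bilin f g).

Lemma tmapE V V' W W' (f : {linear V -> V'}) (g : {linear W -> W'}) v w :
  tmap f g (v ⊠ w) = f v ⊠ g w.
Proof. exact: tliftE. Qed.

Lemma tswap_bilin V W : bilin (fun (v : V) (w : W) => w ⊠ v).
Proof. by split=> ?; [exact: (tpure_bilin W V).2|exact: (tpure_bilin W V).1]. Qed.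

Definition tswap V W : {linear V ⊗ W -> W ⊗ V} := tlift (@tswap_bilin V W).

Lemma tswapE V W (v : V) (w : W) : tswap V W (v ⊠ w) = w ⊠ v.
Proof. exact: tliftE. Qed.

Lemma assoc_bilin1 U V W (w : W) : bilin (fun (u : U) (v : V) => u ⊠ (v ⊠ w)).
Proof.
split=> [v|u] a x y.
- exact: (tpure_bilin _ _).1.
- by rewrite (tpure_bilin V W).1 (tpure_bilin U (V ⊗ W)).2.
Qed.

Lemma assoc_bilin U V W :
  bilin (fun (t : U ⊗ V) (w : W) => tlift (@assoc_bilin1 U V W w) t).
Proof.
split=> [w|t] a x y; first exact: linearP.
elim/tensor_ind: t => [|u v t ih]; first by rewrite !linear0 addr0.
rewrite !(linearD (tlift _)) ih !tliftE.
by rewrite (tpure_bilin V W).2 (tpure_bilin U (V ⊗ W)).2 scalerDr addrACA.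
Qed.

Definition tassoc U V W : {linear (U ⊗ V) ⊗ W -> U ⊗ (V ⊗ W)} :=
  tlift (@assoc_bilin U V W).

Lemma tassocE U V W (u : U) (v : V) (w : W) :
  tassoc U V W (u ⊠ v ⊠ w) = u ⊠ (v ⊠ w).
Proof. by rewrite /tassoc !tliftE. Qed.

Definition tassocV U V W : {linear U ⊗ (V ⊗ W) -> (U ⊗ V) ⊗ W} :=
  locked_with linear_key
  (tswap W (U ⊗ V) \o tmap idfun (tswap V U) \o tassoc W V U \o
   tswap U (W ⊗ V) \o tmap idfun (tswap V W)
   : {linear U ⊗ (V ⊗ W) -> (U ⊗ V) ⊗ W}).

Lemma tassocVE U V W (u : U) (v : V) (w : W) :
  tassocV U V W (u ⊠ (v ⊠ w)) = u ⊠ v ⊠ w.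
Proof. by rewrite /tassocV unlock /= !(tmapE, tswapE, tassocE). Qed.

Definition tmid A B C D B' C' (f : {linear B ⊗ C -> C' ⊗ B'}) :
    {linear (A ⊗ B) ⊗ (C ⊗ D) -> (A ⊗ C') ⊗ (B' ⊗ D)} :=
  locked_with linear_key
  (tassocV A C' (B' ⊗ D) \o
   tmap idfun (tassoc C' B' D \o tmap f idfun \o tassocV B C D) \o
   tassoc A B (C ⊗ D)
   : {linear (A ⊗ B) ⊗ (C ⊗ D) -> (A ⊗ C') ⊗ (B' ⊗ D)}).

Lemma tmid_swapE A B C D (a : A) (b : B) (c : C) (d : D) :
  tmid A D (tswap B C) ((a ⊠ b) ⊠ (c ⊠ d)) = (a ⊠ c) ⊠ (b ⊠ d).
Proof.
by rewrite /tmid unlock /= tassocE tmapE /= tassocVE tmapE tswapE tassocE tassocVE.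
Qed.

Lemma lunit_bilin V : bilin (fun (c : K^o) (v : V) => c *: v).
Proof.
split=> [v|c] a x y; first by rewrite scalerDl scalerA.
by rewrite scalerDr !scalerA mulrC.
Qed.
Lemma runit_bilin V : bilin (fun (v : V) (c : K^o) => c *: v).
Proof.
split=> [c|v] a x y; first by rewrite scalerDr !scalerA mulrC.
by rewrite scalerDl scalerA.
Qed.

Definition lunit V : {linear K^o ⊗ V -> V} := tlift (@lunit_bilin V).
Definition runit V : {linear V ⊗ K^o -> V} := tlift (@runit_bilin V).


Lemma lunitV_is_linear V : linear (fun v : V => (1 : K^o) ⊠ v).
Proof. by move=> a x y; rewrite (tpure_bilin K^o V).2. Qed.

Definition lunitV V : {linear V -> K^o ⊗ V} :=
  locked_with linear_key (HB.pack (fun v : V => (1 : K^o) ⊠ v)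
    (GRing.isLinear.Build K V (K^o ⊗ V) *:%R _ (@lunitV_is_linear V)) : {linear V -> K^o ⊗ V}).

Lemma lunitVE V (v : V) : lunitV V v = (1 : K^o) ⊠ v.
Proof. by rewrite /lunitV unlock. Qed.

Lemma lunitE V (c : K^o) (v : V) : lunit V (c ⊠ v) = c *: v.
Proof. exact: tliftE. Qed.
Lemma runitE V (c : K^o) (v : V) : runit V (v ⊠ c) = c *: v.
Proof. exact: tliftE. Qed.
End TensorMaps.

Section DirectSum.
Variables (K : fieldType) (J : finType) (V : J -> lmodType K).

Definition dsum_type := {dffun forall j, V j}.
HB.instance Definition _ := Choice.on dsum_type.

Implicit Types x y z : dsum_type.

Definition dsum_of (f : forall j, V j) : dsum_type := finfun f.

Lemma dsumE f j : dsum_of f j = f j.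
Proof. exact: ffunE. Qed.

Lemma dsumP x y : (forall j, x j = y j) -> x = y.
Proof. by move/ffunP. Qed.

Definition dadd x y := dsum_of (fun j => x j + y j).
Definition dopp x := dsum_of (fun j => - x j).
Definition dzero := dsum_of (fun j => 0).
Definition dscale (a : K) x := dsum_of (fun j => a *: x j).

Lemma daddA : associative dadd.
Proof. by move=> x y z; apply: dsumP => j; rewrite !dsumE addrA. Qed.
Lemma daddC : commutative dadd.
Proof. by move=> x y; apply: dsumP => j; rewrite !dsumE addrC. Qed.
Lemma dadd0 : left_id dzero dadd.
Proof. by move=> x; apply: dsumP => j; rewrite !dsumE add0r. Qed.
Lemma daddN : left_inverse dzero dopp dadd.
Proof. by move=> x; apply: dsumP => j; rewrite !dsumE addNr. Qed.
HB.instance Definition _ := GRing.isZmodule.Build dsum_type daddA daddC dadd0 daddN.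

Lemma dscaleA a b x : dscale a (dscale b x) = dscale (a * b) x.
Proof. by apply: dsumP => j; rewrite !dsumE scalerA. Qed.
Lemma dscale1 : left_id 1 dscale.
Proof. by move=> x; apply: dsumP => j; rewrite !dsumE scale1r. Qed.
Lemma dscaleDr : right_distributive dscale +%R.
Proof. by move=> a x y; apply: dsumP => j; rewrite !dsumE scalerDr. Qed.
Lemma dscaleDl x : {morph dscale^~ x : a b / a + b}.
Proof. by move=> a b; apply: dsumP => j; rewrite !dsumE scalerDl. Qed.
HB.instance Definition _ := GRing.Zmodule_isLmodule.Build K dsum_type
  dscaleA dscale1 dscaleDr dscaleDl.

Definition dsum : lmodType K := dsum_type.

Definition dproj_fun j (x : dsum) : V j := (x : dsum_type) j.
Lemma dproj_is_linear j : linear (@dproj_fun j).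
Proof. by move=> a x y; rewrite /dproj_fun !dsumE. Qed.
HB.instance Definition _ j :=
  GRing.isLinear.Build K dsum (V j) *:%R (@dproj_fun j) (@dproj_is_linear j).

Definition dproj j : {linear dsum -> V j} :=
  locked_with linear_key (@dproj_fun j : {linear dsum -> V j}).

Lemma dprojE j x : dproj j x = (x : dsum_type) j.
Proof. by rewrite /dproj unlock. Qed.

Lemma dsum_ext (x y : dsum) : (forall j, dproj j x = dproj j y) -> x = y.
Proof. by move=> h; apply: dsumP => j; have:= h j; rewrite !dprojE. Qed.

Definition dinj_fun j (v : V j) : dsum :=
  dsum_of (fun i => if @eqP J j i is ReflectT e then ecast k (V k) e v else 0).
Lemma dinj_is_linear j : linear (@dinj_fun j).
Proof.
move=> a x y; apply: dsumP => i; rewrite !dsumE.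
case: eqP => [e|_]; first by case: i / e.
by rewrite scaler0 addr0.
Qed.
HB.instance Definition _ j :=
  GRing.isLinear.Build K (V j) dsum *:%R (@dinj_fun j) (@dinj_is_linear j).

Definition dinj j : {linear V j -> dsum} :=
  locked_with linear_key (@dinj_fun j : {linear V j -> dsum}).

Lemma dproj_dinj j (v : V j) : dproj j (dinj j v) = v.
Proof.
rewrite dprojE /dinj unlock /= dsumE; case: eqP => // e.
by rewrite (eq_irrelevance e (erefl j)).
Qed.

Lemma dproj_dinj_ne i j (v : V j) : j != i -> dproj i (dinj j v) = 0.
Proof. by move=> ne; rewrite dprojE /dinj unlock /= dsumE; case: eqP ne => // ->; rewrite eqxx. Qed.

Lemma dsum_dec (x : dsum) : x = \sum_j dinj j (dproj j x).
Proof.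
apply: dsum_ext => i; rewrite linear_sum (bigD1 i) //= dproj_dinj big1 ?addr0 //.
by move=> j; exact: dproj_dinj_ne.
Qed.

End DirectSum.

Section LinearSum.
Variables (K : fieldType) (V W : lmodType K) (J : finType).

Definition lsum_fun (f : J -> {linear V -> W}) (x : V) : W := \sum_j f j x.
Lemma lsum_is_linear f : linear (lsum_fun f).
Proof.
move=> a x y; rewrite /lsum_fun scaler_sumr -big_split.
by apply: eq_bigr => j _; exact: linearP.
Qed.
HB.instance Definition _ f :=
  GRing.isLinear.Build K V W *:%R (lsum_fun f) (lsum_is_linear f).

Definition lsum f : {linear V -> W} :=
  locked_with linear_key (lsum_fun f : {linear V -> W}).

Lemma lsumE f x : lsum f x = \sum_j f j x.
Proof. by rewrite /lsum unlock. Qed.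
End LinearSum.

Section LinearScale.
Variables (K : fieldType) (V W : lmodType K) (a : K) (f : {linear V -> W}).

Definition lscale_fun (x : V) : W := a *: f x.
Lemma lscale_is_linear : linear lscale_fun.
Proof. by move=> b x y; rewrite /lscale_fun linearP scalerDr !scalerA mulrC. Qed.
HB.instance Definition _ :=
  GRing.isLinear.Build K V W *:%R lscale_fun lscale_is_linear.

Definition lscale : {linear V -> W} :=
  locked_with linear_key (lscale_fun : {linear V -> W}).

Lemma lscaleE x : lscale x = a *: f x.
Proof. by rewrite /lscale unlock. Qed.
End LinearScale.

Record bij (S T : finType) := Bij { bij_fun :> S -> T; bijP : bijective bij_fun }.

Lemma bij_eq (S T : finType) (f g : bij S T) : f =1 g -> f = g.
Proof.
case: f g => f hf [g hg] /= /funext e; case: g / e hg => hg.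
by rewrite (Prop_irrelevance hf hg).
Qed.

Definition bij_id (S : finType) : bij S S :=
  @Bij S S idfun (Bijective (fun _ => erefl) (fun _ => erefl)).
Definition bij_o (S T U : finType) (g : bij T U) (f : bij S T) : bij S U :=
  Bij (bij_comp (bijP g) (bijP f)).

Lemma inj_bij (S T : finType) (f : bij S T) : injective f.
Proof. exact: bij_inj (bijP f). Qed.

Definition sset (I : finType) (A : {set I}) : finType := {x : I | x \in A}.

(* [decomp S T I] is I = S ⊔ T: since finite sets are types here, S and T are
   subsets of I by way of two injections, with disjoint images covering I. *)
Record decomp (S T I : finType) := Decomp {
  dl : S -> I;
  dr : T -> I;
  decompP : bijective (fun z : S + T => match z with inl s => dl s | inr t => dr t end)
}.

Lemma dl_inj S T I (d : decomp S T I) : injective (dl d).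
Proof. by move=> x y e; have:= bij_inj (decompP d); case/(_ (inl x) (inl y) e). Qed.
Lemma dr_inj S T I (d : decomp S T I) : injective (dr d).
Proof. by move=> x y e; have:= bij_inj (decompP d); case/(_ (inr x) (inr y) e). Qed.

Lemma dlr_neq S T I (d : decomp S T I) s t : dl d s != dr d t.
Proof. by apply/eqP => e; have:= bij_inj (decompP d); move/(_ (inl s) (inr t) e). Qed.

Lemma decomp_cover S T I (d : decomp S T I) (i : I) :
  (exists s, i = dl d s) \/ (exists t, i = dr d t).
Proof.
by case: (decompP d) => g _ gK; rewrite -(gK i); case: (g i) => x; [left|right]; exists x.
Qed.

Lemma dset_bij (I : finType) (S : {set I}) :
  bijective (fun z : sset S + sset (~: S) =>
    match z with inl s => val s | inr t => val t end).
Proof.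
have h (x : I) : (x \in S) = false -> x \in ~: S by rewrite inE => ->.
pose g (x : I) : sset S + sset (~: S) :=
  match boolP (x \in S) with
  | AltTrue p => inl (Sub x p)
  | AltFalse p => inr (Sub x (h x (negbTE p)))
  end.
exists g => [[[x hx]|[x hx]]|x]; rewrite /g /=.
- case: {-}_ / boolP => [p|p]; last by case/negP: (p).
  by congr inl; apply: val_inj.
- case: {-}_ / boolP => [p|p]; first by exfalso; move: hx; rewrite inE p.
  by congr inr; apply: val_inj.
- by case: {-}_ / boolP.
Qed.

Definition dset (I : finType) (S : {set I}) : decomp (sset S) (sset (~: S)) I :=
  Decomp (@dset_bij I S).

(* [void] is the empty set; I = ∅ ⊔ I and I = I ⊔ ∅. *)
Lemma dvoidl_bij (I : finType) :
  bijective (fun z : void + I => match z with inl s => of_void I s | inr t => t end).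
Proof. by exists inr => [[[]|]|]. Qed.
Lemma dvoidr_bij (I : finType) :
  bijective (fun z : I + void => match z with inl s => s | inr t => of_void I t end).
Proof. by exists inl => [[|[]]|]. Qed.

Definition dvoidl (I : finType) : decomp void I I := Decomp (dvoidl_bij I).
Definition dvoidr (I : finType) : decomp I void I := Decomp (dvoidr_bij I).

Record species (K : fieldType) := Species {
  spo :> finType -> lmodType K;
  act : forall S T : finType, bij S T -> {linear spo S -> spo T};
  act_id : forall S, act (bij_id S) =1 idfun;
  act_comp : forall S T U (g : bij T U) (f : bij S T),
    act (bij_o g f) =1 act g \o act f
}.

Record smorph (K : fieldType) (p q : species K) := Smorph {
  smap :> forall I : finType, {linear p I -> q I};
  smap_nat : forall (S T : finType) (f : bij S T) x,
    smap T (act p f x) = act q f (smap S x)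
}.

Definition dim1 (K : fieldType) (V : lmodType K) :=
  exists2 e : V, e != 0 & forall x, exists c, x = c *: e.

Definition connected (K : fieldType) (p : species K) := dim1 (p void).
Definition positive (K : fieldType) (p : species K) := forall x : p void, x = 0.

Record monoid_ops (K : fieldType) (p : species K) := MonoidOps {
  mu : forall S T I : finType, decomp S T I -> {linear p S ⊗ p T -> p I};
  miota : {linear K^o -> p void}
}.

Record comonoid_ops (K : fieldType) (p : species K) := ComonoidOps {
  Delta : forall S T I : finType, decomp S T I -> {linear p I -> p S ⊗ p T};
  eps : {linear p void -> K^o}
}.

Section Structures.
Variables (K : fieldType) (p : species K).


Definition restricts S T I S' T' I' (d : decomp S T I) (d' : decomp S' T' I')
    (f : bij S S') (g : bij T T') (u : bij I I') : Prop :=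
  (forall s, u (dl d s) = dl d' (f s)) /\ (forall t, u (dr d t) = dr d' (g t)).

(* U = R ⊔ S, I = U ⊔ T, V = S ⊔ T, I = R ⊔ V as subsets of I *)
Definition dassoc R S T U V I (d1 : decomp R S U) (d2 : decomp U T I)
    (e1 : decomp S T V) (e2 : decomp R V I) : Prop :=
  [/\ forall r, dl d2 (dl d1 r) = dl e2 r,
      forall s, dl d2 (dr d1 s) = dr e2 (dl e1 s)
    & forall t, dr d2 t = dr e2 (dr e1 t)].

(* S = A ⊔ B, T = C ⊔ D, S' = A ⊔ C, T' = B ⊔ D as subsets of I = S ⊔ T = S' ⊔ T'.
   This forces A = S ∩ S', B = S ∩ T', C = T ∩ S', D = T ∩ T'. *)
Definition dcross A B C D S T S' T' I
    (d : decomp S T I) (d' : decomp S' T' I)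
    (eS : decomp A B S) (eT : decomp C D T)
    (eS' : decomp A C S') (eT' : decomp B D T') : Prop :=
  [/\ forall a, dl d (dl eS a) = dl d' (dl eS' a),
      forall b, dl d (dr eS b) = dr d' (dl eT' b),
      forall c, dr d (dl eT c) = dl d' (dr eS' c)
    & forall x, dr d (dr eT x) = dr d' (dr eT' x)].

(* [mu_nat] for u = id says in particular that [mu m d] does not depend on
   the proof inside d and that S and T may be replaced by isomorphic types. *)
Record is_monoid (m : monoid_ops p) : Prop := IsMonoid {
  mu_nat : forall S T I S' T' I' (d : decomp S T I) (d' : decomp S' T' I') f g u,
    restricts d d' f g u ->
    forall x, act p u (mu m d x) = mu m d' (tmap (act p f) (act p g) x);
  mu_assoc : forall R S T U V I (d1 : decomp R S U) (d2 : decomp U T I)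
      (e1 : decomp S T V) (e2 : decomp R V I),
    dassoc d1 d2 e1 e2 ->
    forall x, mu m d2 (tmap (mu m d1) idfun x) =
              mu m e2 (tmap idfun (mu m e1) (tassoc _ _ _ x));
  mu_unitl : forall I x, mu m (dvoidl I) (tmap (miota m) idfun x) = lunit (p I) x;
  mu_unitr : forall I x, mu m (dvoidr I) (tmap idfun (miota m) x) = runit (p I) x
}.

Record is_comonoid (c : comonoid_ops p) : Prop := IsComonoid {
  Delta_nat : forall S T I S' T' I' (d : decomp S T I) (d' : decomp S' T' I') f g u,
    restricts d d' f g u ->
    forall x, Delta c d' (act p u x) = tmap (act p f) (act p g) (Delta c d x);
  Delta_coassoc : forall R S T U V I (d1 : decomp R S U) (d2 : decomp U T I)
      (e1 : decomp S T V) (e2 : decomp R V I),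
    dassoc d1 d2 e1 e2 ->
    forall x, tassoc _ _ _ (tmap (Delta c d1) idfun (Delta c d2 x)) =
              tmap idfun (Delta c e1) (Delta c e2 x);
  Delta_counitl : forall I x, lunit (p I) (tmap (eps c) idfun (Delta c (dvoidl I) x)) = x;
  Delta_counitr : forall I x, runit (p I) (tmap idfun (eps c) (Delta c (dvoidr I) x)) = x
}.

(* x ⊗ y |-> q^(|B||C|) y ⊗ x; note 0 ^+ 0 = 1. *)
Definition beta (q : K) (B C : finType) : {linear p B ⊗ p C -> p C ⊗ p B} :=
  lscale (q ^+ (#|B| * #|C|)) (tswap (p B) (p C)).

Record is_bimonoid (q : K) (m : monoid_ops p) (c : comonoid_ops p) : Prop := IsBimonoid {
  bimon_monoid : is_monoid m;
  bimon_comonoid : is_comonoid c;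
  Delta_mu : forall A B C D S T S' T' I
      (d : decomp S T I) (d' : decomp S' T' I)
      (eS : decomp A B S) (eT : decomp C D T)
      (eS' : decomp A C S') (eT' : decomp B D T'),
    dcross d d' eS eT eS' eT' ->
    forall x, Delta c d' (mu m d x) =
      tmap (mu m eS') (mu m eT')
        (tmid (p A) (p D) (beta q B C) (tmap (Delta c eS) (Delta c eT) x));
  eps_iota : forall a, eps c (miota m a) = a;
  eps_mu : forall x, eps c (mu m (dvoidl void) x) = lunit K^o (tmap (eps c) (eps c) x);
  Delta_iota : forall x : K^o ⊗ K^o,
    Delta c (dvoidl void) (miota m (lunit K^o x)) = tmap (miota m) (miota m) x
}.

(* The sums run over the subsets S of I, with T the complement of S. *)
Definition is_antipode (m : monoid_ops p) (c : comonoid_ops p) (s : smorph p p) : Prop :=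
  [/\ forall x : p void,
        \sum_(S : {set void}) mu m (dset S) (tmap idfun (s _) (Delta c (dset S) x)) =
          miota m (eps c x),
      forall x : p void,
        \sum_(S : {set void}) mu m (dset S) (tmap (s _) idfun (Delta c (dset S) x)) =
          miota m (eps c x),
      forall (I : finType) (x : p I), (0 < #|I|)%N ->
        \sum_(S : {set I}) mu m (dset S) (tmap idfun (s _) (Delta c (dset S) x)) = 0
    & forall (I : finType) (x : p I), (0 < #|I|)%N ->
        \sum_(S : {set I}) mu m (dset S) (tmap (s _) idfun (Delta c (dset S) x)) = 0].

Definition is_hopf_monoid (q : K) (m : monoid_ops p) (c : comonoid_ops p) : Prop :=
  is_bimonoid q m c /\ exists s : smorph p p, is_antipode m c s.

End Structures.

Definition is_monoid_morph (K : fieldType) (p q : species K) (m : monoid_ops p)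
    (n : monoid_ops q) (f : smorph p q) : Prop :=
  (forall S T I (d : decomp S T I) x, f I (mu m d x) = mu n d (tmap (f S) (f T) x)) /\
  (forall a, f void (miota m a) = miota n a).

Definition monoid_iso (K : fieldType) (p q : species K) (m : monoid_ops p)
    (n : monoid_ops q) : Prop :=
  exists (f : smorph p q) (g : smorph q p),
    [/\ is_monoid_morph m n f, is_monoid_morph n m g,
        forall I, cancel (f I) (g I) & forall I, cancel (g I) (f I)].

Definition is_composition (I : finType) (F : seq {set I}) : bool :=
  [&& set0 \notin F,
      pairwise (fun A B : {set I} => [disjoint A & B]) F
    & [forall x, has (fun A : {set I} => x \in A) F]].

Record composition (I : finType) := Composition {
  blocks :> seq {set I};
  blocksP : is_composition blocks
}.

HB.instance Definition _ (I : finType) := [isSub for @blocks I].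
HB.instance Definition _ (I : finType) := [Countable of composition I by <:].

Lemma size_disjoint (I : finType) (F : seq {set I}) :
  set0 \notin F -> pairwise (fun A B : {set I} => [disjoint A & B]) F ->
  (size F <= #|[set x | has (fun A : {set I} => x \in A) F]|)%N.
Proof.
elim: F => //= A F ih; rewrite in_cons negb_or => /andP[A0 F0] /andP[dA dF].
have -> : [set x | (x \in A) || has (fun A : {set I} => x \in A) F] =
  A :|: [set x | has (fun A : {set I} => x \in A) F].
  by apply/setP => x; rewrite !inE.
rewrite cardsU.
have -> : A :&: [set x | has (fun A : {set I} => x \in A) F] = set0.
  apply/setP => x; rewrite !inE; apply/negP => /andP[xA /hasP[B BF xB]].
  by have /pred0P/(_ x) := allP dA _ BF; rewrite /= xA xB.
rewrite cards0 subn0 -add1n leq_add ?ih //.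
by rewrite card_gt0 eq_sym.
Qed.

Lemma size_composition (I : finType) (F : composition I) : (size F <= #|I|)%N.
Proof.
have /and3P[h0 h1 _] := blocksP F.
by apply: leq_trans (size_disjoint h0 h1) _; exact: max_card.
Qed.

Definition comp_bseq (I : finType) (F : composition I) : #|I|.-bseq {set I} :=
  Bseq (size_composition F).
Definition bseq_comp (I : finType) (s : #|I|.-bseq {set I}) : option (composition I) := insub (s : seq _).
Lemma comp_bseqK (I : finType) : pcancel (@comp_bseq I) (@bseq_comp I).
Proof. exact: valK. Qed.
HB.instance Definition _ (I : finType) : isFinite (composition I) :=
  PCanIsFinite (@comp_bseqK I).

Definition img (S I : finType) (i : S -> I) (F : seq {set S}) : seq {set I} :=
  [seq i @: A | A : {set S} <- F].

Lemma img_disjoint (S I : finType) (i : S -> I) (F : seq {set S}) : injective i ->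
  pairwise (fun A B : {set I} => [disjoint A & B]) (img i F) =
  pairwise (fun A B : {set S} => [disjoint A & B]) F.
Proof.
move=> hi; rewrite pairwise_map; apply: eq_pairwise => A B /=.
by rewrite -!setI_eq0 -imsetI ?imset_eq0 // => x y _ _; exact: hi.
Qed.

Lemma img_set0 (S I : finType) (i : S -> I) (F : seq {set S}) : (set0 \in img i F) = (set0 \in F).
Proof.
apply/mapP/idP => [[A AF /esym/eqP]|h]; last by exists set0; rewrite ?imset0.
by rewrite imset_eq0 => /eqP <-.
Qed.

Lemma has_img (S I : finType) (i : S -> I) (F : seq {set S}) s :
  has (fun A : {set S} => s \in A) F -> has (fun A : {set I} => i s \in A) (img i F).
Proof. by case/hasP => A AF sA; apply/hasP; exists (i @: A); [exact: map_f|exact: imset_f]. Qed.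

Lemma comp_img_subproof S I (u : bij S I) (F : composition S) : is_composition (img u F).
Proof.
have /and3P[h0 h1 /forallP h2] := blocksP F.
apply/and3P; split; rewrite ?img_set0 ?img_disjoint //; first exact: inj_bij.
by apply/forallP => x; have [g _ gK] := bijP u; rewrite -(gK x); exact: has_img.
Qed.

Definition comp_img S I (u : bij S I) (F : composition S) : composition I :=
  Composition (comp_img_subproof u F).

Lemma comp_cat_subproof S T I (d : decomp S T I) (F : composition S) (G : composition T) :
  is_composition (img (dl d) F ++ img (dr d) G).
Proof.
have /and3P[f0 f1 /forallP f2] := blocksP F.
have /and3P[g0 g1 /forallP g2] := blocksP G.
apply/and3P; split.
- by rewrite mem_cat !img_set0 negb_or f0.
- rewrite pairwise_cat !img_disjoint ?f1 ?g1 ?andbT; [|exact: dr_inj|exact: dl_inj].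
  apply/allrelP => _ _ /mapP[A _ ->] /mapP[B _ ->].
  apply/pred0P => x /=; apply/negP => /andP[/imsetP[s _ ->] /imsetP[t _]].
  by move/eqP; apply/negP; exact: dlr_neq.
- apply/forallP => x; rewrite has_cat.
  by case: (decomp_cover d x) => -[y ->]; rewrite has_img // orbT.
Qed.

(* Blocks of F and G become subsets of I = S ⊔ T through the two injections. *)
Definition comp_cat S T I (d : decomp S T I) (F : composition S) (G : composition T) :
  composition I := Composition (comp_cat_subproof d F G).

Lemma comp_nil_subproof : is_composition ([::] : seq {set void}).
Proof. by apply/and3P; split=> //; apply/forallP => -[]. Qed.
Definition comp_nil : composition void := Composition comp_nil_subproof.

Lemma sset_img_bij (S I : finType) (i : S -> I) (hi : injective i) (A : {set S}) :
  bijective (fun x : sset A => Sub (i (val x)) (imset_f i (valP x)) : sset (i @: A)).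
Proof.
apply: inj_card_bij => [x y /(congr1 val)/hi/val_inj //|].
by rewrite !card_sig (eq_card (_ : _ =i i @: A)) // card_imset // (eq_card (_ : _ =i A)).
Qed.

Definition sset_img (S I : finType) (i : S -> I) (hi : injective i) (A : {set S}) :
  bij (sset A) (sset (i @: A)) := Bij (sset_img_bij hi A).

Section FreeMonoid.
Variables (K : fieldType) (q : species K).

(* q(F) is bracketed to the right and ends with a factor K:
   q[I_1] ⊗ (q[I_2] ⊗ (... ⊗ (q[I_k] ⊗ K))). *)
Fixpoint tens (I : finType) (F : seq {set I}) : lmodType K :=
  if F is A :: F' then q (sset A) ⊗ tens F' else K^o.

Fixpoint tens_img (S I : finType) (i : S -> I) (hi : injective i) (F : seq {set S}) :
    {linear tens F -> tens (img i F)} :=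
  match F return {linear tens F -> tens (img i F)} with
  | [::] => idfun
  | A :: F' => tmap (act q (sset_img hi A)) (tens_img hi F')
  end.

Fixpoint tens_cat (I : finType) (F G : seq {set I}) :
    {linear tens F ⊗ tens G -> tens (F ++ G)} :=
  match F return {linear tens F ⊗ tens G -> tens (F ++ G)} with
  | [::] => lunit (tens G)
  | A :: F' => tmap idfun (tens_cat F' G) \o tassoc (q (sset A)) (tens F') (tens G)
  end.

Definition free_obj (I : finType) : lmodType K := dsum (fun F : composition I => tens F).

Definition free_act (S I : finType) (u : bij S I) : {linear free_obj S -> free_obj I} :=
  lsum (fun F : composition S =>
    dinj (fun G : composition I => tens G) (comp_img u F) \o tens_img (inj_bij (f:=u)) F \o
    dproj (fun F : composition S => tens F) F).

Definition tcast (I : finType) (F G : seq {set I}) (e : F = G) (v : tens F) : tens G :=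
  ecast H (tens H) e v.

Lemma dinj_tcast I (F G : composition I) (e : blocks F = blocks G) (v : tens F) :
  dinj (fun H : composition I => tens H) G (tcast e v) =
  dinj (fun H : composition I => tens H) F v.
Proof.
have e' : F = G by apply: val_inj.
by subst G; rewrite (eq_irrelevance e erefl).
Qed.

Lemma act_eqid (S : finType) (u : bij S S) x : u =1 id -> act q u x = x.
Proof. by move=> h; rewrite (_ : u = bij_id S) ?act_id //; exact: bij_eq. Qed.

Lemma tcast_cons (I : finType) (A B : {set I}) (F G : seq {set I})
    (e : A :: F = B :: G) (eAB : A = B) (eFG : F = G) (a : q (sset A)) (v : tens F) :
  tcast e (a ⊠ v) = ecast H (q (sset H)) eAB a ⊠ tcast eFG v.
Proof. by subst B G; rewrite (eq_irrelevance e erefl). Qed.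

Lemma tcast_linear (I : finType) (F G : seq {set I}) (e : F = G) : linear (tcast e).
Proof. by case: G / e. Qed.
HB.instance Definition _ I F G e :=
  GRing.isLinear.Build K (tens F) (tens G) *:%R (@tcast I F G e) (@tcast_linear I F G e).

Lemma sset_cast (I J : finType) (A : {set J}) (B C : {set I})
    (b : bij (sset A) (sset B)) (c : bij (sset A) (sset C)) (e : B = C) a :
  (forall x, val (b x) = val (c x)) ->
  ecast H (q (sset H)) e (act q b a) = act q c a.
Proof.
by case: C / e c => c h; congr (act q _ a); apply: bij_eq => x; exact: val_inj.
Qed.

Lemma tens_img_id (S : finType) (i : S -> S) (hi : injective i) (F : seq {set S})
    (e : img i F = F) v : i =1 id -> tcast e (tens_img hi F v) = v.
Proof.
move=> hid; elim: F e v => [|A F ih] e v /=; first by rewrite (eq_irrelevance e erefl).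
have [eA eF] := e.
pose f : {linear tens (A :: F) -> tens (A :: F)} :=
  tcast e \o tmap (act q (sset_img hi A)) (tens_img hi F).
apply: (@tensor_ext K _ _ _ f idfun) => a w; rewrite /f /= tmapE (tcast_cons e eA eF) ih.
congr (_ ⊠ _); rewrite -[RHS](@act_id K q).
by apply: sset_cast => x /=; exact: hid.
Qed.

Lemma tens_img_comp (R S T : finType) (f : R -> S) (hf : injective f) (g : S -> T)
    (hg : injective g) (h : R -> T) (hh : injective h) (F : seq {set R})
    (e : img g (img f F) = img h F) v : h =1 g \o f ->
  tcast e (tens_img hg _ (tens_img hf F v)) = tens_img hh F v.
Proof.
move=> hE; elim: F e v => [|A F ih] e v /=; first by rewrite (eq_irrelevance e erefl).
have [eA eF] := e.
pose l : {linear tens (A :: F) -> tens (img h (A :: F))} :=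
  tcast e \o (tmap (act q (sset_img hg _)) (tens_img hg _) \o
              tmap (act q (sset_img hf A)) (tens_img hf F)).
apply: (@tensor_ext K _ _ _ l (tmap (act q (sset_img hh A)) (tens_img hh F))) => a w.
rewrite /l /= !tmapE (tcast_cons e eA eF) ih; congr (_ ⊠ _).
rewrite -[act q _ (act q _ a)]/((act q (sset_img hg _) \o act q (sset_img hf A)) a).
rewrite -act_comp.
by apply: sset_cast => x /=; rewrite hE.
Qed.

Lemma free_act_dinj (S I : finType) (u : bij S I) (F : composition S) (v : tens F) :
  free_act u (dinj (fun G : composition S => tens G) F v) =
  dinj (fun G : composition I => tens G) (comp_img u F) (tens_img (inj_bij (f:=u)) F v).
Proof.
rewrite /free_act lsumE (bigD1 F) //= dproj_dinj big1 ?addr0 // => G ne.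
by rewrite dproj_dinj_ne ?linear0 // eq_sym.
Qed.

Lemma free_ext (S : finType) (W : lmodType K) (f g : {linear free_obj S -> W}) :
  (forall (F : composition S) (v : tens F),
     f (dinj (fun G : composition S => tens G) F v) =
     g (dinj (fun G : composition S => tens G) F v)) -> f =1 g.
Proof.
by move=> h x; rewrite (dsum_dec x) !linear_sum; apply: eq_bigr => F _; exact: h.
Qed.

Lemma free_act_id (S : finType) : free_act (bij_id S) =1 idfun.
Proof.
apply: (@free_ext S _ _ idfun) => F v /=; rewrite free_act_dinj.
have e : blocks (comp_img (bij_id S) F) = blocks F.
  by rewrite /= /img -[RHS]map_id; apply: eq_map => A /=; exact: imset_id.
by rewrite -(dinj_tcast e) tens_img_id.
Qed.

Lemma free_act_comp (S T U : finType) (g : bij T U) (f : bij S T) :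
  free_act (bij_o g f) =1 free_act g \o free_act f.
Proof.
apply: (@free_ext S _ _ (free_act g \o free_act f)) => F v /=; rewrite !free_act_dinj.
have e : blocks (comp_img g (comp_img f F)) = blocks (comp_img (bij_o g f) F).
  by rewrite /= /img -map_comp; apply: eq_map => A /=; rewrite -imset_comp.
by rewrite -(dinj_tcast e) /= (tens_img_comp _ _ (inj_bij (f:=bij_o g f))).
Qed.

Definition free_species : species K := Species free_act_id free_act_comp.

Definition free_mu (S T I : finType) (d : decomp S T I) :
    {linear free_species S ⊗ free_species T -> free_species I} :=
  lsum (fun F : composition S => lsum (fun G : composition T =>
    dinj (fun H : composition I => tens H) (comp_cat d F G) \o
    tens_cat (img (dl d) F) (img (dr d) G) \o
    tmap (tens_img (@dl_inj _ _ _ d) F \o dproj (fun F : composition S => tens F) F)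
         (tens_img (@dr_inj _ _ _ d) G \o dproj (fun G : composition T => tens G) G))).

Definition free_iota : {linear K^o -> free_species void} :=
  dinj (fun F : composition void => tens F) comp_nil.

Definition free_monoid : monoid_ops free_species := MonoidOps free_mu free_iota.
End FreeMonoid.

(* The Hopf structure is irrelevant here: only the product and unit count. *)
Definition is_free (K : fieldType) (p : species K) (m : monoid_ops p) : Prop :=
  exists q : species K, positive q /\ monoid_iso m (free_monoid q).

Section Hadamard.
Variables (K : fieldType) (h k : species K).

Definition had_act (S T : finType) (f : bij S T) : {linear h S ⊗ k S -> h T ⊗ k T} :=
  tmap (act h f) (act k f).

Lemma had_act_id (S : finType) : had_act (bij_id S) =1 idfun.
Proof. by apply: (@tensor_ext K _ _ _ _ idfun) => v w; rewrite tmapE !act_id. Qed.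

Lemma had_act_comp (S T U : finType) (g : bij T U) (f : bij S T) :
  had_act (bij_o g f) =1 had_act g \o had_act f.
Proof.
apply: (@tensor_ext K _ _ _ _ (had_act g \o had_act f)) => v w.
by rewrite /had_act /= !tmapE !act_comp.
Qed.

Definition had : species K := Species had_act_id had_act_comp.

Definition had_monoid (m : monoid_ops h) (n : monoid_ops k) : monoid_ops had :=
  @MonoidOps K had
    (fun S T I d => tmap (mu m d) (mu n d) \o tmid (h S) (k T) (tswap (k S) (h T)))
    (tmap (miota m) (miota n) \o lunitV K^o).

Definition had_comonoid (c : comonoid_ops h) (d : comonoid_ops k) : comonoid_ops had :=
  @ComonoidOps K had
    (fun S T I e => tmid (h S) (k T) (tswap (h T) (k S)) \o tmap (Delta c e) (Delta d e))
    (lunit K^o \o tmap (eps c) (eps d)).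
End Hadamard.

(* Main.v *)
From HB Require Import structures.
Require Import Defs.
From mathcomp Require Import all_boot all_algebra.
From mathcomp Require Import boolp.

(** Only the product of [k] matters for the freeness of the Hadamard product, so [k] may
    be replaced by a free monoid T(q) isomorphic to it. This monoid has a coproduct of its
    own, deconcatenation: the component indexed by S, T sends a tensor over a composition
    F . G with F a composition of S and G one of T to its two halves, and kills the other
    compositions. With it T(q) is a connected 0-bimonoid
    ([free_connected_0bimonoid]). The Hadamard product of a p-bimonoid and a q-bimonoid is
    a pq-bimonoid ([had_bimonoid]), so the product of [h] and T(q) is a connected
    0-bimonoid, whatever p is, and it suffices to show that connected 0-bimonoids are free
    ([connected_0bimonoid_free]).

    Maps from a comonoid to a monoid are multiplied by convolution. If f agrees with the
    unit of convolution on the empty set ([unital]), the equation g * f = 1 can be solved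
    by recursion on the size of the set, so f is invertible ([conv_inv]). In particular a
    connected bimonoid has an antipode s, the inverse of the identity, which is the Hopf
    part of the theorem.

    Now let k be a connected 0-bimonoid. The composite of the product for S, T and the
    coproduct for U, V vanishes unless one of S, U contains the other. It follows by
    induction from s * id = 1 that s kills products of elements on nonempty sets
    ([antipode_mu]) and that its values are primitive ([Delta_antipode]): on nonempty
    sets -s is a projection onto the species P of primitive elements. Read the other
    way, s * id = 1 expresses every element through primitive ones, so a monoid morphism
    from k is determined by its restriction to P ([prim_morph_eq]). Conversely a map f
    from P to a monoid extends to a monoid morphism, the convolution inverse of 1 + f s,
    where s is taken on nonempty sets only ([prim_extend]). So k has the
    universal property of the free monoid on P. The free monoid T(P) has it too, being a
    connected 0-bimonoid whose primitive elements are its generators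
    ([free_gen_primitives]), and therefore k is isomorphic to T(P). *)

Set Implicit Arguments.
Unset Strict Implicit.
Unset Printing Implicit Defensive.

Import GRing.Theory.
Local Open Scope ring_scope.

(** * Tensor products *)

Section TensorTools.
Variable K : fieldType.
Implicit Types A B C D U V W : lmodType K.

Lemma tens_ext V W U (f g : V ⊗ W -> U) : linear f -> linear g ->
  (forall v w, f (v ⊠ w) = g (v ⊠ w)) -> f =1 g.
Proof.
move=> hf hg h.
pose F : {linear V ⊗ W -> U} := HB.pack f (GRing.isLinear.Build K _ _ *:%R f hf).
pose G : {linear V ⊗ W -> U} := HB.pack g (GRing.isLinear.Build K _ _ *:%R g hg).
exact: (@tensor_ext K V W U F G).
Qed.

Lemma tpure_linr V W (v : V) : linear (fun w : W => v ⊠ w).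
Proof. exact: (tpure_bilin V W).2. Qed.
Lemma tpure_linl V W (w : W) : linear (fun v : V => v ⊠ w).
Proof. exact: (tpure_bilin V W).1. Qed.

Lemma tpure0l V W (w : W) : (0 : V) ⊠ w = 0.
Proof. exact: (bilin0l (tpure_bilin V W)). Qed.
Lemma tpure0r V W (v : V) : v ⊠ (0 : W) = 0.
Proof. exact: (bilin0r (tpure_bilin V W)). Qed.
Lemma tpureZl V W c (v : V) (w : W) : (c *: v) ⊠ w = c *: (v ⊠ w).
Proof. exact: (bilinZl (tpure_bilin V W)). Qed.
Lemma tpureZr V W c (v : V) (w : W) : v ⊠ (c *: w) = c *: (v ⊠ w).
Proof. exact: (bilinZr (tpure_bilin V W)). Qed.

Lemma tpure_suml V W (J : finType) (P : pred J) (v : J -> V) (w : W) :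
  (\sum_(j | P j) v j) ⊠ w = \sum_(j | P j) v j ⊠ w.
Proof.
apply: (big_morph (fun x : V => x ⊠ w)); last exact: tpure0l.
exact: (fun x y => bilinDl (tpure_bilin V W) x y w).
Qed.
Lemma tpure_sumr V W (J : finType) (P : pred J) (v : V) (w : J -> W) :
  v ⊠ (\sum_(j | P j) w j) = \sum_(j | P j) v ⊠ w j.
Proof.
apply: (big_morph (fun x : W => v ⊠ x)); last exact: tpure0r.
exact: (bilinDr (tpure_bilin V W)).
Qed.

End TensorTools.

(* Proves that a map built from linear maps and pure tensors is linear. *)
Ltac solve_linear := let a := fresh "a" in let x := fresh "x" in let y := fresh "y" in
  move=> a x y /=; rewrite ?(tpure_linl, tpure_linr, linearP) //=.

Section TensorMaps.
Variable K : fieldType.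
Implicit Types A B C D U V W : lmodType K.

Lemma tens_ext3 A B C U (f g : (A ⊗ B) ⊗ C -> U) : linear f -> linear g ->
  (forall a b c, f ((a ⊠ b) ⊠ c) = g ((a ⊠ b) ⊠ c)) -> f =1 g.
Proof.
move=> hf hg h; apply: tens_ext => // t c; move: t.
by apply: tens_ext => [a x y|a x y|a b] //=; rewrite tpure_linl ?hf ?hg.
Qed.

Lemma tens_ext4 A B C D U (f g : (A ⊗ B) ⊗ (C ⊗ D) -> U) : linear f -> linear g ->
  (forall a b c d, f ((a ⊠ b) ⊠ (c ⊠ d)) = g ((a ⊠ b) ⊠ (c ⊠ d))) -> f =1 g.
Proof.
move=> hf hg h; apply: tens_ext3 => // a b t; move: t.
by apply: tens_ext => [x y z|x y z|c d] //=; rewrite tpure_linr ?hf ?hg.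
Qed.

(** Bilinear expressions in two tensors, such as the two coproducts that enter the
    coproduct of a Hadamard product, may be compared on pairs of pure tensors. *)
Lemma tens_ext2 A B C D U (f g : A ⊗ B -> C ⊗ D -> U) :
  (forall t, linear (f^~ t)) -> (forall s, linear (f s)) ->
  (forall t, linear (g^~ t)) -> (forall s, linear (g s)) ->
  (forall a b c d, f (a ⊠ b) (c ⊠ d) = g (a ⊠ b) (c ⊠ d)) -> forall s t, f s t = g s t.
Proof.
move=> f1 f2 g1 g2 h s t; move: s; apply: tens_ext => // a b; move: t.
by apply: tens_ext.
Qed.

Lemma tmap_ext V V' W W' (f f' : {linear V -> V'}) (g g' : {linear W -> W'}) :
  f =1 f' -> g =1 g' -> tmap f g =1 tmap f' g'.
Proof. by move=> hf hg; apply: tensor_ext => v w; rewrite !tmapE hf hg. Qed.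

Lemma tmap_comp V V' V'' W W' W'' (f : {linear V -> V'}) (f' : {linear V' -> V''})
  (g : {linear W -> W'}) (g' : {linear W' -> W''}) t :
  tmap f' g' (tmap f g t) = tmap (f' \o f) (g' \o g) t.
Proof. by move: t; apply: tens_ext => [||v w]; [solve_linear|solve_linear|rewrite !tmapE]. Qed.

Lemma tmap_id V W t : tmap (idfun : {linear V -> V}) (idfun : {linear W -> W}) t = t.
Proof. by move: t; apply: tens_ext => [||v w]; [solve_linear|solve_linear|rewrite !tmapE]. Qed.

Lemma tmap_suml V V' W W' (J : finType) (P : pred J) (F : J -> {linear V -> V'})
    (f : {linear V -> V'}) (g : {linear W -> W'}) t :
  (forall y, f y = \sum_(j | P j) F j y) -> tmap f g t = \sum_(j | P j) tmap (F j) g t.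
Proof.
move=> h; move: t; apply: tens_ext => [||v w]; first by solve_linear.
  move=> a y z; rewrite scaler_sumr -big_split.
  by apply: eq_bigr => j _; rewrite linearP.
rewrite tmapE h /=; under [in RHS]eq_bigr do rewrite tmapE.
exact: tpure_suml.
Qed.

Lemma tmap0l V V' W W' (f : {linear V -> V'}) (g : {linear W -> W'}) t :
  (forall y, f y = 0) -> tmap f g t = 0.
Proof.
move=> h; move: t; apply: (@tensor_ext _ _ _ _ _ \0) => v w.
by rewrite tmapE h tpure0l.
Qed.

Lemma tmap0r V V' W W' (f : {linear V -> V'}) (g : {linear W -> W'}) t :
  (forall y, g y = 0) -> tmap f g t = 0.
Proof.
move=> h; move: t; apply: (@tensor_ext _ _ _ _ _ \0) => v w.
by rewrite tmapE h tpure0r.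
Qed.

Lemma tmap_sumr V V' W W' (J : finType) (P : pred J) (F : J -> {linear W -> W'})
    (f : {linear V -> V'}) (g : {linear W -> W'}) t :
  (forall y, g y = \sum_(j | P j) F j y) -> tmap f g t = \sum_(j | P j) tmap f (F j) t.
Proof.
move=> h; move: t; apply: tens_ext => [||v w]; first by solve_linear.
  move=> a y z; rewrite scaler_sumr -big_split.
  by apply: eq_bigr => j _; rewrite linearP.
rewrite tmapE h /=; under [in RHS]eq_bigr do rewrite tmapE.
exact: tpure_sumr.
Qed.

Lemma tassoc_map U U' V V' W W' (f : {linear U -> U'})
    (g : {linear V -> V'}) (h : {linear W -> W'}) t :
  tassoc _ _ _ (tmap (tmap f g) h t) = tmap f (tmap g h) (tassoc _ _ _ t).
Proof.
move: t; apply: tens_ext => [||t w]; [solve_linear|solve_linear|].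
move: t; apply: tens_ext => [||u v].
- by move=> a x y; rewrite tpure_linl !linearP.
- by move=> a x y; rewrite tpure_linl !linearP.
- by rewrite !(tmapE, tassocE).
Qed.

End TensorMaps.

(** * Decompositions of a finite set *)

Lemma inj_surj_bij (S T : Type) (f : S -> T) :
  injective f -> (forall y, exists x, f x = y) -> bijective f.
Proof.
move=> fi fs; exists (fun y => sval (cid (fs y))) => x.
- by case: (cid _) => z /= /fi.
- by case: (cid _).
Qed.

Lemma bij_inv_ex (S T : finType) (f : bij S T) :
  exists g : bij T S, cancel f g /\ cancel g f.
Proof. by case: (bijP f) => g fK gK; exists (Bij (Bijective gK fK)). Qed.

Definition left_part S T I (d : decomp S T I) : {set I} := dl d @: [set: S].

Lemma mem_dl S T I (d : decomp S T I) s : dl d s \in left_part d.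
Proof. by rewrite imset_f ?inE. Qed.
Lemma mem_dr S T I (d : decomp S T I) t : (dr d t \in left_part d) = false.
Proof. by apply/negP => /imsetP[s _ /esym/eqP]; apply/negP; exact: dlr_neq. Qed.

Lemma decomp_mk S T (I : finType) (l : S -> I) (r : T -> I) :
  injective l -> injective r -> (forall s t, l s <> r t) ->
  (forall i, (exists s, i = l s) \/ (exists t, i = r t)) ->
  bijective (fun z : S + T => match z with inl s => l s | inr t => r t end).
Proof.
move=> li ri lr cov; apply: inj_surj_bij.
- move=> [s|t] [s'|t'] // e; first by rewrite (li _ _ e).
  + by case: (lr _ _ e).
  + by case: (lr _ _ (esym e)).
  + by rewrite (ri _ _ e).
- by move=> i; case: (cov i) => -[x ->]; [exists (inl x)|exists (inr x)].
Qed.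

Lemma left_part_dset (I : finType) (S : {set I}) : left_part (dset S) = S.
Proof.
apply/setP => x; apply/imsetP/idP => [[s _ ->]|h]; first exact: (valP s).
by exists (Sub x h).
Qed.

Lemma card_decomp S T I (d : decomp S T I) : #|I| = (#|S| + #|T|)%N.
Proof. by rewrite -card_sum (bij_eq_card (decompP d)). Qed.

Lemma dsum_bij (S T : finType) :
  bijective (fun z : S + T => match z with inl s => inl T s | inr t => inr S t end).
Proof. by exists id; case. Qed.

Definition dcoprod (S T : finType) : decomp S T (S + T)%type := Decomp (@dsum_bij S T).

Section Refine.
Variables (R S T U V I : finType).

Lemma refine_l_bij (d1 : decomp R S U) (d2 : decomp U T I) :
  bijective (fun z : R + (S + T) => match z with
    | inl r => dl d2 (dl d1 r)
    | inr v => match v with inl s => dl d2 (dr d1 s) | inr t => dr d2 t end end).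
Proof.
apply: decomp_mk.
- by move=> x y /dl_inj/dl_inj.
- move=> [x|x] [y|y] //; first by move/dl_inj/dr_inj => ->.
  + by move/eqP; rewrite (negbTE (dlr_neq d2 _ _)).
  + by move/esym/eqP; rewrite (negbTE (dlr_neq d2 _ _)).
  + by move/dr_inj => ->.
- move=> r [s|t].
  + by move/dl_inj/eqP; rewrite (negbTE (dlr_neq d1 _ _)).
  + by move/eqP; rewrite (negbTE (dlr_neq d2 _ _)).
- move=> i; case: (decomp_cover d2 i) => -[u ->]; last by right; exists (inr u).
  by case: (decomp_cover d1 u) => -[x ->]; [left; exists x|right; exists (inl x)].
Qed.

(** The complement of [R] is the sum type [S + T] rather than a subset of [I], which
    makes associativity available for any two nested decompositions. *)
Definition refine_l d1 d2 : decomp R (S + T)%type I := Decomp (refine_l_bij d1 d2).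

Lemma refine_lP d1 d2 : dassoc d1 d2 (dcoprod S T) (refine_l d1 d2).
Proof. by []. Qed.

Lemma refine_r_bij (e1 : decomp S T V) (e2 : decomp R V I) :
  bijective (fun z : (R + S) + T => match z with
    | inl u => match u with inl r => dl e2 r | inr s => dr e2 (dl e1 s) end
    | inr t => dr e2 (dr e1 t) end).
Proof.
apply: decomp_mk.
- move=> [x|x] [y|y] //; first by move/dl_inj => ->.
  + by move/eqP; rewrite (negbTE (dlr_neq e2 _ _)).
  + by move/esym/eqP; rewrite (negbTE (dlr_neq e2 _ _)).
  + by move/dr_inj/dl_inj => ->.
- by move=> x y /dr_inj/dr_inj.
- move=> [r|s] t.
  + by move/eqP; rewrite (negbTE (dlr_neq e2 _ _)).
  + by move/dr_inj/eqP; rewrite (negbTE (dlr_neq e1 _ _)).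
- move=> i; case: (decomp_cover e2 i) => -[u ->]; first by left; exists (inl u).
  by case: (decomp_cover e1 u) => -[x ->]; [left; exists (inr x)|right; exists x].
Qed.

Definition refine_r e1 e2 : decomp (R + S)%type T I := Decomp (refine_r_bij e1 e2).

Lemma refine_rP e1 e2 : dassoc (dcoprod R S) (refine_r e1 e2) e1 e2.
Proof. by []. Qed.
End Refine.

(** A decomposition is determined, up to relabelling its two parts, by the image of
    its left part; this is what lets the subsets of [I] index all of them. *)
Lemma restricts_ex S T I S' T' I' (d : decomp S T I) (d' : decomp S' T' I')
    (u : bij I I') : u @: left_part d = left_part d' ->
  exists f g, restricts d d' f g u.
Proof.
move=> e.
have hl s : exists s', u (dl d s) = dl d' s'.
  have : u (dl d s) \in left_part d' by rewrite -e imset_f ?mem_dl.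
  by case/imsetP => s' _ ->; exists s'.
have hr t : exists t', u (dr d t) = dr d' t'.
  case: (decomp_cover d' (u (dr d t))) => -[x hx]; last by exists x.
  have : u (dr d t) \in u @: left_part d by rewrite e hx mem_dl.
  by case/imsetP => y yd /inj_bij h; move: yd; rewrite -h mem_dr.
have bf : bijective (fun s => sval (cid (hl s))).
  apply: inj_surj_bij => [x y|s'].
    by case: (cid _) => z /= hz; case: (cid _) => w /= hw zw; apply: (@dl_inj _ _ _ d);
      apply: (@inj_bij _ _ u); rewrite hz hw zw.
  have : dl d' s' \in u @: left_part d by rewrite e mem_dl.
  case/imsetP => _ /imsetP[s _ ->] hs; exists s; case: (cid _) => z /= hz.
  by apply: (@dl_inj _ _ _ d'); rewrite -hz hs.
have bg : bijective (fun t => sval (cid (hr t))).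
  apply: inj_surj_bij => [x y|t'].
    by case: (cid _) => z /= hz; case: (cid _) => w /= hw zw; apply: (@dr_inj _ _ _ d);
      apply: (@inj_bij _ _ u); rewrite hz hw zw.
  have [v uK vK] := bijP u.
  case: (decomp_cover d (v (dr d' t'))) => -[x hx].
    have : dr d' t' \in u @: left_part d by rewrite -(vK (dr d' t')) hx imset_f ?mem_dl.
    by rewrite e mem_dr.
  exists x; case: (cid _) => z /= hz.
  by apply: (@dr_inj _ _ _ d'); rewrite -hz -hx vK.
exists (Bij bf), (Bij bg); split => x /=; by case: (cid _).
Qed.

Lemma bij_id_img (I : finType) (A : {set I}) : bij_id I @: A = A.
Proof. exact: imset_id. Qed.

(** * Convolution of morphisms of species *)

Section Species.
Variables (K : fieldType) (p : species K).

Lemma act1 I (x : p I) : act p (bij_id I) x = x.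
Proof. exact: act_id. Qed.

Lemma act_id1 I (u : bij I I) x : u =1 id -> act p u x = x.
Proof.
move=> h; have -> : u = bij_id I by apply: Defs.bij_eq => z; rewrite h.
by rewrite act_id.
Qed.

Lemma act_o S T U (g : bij T U) (f : bij S T) x :
  act p g (act p f x) = act p (bij_o g f) x.
Proof. by rewrite act_comp. Qed.

Lemma act_cancel S T (f : bij S T) (g : bij T S) : cancel f g ->
  cancel (act p f) (act p g).
Proof. by move=> h x; rewrite act_o act_id1. Qed.

Definition smorph_id : smorph p p :=
  @Smorph K p p (fun I => idfun) (fun S T f x => erefl).
End Species.

Section SmorphOps.
Variables (K : fieldType) (p q : species K).

Lemma smorph_sub_nat (f g : smorph p q) S T (u : bij S T) x :
  (f T \- g T) (act p u x) = act q u ((f S \- g S) x).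
Proof. by rewrite /= !smap_nat linearB. Qed.

Definition smorph_sub (f g : smorph p q) : smorph p q :=
  @Smorph K p q (fun I => f I \- g I) (smorph_sub_nat f g).

Lemma smorph_comp_nat (r : species K) (g : smorph q r) (f : smorph p q) S T (u : bij S T) x :
  (g T \o f T) (act p u x) = act r u ((g S \o f S) x).
Proof. by rewrite /= !smap_nat. Qed.

Definition smorph_comp (r : species K) (g : smorph q r) (f : smorph p q) : smorph p r :=
  @Smorph K p r (fun I => g I \o f I) (smorph_comp_nat g f).

End SmorphOps.

Definition bij_inv S T (u : bij S T) : bij T S := sval (cid (bij_inv_ex u)).
Lemma bij_invK S T (u : bij S T) : cancel u (bij_inv u).
Proof. by rewrite /bij_inv; case: (cid _) => v []. Qed.
Lemma bij_invVK S T (u : bij S T) : cancel (bij_inv u) u.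
Proof. by rewrite /bij_inv; case: (cid _) => v []. Qed.

Lemma card0_void_bij (I : finType) : #|I| = 0%N -> bijective (of_void I).
Proof. by move=> h; apply: inj_card_bij; rewrite ?h ?card_void //; case. Qed.

Definition void_bij (I : finType) (e : #|I| = 0%N) : bij void I := Bij (card0_void_bij e).

Lemma void_bij_eq (I : finType) (u v : bij void I) : u = v.
Proof. by apply: Defs.bij_eq; case. Qed.

Lemma bij_card S T (u : bij S T) : #|S| = #|T|.
Proof. exact: bij_eq_card (bijP u). Qed.

(** Recursion on the size of the set: the value at a set of size n comes from
    iterating the clause n + 1 times from zero, and is natural because the clause
    preserves naturality. *)
Lemma smorph_rec (K : fieldType) (p q : species K)
    (Phi : (forall I, {linear p I -> q I}) -> forall I, {linear p I -> q I}) :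
  (forall (g g' : forall I, {linear p I -> q I}) (I : finType),
     (forall J : finType, (#|J| < #|I|)%N -> g J =1 g' J) -> Phi g I =1 Phi g' I) ->
  (forall (g : forall I, {linear p I -> q I}) (S T : finType) (u : bij S T),
     (forall (J J' : finType) (v : bij J J') x, (#|J| < #|S|)%N ->
        g J' (act p v x) = act q v (g J x)) ->
     forall x, Phi g T (act p u x) = act q u (Phi g S x)) ->
  exists s : smorph p q, forall I, s I =1 Phi s I.
Proof.
move=> Pext Pnat; pose s n := iter n Phi (fun=> \0).
have sn n : forall k (I : finType), (#|I| < n)%N -> (#|I| < k)%N -> s n I =1 s k I.
  elim: n => // n ih [|k] I //=; rewrite !ltnS => hn hk.
  by apply: Pext => J hJ; apply: ih; apply: leq_trans hJ _.
pose t (I : finType) : {linear p I -> q I} := s #|I|.+1 I.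
have tE n (I : finType) : (#|I| < n)%N -> s n I =1 t I by move=> h; exact: sn.
have tP I : t I =1 Phi t I by rewrite /t /=; apply: Pext => J hJ; exact: tE.
have tnat n : forall (S T : finType) (u : bij S T), (#|S| < n)%N ->
    forall x, t T (act p u x) = act q u (t S x).
  elim: n => // n ih S T u hS x; rewrite !tP; apply: Pnat => J J' v y hJ.
  by apply: ih; apply: leq_trans hJ _.
by exists (@Smorph K p q t (fun S T u => tnat #|S|.+1 S T u (leqnn _))) => I; exact: tP.
Qed.

Section Conv.
Implicit Types I J R S T U V : finType.
Variables (K : fieldType) (p q : species K) (c : comonoid_ops p) (m : monoid_ops q).
Hypotheses (Hc : is_comonoid c) (Hm : is_monoid m).

(** The summand of a convolution product at one decomposition. Its two maps need not
    come from morphisms of species, so that summands can be nested. *)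
Definition conv_at S T I (d : decomp S T I) (f : {linear p S -> q S})
    (g : {linear p T -> q T}) : {linear p I -> q I} :=
  locked_with linear_key (mu m d \o tmap f g \o Delta c d : {linear p I -> q I}).

Lemma conv_atE S T I (d : decomp S T I) f g x : conv_at d f g x = mu m d (tmap f g (Delta c d x)).
Proof. by rewrite /conv_at unlock. Qed.

Lemma conv_at_ext S T I (d : decomp S T I) (f f' : {linear p S -> q S})
    (g g' : {linear p T -> q T}) : f =1 f' -> g =1 g' ->
  conv_at d f g =1 conv_at d f' g'.
Proof. by move=> hf hg x; rewrite !conv_atE (tmap_ext hf hg). Qed.

Lemma conv_at_nat S T I S' T' I' (d : decomp S T I) (d' : decomp S' T' I') a b u
    (f : {linear p S -> q S}) (g : {linear p T -> q T})
    (f' : {linear p S' -> q S'}) (g' : {linear p T' -> q T'}) : restricts d d' a b u ->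
  (forall z, f' (act p a z) = act q a (f z)) ->
  (forall z, g' (act p b z) = act q b (g z)) ->
  forall x, conv_at d' f' g' (act p u x) = act q u (conv_at d f g x).
Proof.
move=> r hf hg x; rewrite !conv_atE (Delta_nat Hc r) (mu_nat Hm r).
by rewrite !tmap_comp; congr (mu _ _ _); apply: tmap_ext.
Qed.

(** By naturality of the product and the coproduct, a summand can be computed at any
    decomposition with the right left part; sum types may thus replace subsets of I. *)
Lemma conv_at_img S T I S' T' (d : decomp S T I) (d' : decomp S' T' I) (f g : smorph p q) :
  left_part d = left_part d' -> conv_at d (f S) (g T) =1 conv_at d' (f S') (g T').
Proof.
move=> e x; have [|a [b r]] := @restricts_ex _ _ _ _ _ _ d d' (bij_id I).
  by rewrite bij_id_img.
by have := conv_at_nat r (smap_nat f a) (smap_nat g b) x; rewrite !act_id.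
Qed.

Definition conv (f g : smorph p q) I : {linear p I -> q I} :=
  lsum (fun S : {set I} => conv_at (dset S) (f _) (g _)).

Lemma convE f g I x : conv f g I x = \sum_(S : {set I}) conv_at (dset S) (f _) (g _) x.
Proof. exact: lsumE. Qed.

Lemma conv_ext (f f' g g' : smorph p q) : (forall I, f I =1 f' I) -> (forall I, g I =1 g' I) ->
  forall I, conv f g I =1 conv f' g' I.
Proof. by move=> hf hg I x; rewrite !convE; apply: eq_bigr => S _; exact: conv_at_ext. Qed.

Lemma imset_bij_bij (I J : finType) (u : bij I J) :
  bijective (fun S : {set I} => u @: S).
Proof.
have [v [uK vK]] := bij_inv_ex u; exists (fun S : {set J} => v @: S) => S;
  by rewrite -imset_comp -[RHS]imset_id; apply: eq_imset => x /=.
Qed.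

Lemma conv_nat f g S T (u : bij S T) x :
  conv f g T (act p u x) = act q u (conv f g S x).
Proof.
rewrite !convE linear_sum (reindex _ (onW_bij _ (imset_bij_bij u))) /=.
apply: eq_bigr => A _.
have [|a [b r]] := @restricts_ex _ _ _ _ _ _ (dset A) (dset (u @: A)) u.
  by rewrite !left_part_dset.
exact: (conv_at_nat r (smap_nat f a) (smap_nat g b)).
Qed.

Definition conv_smorph f g : smorph p q := Smorph (@conv_nat f g).

(** The unit of convolution; an empty set need not be [void] itself, hence the
    relabelling. *)
Definition conv_unit_fun I : {linear p I -> q I} :=
  match @eqP _ #|I| 0%N with
  | ReflectT e => act q (void_bij e) \o miota m \o eps c \o act p (bij_inv (void_bij e))
  | ReflectF _ => \0
  end.

Lemma conv_unit_void I (u : bij void I) x :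
  conv_unit_fun I (act p u x) = act q u (miota m (eps c x)).
Proof.
rewrite /conv_unit_fun; case: eqP => [e|[]]; last by rewrite -(bij_card u) card_void.
by rewrite (void_bij_eq u (void_bij e)) /= act_cancel //; exact: bij_invK.
Qed.

Lemma conv_unit_n0 (I : finType) x : (0 < #|I|)%N -> conv_unit_fun I x = 0.
Proof. by rewrite /conv_unit_fun lt0n; case: eqP. Qed.

Lemma conv_unit_nat S T (u : bij S T) x :
  conv_unit_fun T (act p u x) = act q u (conv_unit_fun S x).
Proof.
have [S0|S1] := posnP #|S|; last by rewrite !conv_unit_n0 ?linear0 // -(bij_card u).
pose v := void_bij S0; rewrite -(act_cancel (bij_invVK v) x).
by rewrite act_o !conv_unit_void act_o.
Qed.

Definition conv_unit : smorph p q := Smorph conv_unit_nat.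

Lemma conv_unitE x : conv_unit void x = miota m (eps c x).
Proof. by have := conv_unit_void (bij_id void) x; rewrite !act_id. Qed.

Definition unital (f : smorph p q) := forall x, f void x = miota m (eps c x).

Lemma unital_eq (f : smorph p q) (I : finType) : unital f -> #|I| = 0%N ->
  f I =1 conv_unit I.
Proof.
move=> hf I0 x; pose v := void_bij I0.
rewrite -(act_cancel (bij_invVK v) x); move: (act p _ x) => y.
by rewrite !smap_nat hf conv_unitE.
Qed.

Lemma left_part_dvoidl I : left_part (dvoidl I) = set0.
Proof. by apply/setP => x; rewrite inE; apply/imsetP => -[[]]. Qed.
Lemma left_part_dvoidr I : left_part (dvoidr I) = setT.
Proof. by apply/setP => x; rewrite inE; apply/imsetP; exists x. Qed.

(** Unitality of [f] turns this summand into the counit law of [c] followed by the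
    unit law of [m]. *)
Lemma conv_at_set0 S T I (d : decomp S T I) (f g : smorph p q) x : unital f -> left_part d = set0 ->
  conv_at d (f S) (g T) x = g I x.
Proof.
move=> hf e; rewrite (@conv_at_img _ _ _ _ _ d (dvoidl I)) ?left_part_dvoidl // conv_atE.
rewrite -[RHS](congr1 (g I) (Delta_counitl Hc x)); move: (Delta c _ x) => t.
rewrite -[RHS]/((g I \o lunit (p I) \o tmap (eps c) idfun) t).
rewrite -[LHS]/((mu m (dvoidl I) \o tmap (f void) (g I)) t).
move: t; apply: tensor_ext => v w /=; rewrite !tmapE hf lunitE linearZ /=.
have := mu_unitl Hm (eps c v ⊠ g I w).
by rewrite tmapE lunitE.
Qed.

Lemma conv_at_setT S T I (d : decomp S T I) (f g : smorph p q) x : unital g -> left_part d = setT ->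
  conv_at d (f S) (g T) x = f I x.
Proof.
move=> hf e; rewrite (@conv_at_img _ _ _ _ _ d (dvoidr I)) ?left_part_dvoidr // conv_atE.
rewrite -[RHS](congr1 (f I) (Delta_counitr Hc x)); move: (Delta c _ x) => t.
rewrite -[RHS]/((f I \o runit (p I) \o tmap idfun (eps c)) t).
rewrite -[LHS]/((mu m (dvoidr I) \o tmap (f I) (g void)) t).
move: t; apply: tensor_ext => v w /=; rewrite !tmapE hf runitE linearZ /=.
have := mu_unitr Hm (f I v ⊠ eps c w).
by rewrite tmapE runitE.
Qed.

Lemma conv_unit_unital : unital conv_unit. Proof. exact: conv_unitE. Qed.

Lemma conv_unitl f I : conv conv_unit f I =1 f I.
Proof.
move=> x; rewrite convE (bigD1 set0) // conv_at_set0 ?left_part_dset //;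
  last exact: conv_unit_unital.
rewrite big1 => [|S Sn0]; first exact: addr0.
rewrite conv_atE tmap0l ?linear0 // => y; apply: conv_unit_n0.
by rewrite card_sig (eq_card (_ : _ =i S)) // card_gt0.
Qed.

Lemma conv_unitr f I : conv f conv_unit I =1 f I.
Proof.
move=> x; rewrite convE (bigD1 setT) // conv_at_setT ?left_part_dset //;
  last exact: conv_unit_unital.
rewrite big1 => [|S SnT]; first exact: addr0.
rewrite conv_atE tmap0r ?linear0 // => y; apply: conv_unit_n0.
rewrite card_sig (eq_card (_ : _ =i ~: S)) // card_gt0.
by apply: contra SnT => /eqP e; rewrite -(setCK S) e setC0.
Qed.

End Conv.

Lemma sum_preimset (V : nmodType) (S I : finType) (i : S -> I) (G : {set S} -> V) :
  injective i ->
  \sum_(R : {set S}) G R = \sum_(A : {set I} | A \subset i @: setT) G (i @^-1: A).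
Proof.
move=> hi.
have iK (R : {set S}) : i @^-1: (i @: R) = R.
  by apply/setP => x; rewrite inE mem_imset.
rewrite (reindex_onto (fun A : {set I} => i @^-1: A) (fun R => i @: R)) //=.
apply: eq_bigl => A; apply/eqP/idP => [<-|/subsetP hA].
  by apply: imsetS; apply: subsetT.
apply/setP => y; apply/imsetP/idP => [[x]|yA]; first by rewrite inE => ? ->.
by have /imsetP[x _ e] := hA _ yA; exists x; rewrite // inE -e.
Qed.

(** The subsets B of the complement of A correspond to the sets C containing A, as C =
    A + B. *)
Lemma sum_preimset_compl (V : nmodType) (I : finType) (A : {set I})
    (G : {set sset (~: A)} -> V) :
  \sum_(B : {set sset (~: A)}) G B = \sum_(C : {set I} | A \subset C) G (val @^-1: C).
Proof.
have AnC (B : {set sset (~: A)}) : val @^-1: (A :|: val @: B) = B.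
  apply/setP => x; rewrite !inE mem_imset; last exact: val_inj.
  by have /= := valP x; rewrite inE => /negbTE ->.
rewrite (reindex_onto (fun C : {set I} => val @^-1: C) (fun B => A :|: val @: B)) //=.
apply: eq_bigl => C; apply/eqP/idP => [<-|hA]; first exact: subsetUl.
apply/setP => y; rewrite inE; case: (boolP (y \in A)) => [yA|yA] /=.
  by rewrite (subsetP hA).
apply/imsetP/idP => [[x]|yC]; first by rewrite inE => ? ->.
have yA' : y \in ~: A by rewrite inE.
by exists (Sub y yA'); rewrite ?inE.
Qed.

Section ConvAssoc.
Implicit Types I J R S T U V : finType.
Variables (K : fieldType) (p q : species K) (c : comonoid_ops p) (m : monoid_ops q).
Hypotheses (Hc : is_comonoid c) (Hm : is_monoid m).

Lemma conv_at_suml S T I (d : decomp S T I) (J : finType) (P : pred J)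
    (F : J -> {linear p S -> q S}) (f : {linear p S -> q S}) (g : {linear p T -> q T}) x :
  (forall y, f y = \sum_(j | P j) F j y) ->
  conv_at c m d f g x = \sum_(j | P j) conv_at c m d (F j) g x.
Proof.
move=> h; rewrite conv_atE (tmap_suml _ _ h) linear_sum.
by apply: eq_bigr => j _; rewrite conv_atE.
Qed.

Lemma conv_at_sumr S T I (d : decomp S T I) (J : finType) (P : pred J)
    (F : J -> {linear p T -> q T}) (f : {linear p S -> q S}) (g : {linear p T -> q T}) x :
  (forall y, g y = \sum_(j | P j) F j y) ->
  conv_at c m d f g x = \sum_(j | P j) conv_at c m d f (F j) x.
Proof.
move=> h; rewrite conv_atE (tmap_sumr _ _ h) linear_sum.
by apply: eq_bigr => j _; rewrite conv_atE.
Qed.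

Lemma conv_at_assoc R S T U V I (d1 : decomp R S U) (d2 : decomp U T I)
    (e1 : decomp S T V) (e2 : decomp R V I) (f : {linear p R -> q R})
    (g : {linear p S -> q S}) (h : {linear p T -> q T}) : dassoc d1 d2 e1 e2 ->
  conv_at c m d2 (conv_at c m d1 f g) h =1 conv_at c m e2 f (conv_at c m e1 g h).
Proof.
move=> hd x; rewrite !conv_atE.
have -> : tmap (conv_at c m d1 f g) h (Delta c d2 x) =
   tmap (mu m d1) idfun (tmap (tmap f g) h (tmap (Delta c d1) idfun (Delta c d2 x))).
  by rewrite !tmap_comp; apply: tmap_ext => y; rewrite /= ?conv_atE.
rewrite (mu_assoc Hm hd) tassoc_map (Delta_coassoc Hc hd) !tmap_comp.
by congr (mu _ _ _); apply: tmap_ext => y; rewrite /= ?conv_atE.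
Qed.

(** Reassociating a nested summand and then relabelling it, so that only the subsets
    cut out by the inner decompositions matter. *)
Lemma conv_at_assoc_img R S T U V I R' S' T' V' (d1 : decomp R S U) (d2 : decomp U T I)
    (e1 : decomp S T V) (e2 : decomp R V I) (e1' : decomp S' T' V') (e2' : decomp R' V' I)
    (f g h : smorph p q) : dassoc d1 d2 e1 e2 -> left_part e2 = left_part e2' ->
    dr e2 @: left_part e1 = dr e2' @: left_part e1' ->
  conv_at c m d2 (conv_at c m d1 (f _) (g _)) (h _) =1
  conv_at c m e2' (f _) (conv_at c m e1' (g _) (h _)).
Proof.
move=> hd i2 i1 x; rewrite (conv_at_assoc _ _ _ hd).
have [|a [w [r1 r2]]] := @restricts_ex _ _ _ _ _ _ e2 e2' (bij_id I).
  by rewrite bij_id_img.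
have [|b [b' r]] := @restricts_ex _ _ _ _ _ _ e1 e1' w.
  apply: (@imset_inj _ _ (dr e2')); first exact: dr_inj.
  by rewrite -imset_comp -i1; apply: eq_imset => y /=; rewrite -r2.
have := @conv_at_nat K p q c m Hc Hm _ _ _ _ _ _ e2 e2' a w (bij_id I)
  (f _) (conv_at c m e1 (g _) (h _)) (f _) (conv_at c m e1' (g _) (h _)) (conj r1 r2)
  (smap_nat f a) _ x.
rewrite !act_id => -> //.
exact: (conv_at_nat Hc Hm r (smap_nat g b) (smap_nat h b')).
Qed.

(** Both sides are sums over the flags A, C of subsets of I with A contained in C: on
    the left C is chosen first, on the right A is. *)
Lemma conv_assoc (f g h : smorph p q) I :
  conv c m (conv_smorph Hc Hm f g) h I =1 conv c m f (conv_smorph Hc Hm g h) I.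
Proof.
move=> x; rewrite !convE.
transitivity (\sum_(C : {set I}) \sum_(A : {set I} | A \subset C)
   conv_at c m (dset C) (conv_at c m (dset (val @^-1: A : {set sset C})) (f _) (g _)) (h _) x).
  apply: eq_bigr => C _.
  rewrite (conv_at_suml (P := predT)
    (F := fun R : {set sset C} => conv_at c m (dset R) (f _) (g _)) _ _ _);
    last exact: convE.
  rewrite (sum_preimset _ (i := val)); last exact: val_inj.
  by apply: eq_bigl => A; rewrite -/(left_part (dset C)) left_part_dset.
rewrite (exchange_big_dep predT) //=; apply: eq_bigr => A _.
rewrite (conv_at_sumr (P := predT)
  (F := fun R : {set sset (~: A)} => conv_at c m (dset R) (g _) (h _)) _ _ _);
    last exact: convE.
rewrite sum_preimset_compl; apply: eq_bigr => C AC.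
apply: (conv_at_assoc_img _ _ _ (refine_lP _ _)).
- rewrite left_part_dset; apply/setP => x'; apply/imsetP/idP => [[y _ ->] /=|hx].
    by have := valP y; rewrite inE.
  have xC := subsetP AC _ hx.
  have h1 : Sub x' xC \in (val @^-1: A : {set sset C}) by rewrite inE.
  by exists (Sub (Sub x' xC) h1).
- rewrite left_part_dset; apply/setP => y; apply/imsetP/imsetP => -[z].
    case/imsetP => s _ -> -> /=; have /= := valP s; rewrite !inE => hs.
    have h1 : val (val s) \in ~: A by rewrite inE.
    by exists (exist _ (val (val s)) h1 : sset (~: A)); rewrite ?inE //=; exact: (valP (val s)).
  rewrite inE => hz -> /=.
  have h1 : (exist _ (val z) hz : sset C) \in ~: (val @^-1: A : {set sset C}).
    by rewrite !inE; have /= := valP z; rewrite inE.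
  by exists (inl (exist _ (exist _ (val z) hz : sset C) h1)) => //; rewrite imset_f ?inE.
Qed.
End ConvAssoc.

(** * Convolution inverses and antipodes *)

Lemma card_sset (I : finType) (S : {set I}) : #|{: sset S}| = #|S|.
Proof. by rewrite card_sig; apply: eq_card. Qed.

Lemma card_sset_lt (I : finType) (S : {set I}) : S != setT -> (#|{: sset S}| < #|I|)%N.
Proof.
by move=> h; rewrite card_sset -cardsT proper_card // properT.
Qed.

Lemma void_setT (I : finType) (S : {set I}) : #|I| = 0%N -> S = setT.
Proof. by move=> /card0_eq h; apply/setP => x; have := h x; rewrite inE. Qed.

Section ConvInverse.
Implicit Types I J R S T U V : finType.
Variables (K : fieldType) (p q : species K) (c : comonoid_ops p) (m : monoid_ops q).
Hypotheses (Hc : is_comonoid c) (Hm : is_monoid m).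

(** The equation g * f = 1 solved for the value of g on I. Since f is unital, that
    value is the summand at S = I, and the other summands only involve g on smaller
    sets. *)
Definition conv_linv_step (f : smorph p q) (g : forall I, {linear p I -> q I}) I :
    {linear p I -> q I} :=
  conv_unit c m I \- lsum (fun S : {set I} =>
    if S == setT then (\0 : {linear p I -> q I}) else conv_at c m (dset S) (g _) (f _)).

Lemma conv_linv_stepE f g I x : conv_linv_step f g I x =
  conv_unit c m I x - \sum_(S : {set I} | S != setT) conv_at c m (dset S) (g _) (f _) x.
Proof.
rewrite /conv_linv_step /= lsumE; congr (_ - _); rewrite [RHS]big_mkcond /=.
by apply: eq_bigr => S _; case: eqP.
Qed.

Lemma conv_linv (f : smorph p q) : unital c m f ->
  exists2 g : smorph p q, unital c m g & forall I, conv c m g f I =1 conv_unit c m I.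
Proof.
move=> hf; have [||g gE] := @smorph_rec K p q (conv_linv_step f).
- move=> g g' I h x; rewrite !conv_linv_stepE; congr (_ - _); apply: eq_bigr => S ST.
  by apply: conv_at_ext => // y; apply: h; exact: card_sset_lt.
- move=> g S T u h x; rewrite !conv_linv_stepE linearB; congr (_ - _); first exact: smap_nat.
  rewrite linear_sum (reindex _ (onW_bij _ (imset_bij_bij u))) /=.
  have uT : u @: setT = setT.
    apply/setP => y; rewrite inE; apply/imsetP.
    by exists (bij_inv u y); rewrite ?inE ?bij_invVK.
  apply: eq_big => [A|A AT].
    by rewrite -[in LHS]uT (inj_eq (imset_inj (@inj_bij _ _ u))).
  have [|a [b r]] := @restricts_ex _ _ _ _ _ _ (dset A) (dset (u @: A)) u.
    by rewrite !left_part_dset.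
  apply: (conv_at_nat Hc Hm r); last exact: smap_nat.
  by move=> z; apply: h; apply: card_sset_lt; move: AT;
    rewrite -[in X in X -> _]uT (inj_eq (imset_inj (@inj_bij _ _ u))).
exists g => [x|I x].
  rewrite gE conv_linv_stepE big1 => [|S /eqP[]]; last exact: void_setT (card_void).
  by rewrite subr0 conv_unitE.
rewrite convE (bigD1 setT) // (conv_at_setT Hc Hm) ?left_part_dset // gE conv_linv_stepE.
exact: subrK.
Qed.

(** A left inverse g of f is unital too, hence has a left inverse of its own, which
    can only be f. *)
Lemma conv_inv (f : smorph p q) : unital c m f ->
  exists g : smorph p q, [/\ unital c m g, forall I, conv c m g f I =1 conv_unit c m I
    & forall I, conv c m f g I =1 conv_unit c m I].
Proof.
move=> hf; have [g ug gf] := conv_linv hf; have [f' _ f'g] := conv_linv ug.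
exists g; split=> // I x; rewrite -f'g.
apply: conv_ext => // J {I x} x; rewrite -(conv_unitl Hc Hm) -(conv_unitr Hc Hm f').
rewrite -(@conv_ext _ _ _ c m (conv_smorph Hc Hm f' g) _ f f f'g) // conv_assoc.
by apply: conv_ext.
Qed.
End ConvInverse.

Section Antipode.
Variables (K : fieldType) (p : species K) (c : comonoid_ops p) (m : monoid_ops p).
Hypotheses (Hc : is_comonoid c) (Hm : is_monoid m).

Lemma antipode_ex : unital c m (smorph_id p) -> exists s : smorph p p,
  is_antipode m c s /\
  [/\ unital c m s, forall I, conv c m s (smorph_id p) I =1 conv_unit c m I
    & forall I, conv c m (smorph_id p) s I =1 conv_unit c m I].
Proof.
move=> h; have [s [us sl sr]] := conv_inv Hc Hm h; exists s; split=> //.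
have E1 (I : finType) (x : p I) :
  \sum_(S : {set I}) mu m (dset S) (tmap idfun (s _) (Delta c (dset S) x)) = conv_unit c m I x.
  by rewrite -sr convE; apply: eq_bigr => S _; rewrite conv_atE.
have E2 (I : finType) (x : p I) :
  \sum_(S : {set I}) mu m (dset S) (tmap (s _) idfun (Delta c (dset S) x)) = conv_unit c m I x.
  by rewrite -sl convE; apply: eq_bigr => S _; rewrite conv_atE.
split=> [x|x|I x I0|I x I0]; rewrite ?E1 ?E2 ?conv_unitE ?conv_unit_n0 //.
Qed.
End Antipode.

(** The line p[0] is spanned by the unit because the counit takes it to 1; the
    identity is then unital, so that it has a convolution inverse. *)
Lemma connected_unital (K : fieldType) (p : species K) (c : comonoid_ops p)
    (m : monoid_ops p) : (forall a, eps c (miota m a) = a) -> connected p ->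
  unital c m (smorph_id p).
Proof.
move=> ei [e e0 he] x /=.
have [d dE] := he (miota m 1); have [a ->] := he x.
have d0 : d != 0.
  apply/eqP => d0; have := ei 1; rewrite dE d0 scale0r linear0 => /esym/eqP.
  by rewrite oner_eq0.
have -> : e = d^-1 *: miota m 1 by rewrite dE scalerA mulVf // scale1r.
by rewrite !linearZ /= ei.
Qed.

(** * The Hadamard product of bimonoids *)

Section HadamardBimonoid.
Variables (K : fieldType) (h k : species K).

Section Mon.
Variables (m : monoid_ops h) (n : monoid_ops k).
Local Notation M := (had_monoid m n).

Lemma had_muE S T I (d : decomp S T I) a b x y :
  mu M d ((a ⊠ b) ⊠ (x ⊠ y)) = mu m d (a ⊠ x) ⊠ mu n d (b ⊠ y).
Proof. by rewrite /= tmid_swapE tmapE. Qed.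

Lemma had_actE S T (u : bij S T) a b : act (had h k) u (a ⊠ b) = act h u a ⊠ act k u b.
Proof. exact: tmapE. Qed.

Lemma had_iotaE a : miota M a = a *: (miota m 1 ⊠ miota n 1).
Proof. by rewrite -[a in LHS]mulr1 -[a * 1]/(a *: (1 : K^o)) linearZ /= lunitVE tmapE. Qed.

Lemma had_is_monoid : is_monoid m -> is_monoid n -> is_monoid M.
Proof.
move=> Hm Hn; split.
- move=> S T I S' T' I' d d' f g u r; apply: tens_ext4 => [||a b x y]; [solve_linear|solve_linear|].
  rewrite had_muE had_actE (mu_nat Hm r) (mu_nat Hn r) !tmapE.
  by rewrite had_muE.
- move=> R S T U V I d1 d2 e1 e2 hd t.
  move: t; apply: tens_ext => [||t t3]; [solve_linear|solve_linear|]; move: t t3.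
  pose f (t : had h k R ⊗ had h k S) (z : had h k T) :=
     mu M d2 (tmap (mu M d1) idfun (t ⊠ z)).
  pose g (t : had h k R ⊗ had h k S) (z : had h k T) :=
     mu M e2 (tmap idfun (mu M e1) (tassoc _ _ _ (t ⊠ z))).
  rewrite -[forall t z, _]/(forall t z, f t z = g t z) => t z; move: t.
  apply: tens_ext4 => [||a b x y]; [by rewrite /f; solve_linear|by rewrite /g; solve_linear|].
  move: z; apply: tens_ext => [||v w];
    [by rewrite /f; solve_linear|by rewrite /g; solve_linear|].
  rewrite /f /g tmapE had_muE had_muE tassocE tmapE had_muE had_muE.
  have := mu_assoc Hm hd (a ⊠ x ⊠ v); rewrite tassocE !tmapE => ->.
  by have := mu_assoc Hn hd (b ⊠ y ⊠ w); rewrite tassocE !tmapE => ->.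
- move=> I; apply: tens_ext => [||c t]; [solve_linear|solve_linear|]; move: t.
  apply: tens_ext => [||a b]; [solve_linear|solve_linear|].
  rewrite lunitE tmapE had_iotaE tpureZl linearZ had_muE; congr (_ *: _).
  have := mu_unitl Hm (1 ⊠ a); have := mu_unitl Hn (1 ⊠ b).
  by rewrite !tmapE !lunitE !scale1r => -> ->.
- move=> I; apply: tens_ext => [||t c]; [solve_linear|solve_linear|]; move: t.
  apply: tens_ext => [||a b]; [solve_linear|solve_linear|].
  rewrite runitE tmapE had_iotaE tpureZr linearZ had_muE; congr (_ *: _).
  have := mu_unitr Hm (a ⊠ 1); have := mu_unitr Hn (b ⊠ 1).
  by rewrite !tmapE !runitE !scale1r => -> ->.
Qed.
End Mon.

Section Comon.
Variables (c : comonoid_ops h) (e : comonoid_ops k).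
Local Notation C := (had_comonoid c e).

Lemma had_DeltaE S T I (d : decomp S T I) x y :
  Delta C d (x ⊠ y) = tmid _ _ (tswap _ _) (Delta c d x ⊠ Delta e d y).
Proof. by rewrite /= tmapE. Qed.

Lemma had_epsE x y : eps C (x ⊠ y) = eps c x * eps e y.
Proof. by rewrite /= tmapE lunitE. Qed.

(** Each law follows from the same law for the two factors once the coproducts of the
    factors are collected on two sides by exchanging the middle tensor factors. *)
Lemma had_is_comonoid : is_comonoid c -> is_comonoid e -> is_comonoid C.
Proof.
move=> Hc He; split.
- move=> S T I S' T' I' d d' f g u r; apply: tens_ext => [||x y]; [solve_linear|solve_linear|].
  rewrite had_actE !had_DeltaE (Delta_nat Hc r) (Delta_nat He r).
  move: (Delta c d x) (Delta e d y); apply: tens_ext2; try by move=> ?; solve_linear.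
  by move=> a b a' b'; rewrite !tmapE !tmid_swapE !tmapE.
- move=> R S T U V I d1 d2 e1 e2 hd; apply: tens_ext => [||x y]; [solve_linear|solve_linear|].
  rewrite !had_DeltaE.
  transitivity (tmap idfun (tmid _ _ (tswap _ _)) (tmid _ _ (tswap _ _)
     (tassoc _ _ _ (tmap (Delta c d1) idfun (Delta c d2 x)) ⊠
      tassoc _ _ _ (tmap (Delta e d1) idfun (Delta e d2 y))))).
    move: (Delta c d2 x) (Delta e d2 y); apply: tens_ext2; try by move=> ?; solve_linear.
    move=> a b a' b'; rewrite tmid_swapE !tmapE had_DeltaE.
    move: (Delta c d1 a) (Delta e d1 a'); apply: tens_ext2; try by move=> ?; solve_linear.
    by move=> r s r' s'; rewrite !(tmid_swapE, tassocE, tmapE).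
  rewrite (Delta_coassoc Hc hd) (Delta_coassoc He hd).
  move: (Delta c e2 x) (Delta e e2 y); apply: tens_ext2; try by move=> ?; solve_linear.
  by move=> a b a' b'; rewrite !(tmid_swapE, tmapE) had_DeltaE.
- move=> I; apply: tens_ext => [||x y]; [solve_linear|solve_linear|].
  rewrite had_DeltaE -[in RHS](Delta_counitl Hc x) -[in RHS](Delta_counitl He y).
  move: (Delta c _ x) (Delta e _ y); apply: tens_ext2; try by move=> ?; solve_linear.
  move=> a b a' b'; rewrite tmid_swapE !tmapE had_epsE !lunitE.
  by rewrite tpureZl tpureZr scalerA.
- move=> I; apply: tens_ext => [||x y]; [solve_linear|solve_linear|].
  rewrite had_DeltaE -[in RHS](Delta_counitr Hc x) -[in RHS](Delta_counitr He y).
  move: (Delta c _ x) (Delta e _ y); apply: tens_ext2; try by move=> ?; solve_linear.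
  move=> a b a' b'; rewrite tmid_swapE !tmapE had_epsE !runitE.
  by rewrite tpureZl tpureZr scalerA.
Qed.
End Comon.

Lemma tmid_betaE (p : species K) (q : K) A B C D (a : p A) (b : p B) (c : p C) (d : p D) :
  tmid (p A) (p D) (beta p q B C) ((a ⊠ b) ⊠ (c ⊠ d)) =
  q ^+ (#|B| * #|C|) *: ((a ⊠ c) ⊠ (b ⊠ d)).
Proof.
rewrite /tmid unlock /= tassocE tmapE /= tassocVE tmapE lscaleE tswapE.
by rewrite tpureZl linearZ /= tassocE tpureZr linearZ /= tassocVE.
Qed.

(** The exchange of the middle factors commutes with tensor products of linear maps,
    so the two compatibility conditions multiply; the scalars combine as p^n q^n =
    (pq)^n. *)
Lemma had_bimonoid (p q : K) (m : monoid_ops h) (n : monoid_ops k)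
    (c : comonoid_ops h) (e : comonoid_ops k) : is_bimonoid p m c -> is_bimonoid q n e ->
  is_bimonoid (p * q) (had_monoid m n) (had_comonoid c e).
Proof.
move=> Hm Hn; split.
- exact: had_is_monoid (bimon_monoid Hm) (bimon_monoid Hn).
- exact: had_is_comonoid (bimon_comonoid Hm) (bimon_comonoid Hn).
- move=> A B C D S T S' T' I d d' eS eT eS' eT' hd.
  apply: tens_ext4 => [||a b x y]; [solve_linear|solve_linear|].
  rewrite had_muE had_DeltaE (Delta_mu Hm hd) (Delta_mu Hn hd) !tmapE !had_DeltaE.
  move: (Delta c eS a) (Delta e eS b); apply: tens_ext2; try by move=> ?; solve_linear.
  move=> a1 a2 b1 b2.
  move: (Delta c eT x) (Delta e eT y); apply: tens_ext2; try by move=> ?; solve_linear.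
  move=> x1 x2 y1 y2.
  rewrite !tmid_swapE !tmid_betaE !linearZ /= !tmapE !tpureZl !tpureZr linearZ /=.
  by rewrite linearZ /= !tmid_swapE !tmapE scalerA -exprMn.
- move=> a; rewrite had_iotaE linearZ /= !tmapE lunitE !(eps_iota Hm, eps_iota Hn).
  by rewrite scale1r [LHS]mulr1.
- apply: tens_ext4 => [||a b x y]; [solve_linear|solve_linear|].
  rewrite had_muE had_epsE (eps_mu Hm) (eps_mu Hn) !tmapE !lunitE !had_epsE.
  exact: mulrACA.
- apply: tens_ext => [||a b]; [solve_linear|solve_linear|].
  rewrite lunitE !tmapE !had_iotaE tpureZl tpureZr scalerA linearZ /= !tmapE.
  have := Delta_iota Hm (1 ⊠ 1); have := Delta_iota Hn (1 ⊠ 1).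
  by rewrite !lunitE !tmapE !scale1r => -> ->; rewrite tmid_swapE.
Qed.
End HadamardBimonoid.

(** * Connected bimonoids *)

(** Supplies the four pieces that the compatibility condition of a bimonoid takes as
    given. *)
Lemma dcross_ex S T S' T' I (d : decomp S T I) (d' : decomp S' T' I) :
  exists (A : {set S}) (C : {set T}) (eS' : decomp (sset A) (sset C) S')
    (eT' : decomp (sset (~: A)) (sset (~: C)) T'),
    [/\ dcross d d' (dset A) (dset C) eS' eT', A = dl d @^-1: left_part d'
      & C = dr d @^-1: left_part d'].
Proof.
pose A := dl d @^-1: left_part d'; pose C := dr d @^-1: left_part d'.
have inl_ex i : i \in left_part d' -> exists s', i = dl d' s'.
  by case/imsetP => s' _ ->; exists s'.
have inr_ex i : i \in ~: left_part d' -> exists t', i = dr d' t'.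
  by rewrite inE; case: (decomp_cover d' i) => -[s' ->]; [rewrite mem_dl|exists s'].
have hA (a : sset A) : dl d (val a) \in left_part d' by have := valP a; rewrite inE.
have hC (x : sset C) : dr d (val x) \in left_part d' by have := valP x; rewrite inE.
have hB (a : sset (~: A)) : dl d (val a) \in ~: left_part d' by have := valP a; rewrite !inE.
have hD (x : sset (~: C)) : dr d (val x) \in ~: left_part d' by have := valP x; rewrite !inE.
pose fA a := sval (cid (inl_ex _ (hA a))); pose fC a := sval (cid (inl_ex _ (hC a))).
pose fB a := sval (cid (inr_ex _ (hB a))); pose fD a := sval (cid (inr_ex _ (hD a))).
have EA a : dl d (val a) = dl d' (fA a) by rewrite /fA; case: (cid _).
have EC a : dr d (val a) = dl d' (fC a) by rewrite /fC; case: (cid _).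
have EB a : dl d (val a) = dr d' (fB a) by rewrite /fB; case: (cid _).
have ED a : dr d (val a) = dr d' (fD a) by rewrite /fD; case: (cid _).
have bl : bijective (fun z : sset A + sset C => match z with inl s => fA s | inr t => fC t end).
  apply: decomp_mk.
  - by move=> x y e; apply: val_inj; apply: (@dl_inj _ _ _ d); rewrite !EA e.
  - by move=> x y e; apply: val_inj; apply: (@dr_inj _ _ _ d); rewrite !EC e.
  - by move=> x y e; have := dlr_neq d (val x) (val y); rewrite EA EC e eqxx.
  - move=> s'; case: (decomp_cover d (dl d' s')) => -[x hx].
    + have xA : x \in A by rewrite inE -hx mem_dl.
      left; exists (exist _ x xA : sset A); apply: (@dl_inj _ _ _ d').
      by rewrite -EA.
    + have xC : x \in C by rewrite inE -hx mem_dl.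
      right; exists (exist _ x xC : sset C); apply: (@dl_inj _ _ _ d').
      by rewrite -EC.
have br : bijective (fun z : sset (~: A) + sset (~: C) =>
    match z with inl s => fB s | inr t => fD t end).
  apply: decomp_mk.
  - by move=> x y e; apply: val_inj; apply: (@dl_inj _ _ _ d); rewrite !EB e.
  - by move=> x y e; apply: val_inj; apply: (@dr_inj _ _ _ d); rewrite !ED e.
  - by move=> x y e; have := dlr_neq d (val x) (val y); rewrite EB ED e eqxx.
  - move=> s'; case: (decomp_cover d (dr d' s')) => -[x hx].
    + have xA : x \in ~: A by rewrite !inE -hx mem_dr.
      left; exists (exist _ x xA : sset (~: A)); apply: (@dr_inj _ _ _ d').
      by rewrite -EB.
    + have xC : x \in ~: C by rewrite !inE -hx mem_dr.
      right; exists (exist _ x xC : sset (~: C)); apply: (@dr_inj _ _ _ d').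
      by rewrite -ED.
by exists A, C, (Decomp bl), (Decomp br).
Qed.

Section Compat.
Implicit Types I J R S T U V : finType.
Variables (K : fieldType) (k : species K) (m : monoid_ops k) (c : comonoid_ops k) (q : K).
Hypotheses (Hb : is_bimonoid q m c) (Hu : unital c m (smorph_id k)).

Let Hm := bimon_monoid Hb.
Let Hc := bimon_comonoid Hb.

Lemma mu_1l I (x : k I) : mu m (dvoidl I) (miota m 1 ⊠ x) = x.
Proof. by have := mu_unitl Hm (1 ⊠ x); rewrite tmapE lunitE scale1r. Qed.
Lemma mu_1r I (x : k I) : mu m (dvoidr I) (x ⊠ miota m 1) = x.
Proof. by have := mu_unitr Hm (x ⊠ 1); rewrite tmapE runitE scale1r. Qed.

Lemma iota_eps (x : k void) : x = eps c x *: miota m 1.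
Proof.
have := Hu x => /= e; rewrite [LHS]e -[eps c x in LHS]mulr1.
by rewrite -[eps c x * 1]/(eps c x *: (1 : K^o)) linearZ.
Qed.

Lemma Delta_1r I (x : k I) : Delta c (dvoidr I) x = x ⊠ miota m 1.
Proof.
rewrite -[in RHS](Delta_counitr Hc x); move: (Delta c _ x).
apply: tens_ext => [||a b]; [solve_linear|solve_linear|].
by rewrite tmapE runitE tpureZl -tpureZr -iota_eps.
Qed.

Lemma Delta_1l I (x : k I) : Delta c (dvoidl I) x = miota m 1 ⊠ x.
Proof.
rewrite -[in RHS](Delta_counitl Hc x); move: (Delta c _ x).
apply: tens_ext => [||a b]; [solve_linear|solve_linear|].
by rewrite tmapE lunitE tpureZr -tpureZl -iota_eps.
Qed.

(** Compatibility of product and coproduct when R is contained in R + S: the piece B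
    of the cross is empty, no power of q survives, and connectedness removes the
    factor indexed by B. *)
Lemma Delta_mu_sub R S T U V I (d1 : decomp R S U) (d2 : decomp U T I)
    (e1 : decomp S T V) (e2 : decomp R V I) : dassoc d1 d2 e1 e2 -> forall x,
  Delta c d2 (mu m e2 x) = tmap (mu m d1) idfun (tassocV _ _ _ (tmap idfun (Delta c e1) x)).
Proof.
case=> h1 h2 h3.
have hd : dcross e2 d2 (dvoidr R) e1 d1 (dvoidl T) by split=> // -[].
apply: tens_ext => [||r v]; [solve_linear|solve_linear|].
rewrite (Delta_mu Hb hd) !tmapE Delta_1r; move: (Delta c e1 v).
apply: tens_ext => [||s t]; [solve_linear|solve_linear|].
by rewrite tmid_betaE card_void mul0n expr0 scale1r tassocVE !tmapE mu_1l.
Qed.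

(** The case in which the piece C of the cross is empty. *)
Lemma Delta_mu_sup R S T U V I (d1 : decomp R S U) (d2 : decomp U T I)
    (e1 : decomp S T V) (e2 : decomp R V I) : dassoc d1 d2 e1 e2 -> forall x,
  Delta c e2 (mu m d2 x) = tmap idfun (mu m e1) (tassoc _ _ _ (tmap (Delta c d1) idfun x)).
Proof.
case=> h1 h2 h3.
have hd : dcross d2 e2 d1 (dvoidl T) (dvoidr R) e1 by split=> // -[].
apply: tens_ext => [||u t]; [solve_linear|solve_linear|].
rewrite (Delta_mu Hb hd) !tmapE Delta_1l; move: (Delta c d1 u).
apply: tens_ext => [||r s]; [solve_linear|solve_linear|].
by rewrite tmid_betaE card_void muln0 expr0 scale1r tassocE !tmapE mu_1r.
Qed.

(** Neither of the two left parts contains the other exactly when the pieces B and C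
    of the cross are both nonempty, and then the braiding of a 0-bimonoid is zero. *)
Lemma Delta_mu_cross S T S' T' I (d : decomp S T I) (d' : decomp S' T' I) x : q = 0 ->
  ~~ (left_part d \subset left_part d') -> ~~ (left_part d' \subset left_part d) ->
  Delta c d' (mu m d x) = 0.
Proof.
move=> q0 h1 h2.
have [A [C [eS' [eT' [hd EA EC]]]]] := dcross_ex d d'.
rewrite (Delta_mu Hb hd) (_ : tmid _ _ _ _ = 0) ?linear0 //.
have e0 : q ^+ (#|{: sset (~: A)}| * #|{: sset C}|) = 0.
  rewrite q0 expr0n muln_eq0 !card_sset !cards_eq0 (_ : _ || _ = false) //.
  apply/norP; split.
  - case/subsetPn: h1 => _ /imsetP[s _ ->] h.
    by apply/set0Pn; exists s; rewrite EA !inE.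
  - case/subsetPn: h2 => i id' h; case: (decomp_cover d i) => -[s E].
      by case/negP: h; rewrite E mem_dl.
    by apply/set0Pn; exists s; rewrite EC inE -E.
by move: (tmap _ _ x); apply: (@tens_ext4 _ _ _ _ _ _ _ (fun=> 0)) => [||a b c' d''];
  [solve_linear|move=> a y z; rewrite scaler0 addr0|rewrite tmid_betaE e0 scale0r].
Qed.
End Compat.

(** * Connected 0-bimonoids *)

Section SumLeft.
Implicit Types I J R S T U V : finType.

(** The subsets of the left part of [d] are the only ones left when the other proper
    subsets contribute nothing; I itself is not among them as V is nonempty. *)
Lemma sum_left (M : nmodType) U V I (d : decomp U V I) (F : {set I} -> M) :
  (0 < #|V|)%N -> (forall A : {set I}, A != setT -> ~~ (A \subset left_part d) -> F A = 0) ->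
  \sum_(A : {set I} | A != setT) F A = \sum_(R : {set U}) F (dl d @: R).
Proof.
move=> V0 h; rewrite (sum_preimset _ (@dl_inj _ _ _ d)) -/(left_part d).
rewrite (bigID (fun S : {set I} => S \subset left_part d)) /=.
rewrite [X in _ + X]big1 => [|S /andP[]]; last exact: h.
rewrite addr0; apply: eq_big => S.
  apply: andb_idl => hS; apply/eqP => ST; have /card_gt0P[v _] := V0.
  by have := subsetP hS (dr d v); rewrite ST inE mem_dr => /(_ isT).
case/andP=> _ /subsetP hS; congr F; apply/setP => i; apply/idP/imsetP => [iS|[u]].
  have /imsetP[u _ e] := hS _ iS.
  by exists u; rewrite // inE -e.
by rewrite inE => ? ->.
Qed.

Lemma left_part_refine_l R S T U I (d1 : decomp R S U) (d2 : decomp U T I) :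
  left_part (refine_l d1 d2) = dl d2 @: left_part d1.
Proof. by rewrite /left_part -imset_comp. Qed.

Lemma left_part_refine_r R S T V I (e1 : decomp S T V) (e2 : decomp R V I) :
  left_part (refine_r e1 e2) = left_part e2 :|: dr e2 @: left_part e1.
Proof.
apply/setP => i; rewrite inE; apply/imsetP/orP => [[[r|s] _ ->] /=|[]].
- by left; rewrite mem_dl.
- by right; rewrite imset_f ?mem_dl.
- by case/imsetP => r _ ->; exists (inl r).
- by case/imsetP => _ /imsetP[s _ ->] ->; exists (inr s).
Qed.

(** Lets the summand at a set S containing the left part of [d] be computed at nested
    decompositions, obtained by splitting the right part of [d] along S. *)
Lemma sup_refine U V I (d : decomp U V I) (S : {set I}) : left_part d \subset S ->
  S = left_part (refine_r (dset (dr d @^-1: S)) d).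
Proof.
move/subsetP=> h; rewrite left_part_refine_r left_part_dset; apply/setP => i; rewrite inE.
apply/idP/orP => [iS|[/h //|]]; last by case/imsetP => v; rewrite inE => ? ->.
case: (decomp_cover d i) => -[x e]; first by left; rewrite e mem_dl.
by right; apply/imsetP; exists x; rewrite // inE -e.
Qed.

Lemma sup_proper U V I (d : decomp U V I) (S : {set I}) : left_part d \subset S ->
  S != setT -> ~~ (S \subset left_part d) ->
  dr d @^-1: S != set0 /\ dr d @^-1: S != setT.
Proof.
move=> h ST SU; split.
- case/subsetPn: SU => i iS iU; apply/set0Pn.
  case: (decomp_cover d i) => -[x e]; first by case/negP: iU; rewrite e mem_dl.
  by exists x; rewrite inE -e.
- apply: contra ST => /eqP/setP e; apply/eqP/setP => i; rewrite inE.
  case: (decomp_cover d i) => -[x ->]; first by apply: (subsetP h); rewrite mem_dl.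
  by have := e x; rewrite !inE.
Qed.
End SumLeft.

(** Connectedness enters as the unit and the counit being mutually inverse on the
    empty set. *)
Record connected_0bimonoid (K : fieldType) (k : species K) (m : monoid_ops k)
    (c : comonoid_ops k) : Prop := Connected0Bimonoid {
  conn0_bimonoid : is_bimonoid 0 m c;
  conn0_unit : unital c m (smorph_id k)
}.

Section ZeroBimonoid.
Implicit Types I J R S T U V W : finType.
Variables (K : fieldType) (k : species K) (m : monoid_ops k) (c : comonoid_ops k).
Hypothesis (Hk : connected_0bimonoid m c).

Let Hb := conn0_bimonoid Hk.
Let Hu := conn0_unit Hk.
Let Hm := bimon_monoid Hb.
Let Hc := bimon_comonoid Hb.

Section ConvMul.
Variables (N : species K) (n : monoid_ops N).
Hypothesis (Hn : is_monoid n).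

(** A convolution product evaluated on a product x y, where x lives on U and y on V.
    By [Delta_mu_cross] the subset S of I matters only if it is comparable with U. For
    S inside U the summand is f(x') g(x'' y), which the first hypothesis turns into
    f(x') g(x'') h(y); for S strictly between U and I it is f(x y') g(y''), which
    vanishes by the second. The summand at S = I is left out because it is the one
    that the applications solve for. *)
Lemma conv_mul (f g h : smorph k N) U V I (d : decomp U V I) t :
  (0 < #|V|)%N ->
  (forall R : {set U}, (forall x, f (sset R) x = 0) \/
     forall W (e : decomp (sset (~: R)) V W) t,
       g W (mu m e t) = mu n e (tmap (g _) (h _) t)) ->
  (forall (Q : {set V}) W (e : decomp U (sset Q) W) t, Q != set0 -> Q != setT ->
     f W (mu m e t) = 0) ->
  \sum_(S : {set I} | S != setT) conv_at c n (dset S) (f _) (g _) (mu m d t) =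
  mu n d (tmap (conv c n f g U) (h V) t).
Proof.
move=> V0 hg hf; rewrite (sum_left (d := d) V0) => [|S ST SU]; last first.
  (* The remaining sets are incomparable with the left part of [d], or lie strictly
     between it and [I]. *)
  case: (boolP (left_part d \subset S)) => [US|US]; last first.
    by rewrite conv_atE (Delta_mu_cross Hb) ?left_part_dset // !linear0.
  have [Q0 QT] := sup_proper US ST SU; set Q := dr d @^-1: S in Q0 QT.
  rewrite (@conv_at_img _ _ _ _ _ Hc Hn _ _ _ _ _ _ (refine_r (dset Q) d));
    last by rewrite left_part_dset; exact: sup_refine.
  rewrite conv_atE (Delta_mu_sub Hb Hu (refine_rP (dset Q) d)) tmap_comp.
  rewrite (_ : tmap _ _ _ = 0) ?linear0 //; move: t.
  apply: (@tens_ext _ _ _ _ _ (fun=> 0)) => [||a b]; [solve_linear| |].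
    by move=> x y z; rewrite scaler0 addr0.
  rewrite tmapE; move: (Delta c _ b).
  apply: (@tens_ext _ _ _ _ _ (fun=> 0)) => [||b1 b2]; [solve_linear| |].
    by move=> x y z; rewrite scaler0 addr0.
  by rewrite tassocVE tmapE /= (hf Q) // tpure0l.
rewrite (tmap_suml (P := predT) (F := fun R : {set U} => conv_at c n (dset R) (f _) (g _)) _ _);
  last exact: convE.
rewrite linear_sum; apply: eq_bigr => R _.
rewrite (@conv_at_img _ _ _ _ _ Hc Hn _ _ _ _ _ _ (refine_l (dset R) d));
  last by rewrite left_part_dset left_part_refine_l left_part_dset.
have hd := refine_lP (dset R) d.
rewrite conv_atE (Delta_mu_sup Hb Hu hd) tmap_comp.
case: (hg R) => [f0|hg'].
  rewrite tmap0l ?linear0 => [|y]; last exact: f0.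
  by rewrite tmap0l ?linear0 // => y; rewrite conv_atE tmap0l ?linear0.
transitivity (mu n d (tmap (mu n (dset R)) idfun
   (tmap (tmap (f _) (g _)) (h V) (tmap (Delta c (dset R)) idfun t)))).
  rewrite (mu_assoc Hn hd) tassoc_map tmap_comp; congr (mu _ _ _).
  by apply: tmap_ext => y //=; exact: hg'.
by rewrite !tmap_comp; congr (mu _ _ _); apply: tmap_ext => y //=; rewrite conv_atE.
Qed.
End ConvMul.

(** The dual of [conv_mul]: for S inside U coassociativity turns the summand into
    s(x'_1) x'_2 (x) x'', which adds up to the convolution product on the left factor,
    and for S strictly between U and I the coproduct splits s(x'), which vanishes by
    hypothesis. *)
Lemma Delta_conv (s : smorph k k) U V I (d : decomp U V I) x :
  (0 < #|V|)%N ->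
  (forall (Q : {set V}) W (e : decomp U (sset Q) W) y, Q != set0 -> Q != setT ->
     Delta c e (s W y) = 0) ->
  \sum_(S : {set I} | S != setT) Delta c d (conv_at c m (dset S) (s _) (smorph_id k _) x) =
  tmap (conv c m s (smorph_id k) U) idfun (Delta c d x).
Proof.
move=> V0 hs; rewrite (sum_left (d := d) V0) => [|S ST SU]; last first.
  case: (boolP (left_part d \subset S)) => [US|US]; last first.
    by rewrite conv_atE (Delta_mu_cross Hb) // left_part_dset.
  have [Q0 QT] := sup_proper US ST SU; set Q := dr d @^-1: S in Q0 QT.
  rewrite (@conv_at_img _ _ _ _ _ Hc Hm _ _ _ _ _ _ (refine_r (dset Q) d));
    last by rewrite left_part_dset; exact: sup_refine.
  rewrite conv_atE (Delta_mu_sup Hb Hu (refine_rP (dset Q) d)) tmap_comp.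
  by rewrite [X in tassoc _ _ _ X]tmap0l ?linear0 // => y; exact: (hs Q _ _ _ Q0 QT).
rewrite (tmap_suml (P := predT)
  (F := fun R : {set U} => conv_at c m (dset R) (s _) (smorph_id k _)) _ _); last exact: convE.
apply: eq_bigr => R _.
rewrite (@conv_at_img _ _ _ _ _ Hc Hm _ _ _ _ _ _ (refine_l (dset R) d));
  last by rewrite left_part_dset left_part_refine_l left_part_dset.
have hd := refine_lP (dset R) d.
rewrite conv_atE (Delta_mu_sub Hb Hu hd) tmap_comp.
have -> : forall z,
   tmap (idfun \o s (sset R)) (Delta c (dcoprod (sset (~: R)) V) \o smorph_id k _) z =
   tmap (s _) idfun (tmap idfun (Delta c (dcoprod _ V)) z).
  by move=> z; rewrite tmap_comp; apply: tmap_ext.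
rewrite -(Delta_coassoc Hc hd); move: (Delta c d x).
apply: tens_ext => [||u v]; [solve_linear|solve_linear|].
rewrite !tmapE conv_atE; move: (Delta c _ u).
apply: tens_ext => [||a b]; [solve_linear|solve_linear|].
by rewrite tassocE !tmapE tassocVE tmapE.
Qed.
End ZeroBimonoid.

Lemma decomp_gt0 S T I (d : decomp S T I) : (0 < #|S|)%N -> (0 < #|I|)%N.
Proof. by move=> h; rewrite (card_decomp d) addn_gt0 h. Qed.

Lemma decomp_sset_ltn U V I W (d : decomp U V I) (Q : {set V}) (e : decomp U (sset Q) W) :
  Q != setT -> (#|W| < #|I|)%N.
Proof.
by move=> QT; rewrite (card_decomp d) (card_decomp e) ltn_add2l card_sset_lt.
Qed.

(** [i] identifies the positive species [r] with the primitive elements of the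
    comonoid [c], those killed by every component of the coproduct with two nonempty
    parts. *)
Record is_primitives (K : fieldType) (k r : species K) (c : comonoid_ops k)
    (i : smorph r k) : Prop := IsPrimitives {
  prim_pos : positive r;
  prim_inj : forall I, injective (i I);
  prim_Delta : forall U V I (d : decomp U V I) a, (0 < #|U|)%N -> (0 < #|V|)%N ->
    Delta c d (i I a) = 0;
  prim_surj : forall (I : finType) x, (0 < #|I|)%N ->
    (forall U V (d : decomp U V I), (0 < #|U|)%N -> (0 < #|V|)%N -> Delta c d x = 0) ->
    exists a, i I a = x
}.

Lemma positive0 (K : fieldType) (r : species K) (I : finType) (x : r I) :
  positive r -> #|I| = 0%N -> x = 0.
Proof.
move=> hr I0; rewrite -(act_cancel (bij_invVK (void_bij I0)) x).
by rewrite (hr (act r _ x)) linear0.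
Qed.

Section Antipode0.
Implicit Types I J R S T U V W : finType.
Variables (K : fieldType) (k : species K) (m : monoid_ops k) (c : comonoid_ops k).
Hypothesis (Hk : connected_0bimonoid m c).

Let Hb := conn0_bimonoid Hk.
Let Hu := conn0_unit Hk.
Let Hm := bimon_monoid Hb.
Let Hc := bimon_comonoid Hb.

Variable s : smorph k k.
Hypothesis us : unital c m s.
Hypothesis sl : forall I, conv c m s (smorph_id k) I =1 conv_unit c m I.

(** The equation s * id = 0 on a product x y reduces, by [conv_mul] and induction, to
    s(x y) + (s * id)(x) y = 0, whose second term vanishes. The bound n carries the
    induction on the size of I. *)
Lemma antipode_mu n : forall U V I (d : decomp U V I) t, (#|I| < n)%N ->
  (0 < #|U|)%N -> (0 < #|V|)%N -> s I (mu m d t) = 0.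
Proof.
elim: n => // n ih U V I d t In U0 V0.
have := sl (mu m d t).
rewrite convE (bigD1 setT) // (conv_at_setT Hc Hm) ?left_part_dset //.
rewrite conv_unit_n0 ?(decomp_gt0 d) //.
rewrite (conv_mul Hk Hm (h := smorph_id k)) //.
- rewrite tmap0l ?linear0 => [|y]; last by rewrite sl conv_unit_n0.
  by rewrite -[X in X = _ -> _]/(s I (mu m d t) + 0) addr0.
- by move=> R; right=> W e t'; rewrite tmap_id.
- move=> Q W e t' Q0 QT; apply: ih => //; last by rewrite card_sset card_gt0.
  by rewrite (leq_trans (decomp_sset_ltn d e QT)).
Qed.

(** The same argument as for [antipode_mu], with [Delta_conv]: the values of the
    antipode are primitive. *)
Lemma Delta_antipode n : forall U V I (d : decomp U V I) x, (#|I| < n)%N ->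
  (0 < #|U|)%N -> (0 < #|V|)%N -> Delta c d (s I x) = 0.
Proof.
elim: n => // n ih U V I d x In U0 V0.
have /(congr1 (Delta c d)) := sl x.
rewrite convE linear_sum (bigD1 setT) // (conv_at_setT Hc Hm) ?left_part_dset //.
rewrite conv_unit_n0 ?(decomp_gt0 d) // linear0 (Delta_conv Hk) //.
- rewrite tmap0l => [|y]; last by rewrite sl conv_unit_n0.
  by rewrite -[X in X = _ -> _]/(Delta c d (s I x) + 0) addr0.
- move=> Q W e t' Q0 QT; apply: ih => //; last by rewrite card_sset card_gt0.
  by rewrite (leq_trans (decomp_sset_ltn d e QT)).
Qed.

(** The summand at the empty set in s * id = 0 is x itself. As s has primitive values,
    this writes x in terms of primitive elements and elements on smaller sets. *)
Lemma conv_antipode_sum I x : (0 < #|I|)%N ->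
  x = - \sum_(S : {set I} | S != set0) conv_at c m (dset S) (s _) (smorph_id k _) x.
Proof.
move=> I0; apply/eqP; rewrite -addr_eq0; apply/eqP.
rewrite -[RHS](conv_unit_n0 c m x I0) -sl convE [RHS](bigD1 set0) //.
by rewrite (conv_at_set0 Hc Hm) ?left_part_dset.
Qed.

Lemma antipode_prim I x : (0 < #|I|)%N ->
  (forall U V (d : decomp U V I), (0 < #|U|)%N -> (0 < #|V|)%N -> Delta c d x = 0) ->
  s I x = - x.
Proof.
move=> I0 h; have TN0 : [set: I] != set0 by rewrite -card_gt0 cardsT.
apply/eqP; rewrite -eqr_oppLR eq_sym; apply/eqP; rewrite [LHS](conv_antipode_sum x I0).
rewrite (bigD1 setT) // (conv_at_setT Hc Hm) ?left_part_dset //.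
rewrite big1 => [|S /andP[S0 ST]]; first by rewrite [X in - X]addr0.
rewrite conv_atE h ?linear0 // card_sset card_gt0 //.
by apply: contra ST => /eqP e; rewrite -(setCK S) e setC0.
Qed.
End Antipode0.

Section Universal.
Implicit Types I J R S T U V W : finType.
Variables (K : fieldType) (k : species K) (m : monoid_ops k) (c : comonoid_ops k).
Hypothesis (Hk : connected_0bimonoid m c).
Variables (r : species K) (i : smorph r k).
Hypothesis (Hi : is_primitives c i).
Variables (N : species K) (n : monoid_ops N).
Hypothesis (Hn : is_monoid n).

Let Hb := conn0_bimonoid Hk.
Let Hu := conn0_unit Hk.
Let Hm := bimon_monoid Hb.
Let Hc := bimon_comonoid Hb.

(** By induction on the size of the set, since [conv_antipode_sum] generates the
    monoid from its primitive elements. *)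
Lemma prim_morph_eq (f g : smorph k N) : is_monoid_morph m n f -> is_monoid_morph m n g ->
  (forall I a, f I (i I a) = g I (i I a)) -> forall I x, f I x = g I x.
Proof.
case=> fM f1 [gM g1] h.
have [s [_ [us sl _]]] := antipode_ex Hc Hm Hu.
move=> I x; move: {2}(#|I|).+1 (ltnSn #|I|) => b; elim: b => // b ih in I x * => Ib.
have [I0|I0] := posnP #|I|.
  rewrite -(act_cancel (bij_invVK (void_bij I0)) x); move: (act k _ x) => y.
  rewrite !smap_nat; congr (act _ _ _); rewrite (iota_eps Hu y) !linearZ /=; congr (_ *: _).
  by rewrite f1 g1.
rewrite (conv_antipode_sum Hk us sl x I0) !linearN; congr (- _); rewrite !linear_sum.
apply: eq_bigr => S S0; rewrite !conv_atE fM gM !tmap_comp; congr (mu _ _ _).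
have S0' : (0 < #|{: sset S}|)%N by rewrite card_sset card_gt0.
apply: tmap_ext => y /=.
- have [U V d U0 V0|a ea] := prim_surj Hi (x := s _ y) S0'.
    exact: (Delta_antipode Hk sl _ _ (ltnSn _)).
  by rewrite -ea h.
- apply: ih; apply: leq_trans (card_sset_lt _) _ => //.
  by apply: contra S0 => /eqP e; rewrite -(setCK S) e setCT.
Qed.

Lemma mu_unital_l (f : smorph k N) U V I (d : decomp U V I) t : unital c n f ->
  #|U| = 0%N -> f I (mu m d t) = mu n d (tmap (f U) (f V) t).
Proof.
move=> hf U0.
have [|a [b h]] := @restricts_ex _ _ _ _ _ _ d (dvoidl I) (bij_id I).
  by rewrite bij_id_img left_part_dvoidl; apply/setP => x; rewrite inE; apply/negP;
    case/imsetP => u; have := card0_eq U0 u.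
rewrite -(act1 (mu m d t)) -(act1 (mu n d _)) (mu_nat Hm h) (mu_nat Hn h).
have -> : tmap (act N a) (act N b) (tmap (f U) (f V) t) =
   tmap (f void) (f I) (tmap (act k a) (act k b) t).
  by rewrite !tmap_comp; apply: tmap_ext => y /=; rewrite smap_nat.
move: (tmap _ _ t); apply: tens_ext => [||x y]; [solve_linear|solve_linear|].
rewrite tmapE hf (iota_eps Hu x) !linearZ /= !tpureZl !linearZ /=; congr (_ *: _).
rewrite (mu_1l Hb) (eps_iota Hb) -[RHS]/((mu n (dvoidl I)) (miota n 1 ⊠ f I y)).
by have := mu_unitl Hn (1 ⊠ f I y); rewrite tmapE lunitE scale1r => ->.
Qed.

Lemma mu_unital_r (f : smorph k N) U V I (d : decomp U V I) t : unital c n f ->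
  #|V| = 0%N -> f I (mu m d t) = mu n d (tmap (f U) (f V) t).
Proof.
move=> hf V0.
have [|a [b h]] := @restricts_ex _ _ _ _ _ _ d (dvoidr I) (bij_id I).
  rewrite bij_id_img left_part_dvoidr; apply/setP => x; rewrite inE.
  case: (decomp_cover d x) => -[y ->]; first exact: mem_dl.
  by have := card0_eq V0 y.
rewrite -(act1 (mu m d t)) -(act1 (mu n d _)) (mu_nat Hm h) (mu_nat Hn h).
have -> : tmap (act N a) (act N b) (tmap (f U) (f V) t) =
   tmap (f I) (f void) (tmap (act k a) (act k b) t).
  by rewrite !tmap_comp; apply: tmap_ext => y /=; rewrite smap_nat.
move: (tmap _ _ t); apply: tens_ext => [||x y]; [solve_linear|solve_linear|].
rewrite tmapE hf (iota_eps Hu y) !linearZ /= !tpureZr !linearZ /=; congr (_ *: _).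
rewrite (mu_1r Hb) (eps_iota Hb) -[RHS]/((mu n (dvoidr I)) (f I x ⊠ miota n 1)).
by have := mu_unitr Hn (f I x ⊠ 1); rewrite tmapE runitE scale1r => ->.
Qed.

(** On nonempty sets -s is a projection onto the primitive elements: its values are
    primitive, and s(x) = -x for x primitive since all other summands of s * id vanish
    at x. *)
Lemma prim_retract (s : smorph k k) : unital c m s ->
  (forall I, conv c m s (smorph_id k) I =1 conv_unit c m I) ->
  exists j : smorph k r, (forall I x, i I (j I x) = conv_unit c m I x - s I x) /\
    forall I, cancel (i I) (j I).
Proof.
move=> us sl.
have hex I (x : k I) : exists a, i I a = conv_unit c m I x - s I x.
  have [I0|I0] := posnP #|I|.
    by exists 0; rewrite linear0 (unital_eq us I0) subrr.
  have [U V d U0 V0|a ea] := prim_surj Hi (x := s I x) I0.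
    exact: (Delta_antipode Hk sl _ _ (ltnSn _)).
  by exists (- a); rewrite linearN ea conv_unit_n0 // sub0r.
pose j0 I x := sval (cid (hex I x)).
have j0E I x : i I (j0 I x) = conv_unit c m I x - s I x by rewrite /j0; case: (cid _).
have j0l I : linear (j0 I).
  move=> a x y; apply: (prim_inj Hi); rewrite linearP !j0E !linearP /=.
  by rewrite scalerDr addrACA.
pose j I : {linear k I -> r I} := HB.pack (j0 I) (GRing.isLinear.Build K _ _ *:%R _ (j0l I)).
have jn S T (u : bij S T) x : j T (act k u x) = act r u (j S x).
  by apply: (prim_inj Hi); rewrite smap_nat !j0E !smap_nat linearB.
exists (Smorph jn); split=> [I x|I a]; first exact: j0E.
apply: (prim_inj Hi); rewrite [LHS]j0E.
have [I0|I0] := posnP #|I|.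
  by rewrite (positive0 a (prim_pos Hi) I0) !linear0 addr0.
rewrite conv_unit_n0 // (antipode_prim Hk us sl) // ?sub0r ?opprK // => U V d.
exact: (prim_Delta Hi).
Qed.

Lemma conv_subl (f g h : smorph k N) I x :
  conv c n (smorph_sub f g) h I x = conv c n f h I x - conv c n g h I x.
Proof.
rewrite !convE -sumrB; apply: eq_bigr => S _; rewrite !conv_atE -linearB; congr (mu _ _ _).
move: (Delta c _ x); apply: tens_ext => [||v w]; first by solve_linear.
  by move=> a y z; rewrite !linearP /= scalerDr addrACA.
by rewrite !tmapE /= -[in RHS]scaleN1r -tpureZl scaleN1r (bilinDl (tpure_bilin _ _)).
Qed.

(** Let phi = f j, where j is the projection onto the primitive elements. A
    multiplicative extension g of f has to satisfy g = 1 + phi * g, as one sees by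
    applying it to [conv_antipode_sum]; so g is the convolution inverse of 1 - phi.
    This inverse is multiplicative by [conv_mul] because phi kills products. *)
Lemma prim_extend (f : smorph r N) : exists2 g : smorph k N, is_monoid_morph m n g &
  forall I a, g I (i I a) = f I a.
Proof.
have [s [_ [us sl _]]] := antipode_ex Hc Hm Hu.
have [j [ij ji]] := prim_retract us sl.
pose phi := smorph_comp f j.
have phi0 I x : #|I| = 0%N -> phi I x = 0.
  by move=> I0; rewrite /= (positive0 (j I x) (prim_pos Hi) I0) linear0.
have [g [ug _ eg]] : exists g : smorph k N, [/\ unital c n g,
    forall I, conv c n g (smorph_sub (conv_unit c n) phi) I =1 conv_unit c n I
    & forall I, conv c n (smorph_sub (conv_unit c n) phi) g I =1 conv_unit c n I].
  apply: (conv_inv Hc Hn) => x.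
  by rewrite -[LHS]/(conv_unit c n void x - phi void x) phi0 ?card_void // subr0 conv_unitE.
have gE I x : g I x = conv_unit c n I x + conv c n phi g I x.
  by rewrite -(eg I x) conv_subl (conv_unitl Hc Hn) subrK.
have phiM U V I (d : decomp U V I) t : (0 < #|U|)%N -> (0 < #|V|)%N ->
    phi I (mu m d t) = 0.
  move=> U0 V0; rewrite /= (_ : j I _ = 0) ?linear0 //; apply: (prim_inj Hi).
  rewrite ij linear0 conv_unit_n0 ?(decomp_gt0 d) // sub0r.
  by rewrite (antipode_mu Hk sl _ _ (ltnSn _)) ?oppr0.
exists g; first split.
- move=> S T I d x; move: {2}(#|I|).+1 (ltnSn #|I|) => b.
  elim: b S T I d x => // b ih U V I d t Ib.
  have [U0|U0] := posnP #|U|; first exact: mu_unital_l.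
  have [V0|V0] := posnP #|V|; first exact: mu_unital_r.
  rewrite gE conv_unit_n0 ?(decomp_gt0 d) // add0r convE (bigD1 setT) //.
  rewrite (conv_at_setT Hc Hn) ?left_part_dset // phiM // (conv_mul Hk Hn (h := g)) //.
  + rewrite -[LHS]/(0 + _) add0r; congr (mu _ _ _); apply: tmap_ext => // y.
    by rewrite gE conv_unit_n0 // add0r.
  + move=> R; have [R0|R0] := posnP #|R|.
      by left=> x; rewrite phi0 // card_sset.
    right=> W e t'; apply: ih; rewrite -ltnS (leq_trans _ Ib) // ltnS.
    rewrite (card_decomp e) (card_decomp d) ltn_add2r card_sset_lt //.
    by apply: contraTneq R0 => /(congr1 (fun A => ~: A)); rewrite setCK setCT => ->;
      rewrite cards0.
  + move=> Q W e t' Q0 QT; apply: phiM => //.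
    by rewrite card_sset card_gt0.
- by move=> a; rewrite ug (eps_iota Hb).
- move=> I a; have [I0|I0] := posnP #|I|.
    by rewrite (positive0 a (prim_pos Hi) I0) !linear0.
  rewrite gE conv_unit_n0 // add0r convE (bigD1 setT) // (conv_at_setT Hc Hn) ?left_part_dset //.
  rewrite big1 => [|S ST]; first by rewrite -[LHS]/(f I (j I (i I a)) + 0) addr0 ji.
  rewrite conv_atE; have [S0|S0] := posnP #|{: sset S}|.
    by rewrite tmap0l ?linear0 // => y; exact: phi0.
  rewrite (prim_Delta Hi) ?linear0 // card_sset card_gt0.
  by apply: contra ST => /eqP e; rewrite -(setCK S) e setC0.
Qed.
End Universal.

(** Both monoids have the universal property of the free monoid on [r]. *)
Lemma connected_0bimonoid_iso (K : fieldType) (k k' r : species K) (m : monoid_ops k)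
    (c : comonoid_ops k) (m' : monoid_ops k') (c' : comonoid_ops k')
    (i : smorph r k) (i' : smorph r k') :
  connected_0bimonoid m c -> connected_0bimonoid m' c' ->
  is_primitives c i -> is_primitives c' i' ->
  monoid_iso m m'.
Proof.
move=> Hk Hk' Hi Hi'.
have Hm := bimon_monoid (conn0_bimonoid Hk); have Hm' := bimon_monoid (conn0_bimonoid Hk').
have [f [fM f1] fi] := prim_extend Hk Hi Hm' i'.
have [g [gM g1] gi] := prim_extend Hk' Hi' Hm i.
have idM (l : species K) (o : monoid_ops l) : is_monoid_morph o o (smorph_id l).
  by split=> // S T I d x; rewrite tmap_id.
exists f, g; split=> // I x.
- apply: (@prim_morph_eq K k m c Hk r i Hi k m (smorph_comp g f) (smorph_id k)) => //.
    by split=> [S T J d y|a] /=; rewrite ?fM ?gM ?tmap_comp ?f1 ?g1.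
  by move=> J a /=; rewrite fi gi.
- apply: (@prim_morph_eq K k' m' c' Hk' r i' Hi' k' m' (smorph_comp f g) (smorph_id k')) => //.
    by split=> [S T J d y|a] /=; rewrite ?gM ?fM ?tmap_comp ?f1 ?g1.
  by move=> J a /=; rewrite gi fi.
Qed.

(** * The species of primitive elements *)

Section Submodule.
Variables (K : fieldType) (V : lmodType K).

(** Subspaces are given by predicates because the components of a species may be
    infinite-dimensional. *)
Record submod := Submod {
  smem :> V -> Prop;
  smem0 : smem 0;
  smemP : forall a x y, smem x -> smem y -> smem (a *: x + y)
}.

Variable S : submod.

Definition subm_type := {x : V | `[< S x >]}.
HB.instance Definition _ := Choice.on subm_type.

Definition subm_val (x : subm_type) : V := val x.
Definition subm_in (x : V) (h : S x) : subm_type := exist _ x (introT (asboolP _) h).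

Lemma subm_val_inj : injective subm_val. Proof. exact: val_inj. Qed.
Lemma subm_valP x : S (subm_val x). Proof. exact: (elimT (asboolP _) (valP x)). Qed.

Definition subm_zero := subm_in (smem0 S).
Definition subm_lin a x y := subm_in (smemP a (subm_valP x) (subm_valP y)).
Definition subm_add := subm_lin 1.
Definition subm_scale a x := subm_lin a x subm_zero.
Definition subm_opp := subm_scale (-1).

Lemma subm_valD x y : subm_val (subm_add x y) = subm_val x + subm_val y.
Proof. by rewrite /subm_val /= scale1r. Qed.
Lemma subm_valZ a x : subm_val (subm_scale a x) = a *: subm_val x.
Proof. by rewrite /subm_val /= addr0. Qed.
Lemma subm_valN x : subm_val (subm_opp x) = - subm_val x.
Proof. by rewrite subm_valZ scaleN1r. Qed.

Lemma subm_addA : associative subm_add.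
Proof. by move=> x y z; apply: subm_val_inj; rewrite !subm_valD addrA. Qed.
Lemma subm_addC : commutative subm_add.
Proof. by move=> x y; apply: subm_val_inj; rewrite !subm_valD addrC. Qed.
Lemma subm_add0 : left_id subm_zero subm_add.
Proof. by move=> x; apply: subm_val_inj; rewrite subm_valD add0r. Qed.
Lemma subm_addN : left_inverse subm_zero subm_opp subm_add.
Proof. by move=> x; apply: subm_val_inj; rewrite subm_valD subm_valN addNr. Qed.

HB.instance Definition _ := GRing.isZmodule.Build subm_type subm_addA subm_addC subm_add0 subm_addN.

Lemma subm_scaleA a b x : subm_scale a (subm_scale b x) = subm_scale (a * b) x.
Proof. by apply: subm_val_inj; rewrite !subm_valZ scalerA. Qed.
Lemma subm_scale1 : left_id 1 subm_scale.
Proof. by move=> x; apply: subm_val_inj; rewrite subm_valZ scale1r. Qed.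
Lemma subm_scaleDr : right_distributive subm_scale +%R.
Proof. by move=> a x y; apply: subm_val_inj; rewrite !(subm_valZ, subm_valD) scalerDr. Qed.
Lemma subm_scaleDl x : {morph subm_scale^~ x : a b / a + b}.
Proof. by move=> a b; apply: subm_val_inj; rewrite !(subm_valZ, subm_valD) scalerDl. Qed.

HB.instance Definition _ := GRing.Zmodule_isLmodule.Build K subm_type
  subm_scaleA subm_scale1 subm_scaleDr subm_scaleDl.

Definition subm : lmodType K := subm_type.

Lemma subm_val_is_linear : linear (subm_val : subm -> V).
Proof. by move=> a x y; rewrite -subm_valZ -subm_valD. Qed.
HB.instance Definition _ := GRing.isLinear.Build K subm V *:%R
  (subm_val : subm -> V) subm_val_is_linear.

Definition subm_incl : {linear subm -> V} := locked_with linear_key (subm_val : {linear subm -> V}).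

Lemma subm_incl_inj : injective subm_incl.
Proof. by rewrite /subm_incl unlock; exact: subm_val_inj. Qed.
Lemma subm_inclP x : S (subm_incl x).
Proof. by rewrite /subm_incl unlock; exact: subm_valP. Qed.
Lemma subm_incl_ex x : S x -> exists y, subm_incl y = x.
Proof. by move=> h; exists (subm_in h); rewrite /subm_incl unlock. Qed.
End Submodule.

(** Relabellings restrict to the subspaces by choosing preimages under the inclusions;
    injectivity of the inclusions makes them linear and functorial. *)
Lemma subspecies_ex (K : fieldType) (p : species K) (S : forall I, submod (p I)) :
  (forall I J (u : bij I J) x, S I x -> S J (act p u x)) ->
  exists (r : species K) (i : smorph r p), [/\ forall I, injective (i I),
    forall I a, S I (i I a) & forall I x, S I x -> exists a, i I a = x].
Proof.
move=> hS.
have hact I J (u : bij I J) (a : subm (S I)) :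
    exists b, subm_incl (S J) b = act p u (subm_incl _ a).
  by apply: subm_incl_ex; apply: hS; exact: subm_inclP.
pose f I J u a := sval (cid (hact I J u a)).
have fE I J u a : subm_incl (S J) (f I J u a) = act p u (subm_incl _ a).
  by rewrite /f; case: (cid _).
have fl I J u : linear (f I J u).
  by move=> a x y; apply: subm_incl_inj; rewrite linearP !fE !linearP.
pose F I J (u : bij I J) : {linear subm (S I) -> subm (S J)} :=
  HB.pack (f I J u) (GRing.isLinear.Build K _ _ *:%R _ (fl I J u)).
have F1 I : F I I (bij_id I) =1 idfun.
  by move=> x; apply: subm_incl_inj; rewrite [LHS]fE act1.
have F2 I J L (g : bij J L) (u : bij I J) : F I L (bij_o g u) =1 F J L g \o F I J u.
  by move=> x; apply: subm_incl_inj; rewrite [LHS]fE [RHS]fE [in RHS]fE act_o.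
pose r := @Species K (fun I => subm (S I)) F F1 F2.
have inat I J (u : bij I J) (x : r I) : subm_incl (S J) (act r u x) = act p u (subm_incl (S I) x).
  exact: fE.
exists r, (@Smorph K r p (fun I => subm_incl (S I)) inat).
split=> [I|I a|I x]; [exact: subm_incl_inj|exact: subm_inclP|exact: subm_incl_ex].
Qed.

Lemma primitives_ex (K : fieldType) (k : species K) (c : comonoid_ops k) :
  is_comonoid c -> exists (r : species K) (i : smorph r k), is_primitives c i.
Proof.
move=> Hc.
pose P (I : finType) (x : k I) := (#|I| = 0%N -> x = 0) /\
  forall U V (d : decomp U V I), (0 < #|U|)%N -> (0 < #|V|)%N -> Delta c d x = 0.
have P0 I : P I 0 by split=> // U V d _ _; rewrite linear0.
have PP I a x y : P I x -> P I y -> P I (a *: x + y).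
  case=> x0 hx [y0 hy]; split=> [I0|U V d U0 V0].
    by rewrite x0 // y0 // scaler0 addr0.
  by rewrite linearP hx // hy // scaler0 addr0.
have [|r [i [ii iP iS]]] := @subspecies_ex K k (fun I => Submod (P0 I) (@PP I)).
  move=> I J u x [x0 hx]; split=> [J0|U V d U0 V0].
    by rewrite x0 ?linear0 // (bij_card u).
  have uV := bij_invVK u.
  have [|a [b h']] := @restricts_ex _ _ _ _ _ _ (dset (bij_inv u @: left_part d)) d u.
    rewrite left_part_dset -imset_comp -[RHS]imset_id; apply: eq_imset => y; exact: uV.
  by rewrite (Delta_nat Hc h') hx ?linear0 ?(bij_card a) ?(bij_card b).
exists r, i; split=> //.
- by move=> x; apply: ii; rewrite linear0; case: (iP _ x) => h _; apply: h; rewrite card_void.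
- by move=> U V I d a U0 V0; case: (iP _ a) => _; apply.
- by move=> I x I0 h; apply: iS; split=> // e; rewrite e in I0.
Qed.

(** * Monomials in the free monoid *)

Lemma sset_bij_img (S I : finType) (i : S -> I) (A : {set S}) (B : {set I})
    (g : bij (sset A) (sset B)) : (forall x, val (g x) = i (val x)) -> B = i @: A.
Proof.
move=> h; apply/setP => y; apply/idP/imsetP => [yB|[x xA ->]].
  exists (val (bij_inv g (exist _ y yB))); first exact: valP.
  by rewrite -h bij_invVK.
by rewrite -[x]/(val (exist _ x xA : sset A)) -h; exact: valP.
Qed.

Lemma comp_set0 (I : finType) (F : composition I) : set0 \notin blocks F.
Proof. by case/and3P: (blocksP F). Qed.

Lemma comp_disjoint (I : finType) (F : composition I) :
  pairwise (fun A B : {set I} => [disjoint A & B]) F.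
Proof. by case/and3P: (blocksP F). Qed.

Lemma comp_cover (I : finType) (F : composition I) x : exists2 A, A \in blocks F & x \in A.
Proof. by case/and3P: (blocksP F) => _ _ /forallP/(_ x)/hasP. Qed.

Lemma comp_uniq (I : finType) (F : composition I) : uniq (blocks F).
Proof.
move: (comp_set0 F) (comp_disjoint F); elim: (blocks F) => //= A s ih.
rewrite in_cons negb_or => /andP[A0 s0] /andP[dA ds]; rewrite ih // andbT.
apply/negP => As; have /= := allP dA _ As; rewrite -setI_eq0 setIid => /eqP A0'.
by rewrite A0' eqxx in A0.
Qed.

Section Pure.
Implicit Types I J R S T U V : finType.
Variables (K : fieldType) (q : species K).

Definition block_section I := forall A : {set I}, q (sset A).

Fixpoint pure I (F : seq {set I}) (a : block_section I) : tens q F :=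
  match F return tens q F with
  | [::] => (1 : K^o)
  | A :: F' => a A ⊠ pure F' a
  end.

Lemma pure_eq I F (a b : block_section I) : (forall A, A \in F -> a A = b A) ->
  pure F a = pure F b.
Proof.
elim: F => //= A F ih h; rewrite h ?mem_head // ih // => B BF.
by rewrite h // inE BF orbT.
Qed.

Definition section_upd I (a : block_section I) A (v : q (sset A)) : block_section I := fun B =>
  if @eqP _ A B is ReflectT e then ecast H (q (sset H)) e v else a B.

Lemma section_upd_eq I (a : block_section I) A v : section_upd a v A = v.
Proof. by rewrite /section_upd; case: eqP => // e; rewrite (eq_irrelevance e erefl). Qed.
Lemma section_upd_ne I (a : block_section I) A (v : q (sset A)) B :
  B != A -> section_upd a v B = a B.
Proof. by rewrite /section_upd; case: eqP => // e /eqP[]; exact: esym. Qed.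

(** Since the blocks of a composition are distinct, a pure tensor over them is a choice
    of one vector per set, so that [pure] spans without any transport along equalities. *)
Lemma tens_pure_ext I (F : seq {set I}) (W : lmodType K) (f g : tens q F -> W) :
  uniq F -> linear f -> linear g -> (forall a, f (pure F a) = g (pure F a)) -> f =1 g.
Proof.
elim: F f g => [|A F ih] f g /=.
  move=> _ hf hg h x; have {h} h := h (fun=> 0).
  have E (l : K^o -> W) : linear l -> l x = x *: l 1.
    move=> hl; have l0 : l 0 = 0 by have := hl (-1) 0 0; rewrite scaler0 addr0 scaleN1r addNr.
    by have := hl x 1 0; rewrite l0 !addr0 => <-; congr l; rewrite -[RHS]/(x * 1) mulr1.
  by rewrite (E f hf) (E g hg) h.
case/andP=> AF uF hf hg h; apply: tens_ext => // v w; move: w.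
apply: (ih (fun w => f (v ⊠ w)) (fun w => g (v ⊠ w)) uF).
- by move=> a x y /=; rewrite tpure_linr hf.
- by move=> a x y /=; rewrite tpure_linr hg.
move=> a; have := h (section_upd a v).
rewrite section_upd_eq (@pure_eq _ _ (section_upd a v) a) // => B BF.
by rewrite section_upd_ne //; apply: contraNneq AF => <-.
Qed.

Definition monom I (F : composition I) (a : block_section I) : free_species q I :=
  dinj (fun G : composition I => tens q G) F (pure F a).

Lemma monom_ext I (W : lmodType K) (f g : free_species q I -> W) : linear f -> linear g ->
  (forall F a, f (monom F a) = g (monom F a)) -> f =1 g.
Proof.
move=> hf hg h.
pose f' : {linear free_obj q I -> W} := HB.pack f (GRing.isLinear.Build K _ _ *:%R f hf).
pose g' : {linear free_obj q I -> W} := HB.pack g (GRing.isLinear.Build K _ _ *:%R g hg).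
apply: (@free_ext K q I W f' g') => F.
apply: (@tens_pure_ext I F W (fun v => f' (dinj _ F v)) (fun v => g' (dinj _ F v))).
- exact: comp_uniq.
- by move=> c x y; rewrite !linearP.
- by move=> c x y; rewrite !linearP.
- by move=> a; exact: h.
Qed.

Lemma monom_ext2 S T (W : lmodType K) (f g : free_species q S ⊗ free_species q T -> W) :
  linear f -> linear g ->
  (forall F a G b, f (monom F a ⊠ monom G b) = g (monom F a ⊠ monom G b)) -> f =1 g.
Proof.
move=> hf hg h; apply: tens_ext => // v w; move: v; apply: monom_ext => [||F a].
- by move=> c x y /=; rewrite tpure_linl hf.
- by move=> c x y /=; rewrite tpure_linl hg.
move: w; apply: monom_ext => [||G b]; last exact: h.
- by move=> c x y /=; rewrite tpure_linr hf.
- by move=> c x y /=; rewrite tpure_linr hg.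
Qed.

Lemma monom_eq I (F G : composition I) a b : blocks F = blocks G ->
  (forall A, A \in blocks F -> a A = b A) -> monom F a = monom G b.
Proof.
by move=> e h; have {}e : F = G by [apply: val_inj]; subst G; rewrite /monom (pure_eq h).
Qed.

(** Transport of a choice of vectors along the injection [i]. Allowing any relabelling
    [g] above [i] spares casts when two images of a block agree only propositionally. *)
Definition transports S I (i : S -> I) (F : seq {set S}) (a : block_section S)
    (c : block_section I) :=
  forall A, A \in F -> forall B (g : bij (sset A) (sset B)),
    (forall x, val (g x) = i (val x)) -> c B = act q g (a A).

Lemma transports_comp S T I (i : S -> T) (j : T -> I) F a b c : injective i ->
  transports i F a b -> transports j (img i F) b c -> transports (j \o i) F a c.
Proof.
move=> hi hab hbc A AF B g hg.
pose g2 := sset_img hi A; pose g1 := bij_o g (bij_inv g2).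
have h1 y : val (g1 y) = j (val y).
  by rewrite /= hg /= -[in RHS](bij_invVK g2 y).
rewrite (hbc _ (map_f _ AF) _ g1 h1) (hab _ AF _ g2) // act_o.
by congr (act q _ _); apply: Defs.bij_eq => x /=; rewrite bij_invK.
Qed.

Lemma transports_uniq S I (i j : S -> I) F a b c : injective i -> i =1 j ->
  transports i F a b -> transports j F a c -> forall B, B \in img i F -> b B = c B.
Proof.
move=> hi ij hb hc _ /mapP[A AF ->]; rewrite (hb A AF _ (sset_img hi A)) //.
by rewrite (hc A AF _ (sset_img hi A)) // => x /=; rewrite ij.
Qed.

Lemma push_ex S I (i : S -> I) F a : injective i -> exists c, transports i F a c.
Proof.
move=> hi.
have h (B : {set I}) : exists y, forall A, A \in F -> forall g : bij (sset A) (sset B),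
    (forall x, val (g x) = i (val x)) -> y = act q g (a A).
  have [[A [AF [g hg]]]|n] := pselect (exists A, A \in F /\
      exists g : bij (sset A) (sset B), forall x, val (g x) = i (val x)).
    exists (act q g (a A)) => A' A'F g' hg'.
    have e : A' = A.
      by apply: (imset_inj hi); rewrite -(sset_bij_img hg) -(sset_bij_img hg').
    subst A'; congr (act q _ _); apply: Defs.bij_eq => x; apply: val_inj.
    by rewrite hg hg'.
  by exists 0 => A AF g hg; case: n; exists A; split=> //; exists g.
by exists (fun B => sval (cid (h B))) => A AF B g hg; case: (cid _) => y /= hy; exact: hy hg.
Qed.

Lemma pull_ex S I (i : S -> I) F c : injective i -> exists a, transports i F a c.
Proof.
move=> hi; exists (fun A => act q (bij_inv (sset_img hi A)) (c (i @: A))) => A AF B g hg.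
have e := sset_bij_img hg; subst B; rewrite act_o act_id1 // => x.
by apply: val_inj; rewrite /= hg -[in RHS](bij_invVK (sset_img hi A) x).
Qed.

Lemma glue_ex S T I (d : decomp S T I) (F : composition S) (G : composition T) a b :
  exists c, transports (dl d) F a c /\ transports (dr d) G b c.
Proof.
have [c1 h1] := push_ex F a (@dl_inj _ _ _ d).
have [c2 h2] := push_ex G b (@dr_inj _ _ _ d).
exists (fun B => if B \in img (dl d) F then c1 B else c2 B); split=> A AF B g hg.
  have -> : B \in img (dl d) F by rewrite (sset_bij_img hg) map_f.
  exact: h1.
rewrite ifN; first exact: h2.
apply/negP => /mapP[A' A'F e]; have e2 := sset_bij_img hg.
have /set0Pn[x xA] : A != set0 by apply: contraNneq (comp_set0 G) => <-.
have : dr d x \in B by rewrite e2 imset_f.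
by rewrite e => /imsetP[y _ /esym/eqP]; apply/negP; exact: dlr_neq.
Qed.

Lemma tens_img_pure S I (i : S -> I) (hi : injective i) F a c : transports i F a c ->
  tens_img q hi F (pure F a) = pure (img i F) c.
Proof.
elim: F => //= A F ih h; rewrite tmapE ih => [|B BF]; last by apply: h; rewrite inE BF orbT.
by rewrite (h A (mem_head _ _) _ (sset_img hi A)).
Qed.

Lemma tens_cat_pure I (F G : seq {set I}) c :
  tens_cat q F G (pure F c ⊠ pure G c) = pure (F ++ G) c.
Proof.
elim: F => /= [|A F ih]; first by rewrite lunitE scale1r.
by rewrite tassocE tmapE ih.
Qed.

Lemma free_mu_dinj S T I (d : decomp S T I) (F : composition S) (G : composition T) v w :
  mu (free_monoid q) d (dinj (fun H : composition S => tens q H) F v ⊠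
                        dinj (fun H : composition T => tens q H) G w) =
  dinj (fun H : composition I => tens q H) (comp_cat d F G)
    (tens_cat q _ _ (tens_img q (@dl_inj _ _ _ d) F v ⊠ tens_img q (@dr_inj _ _ _ d) G w)).
Proof.
rewrite /= /free_mu lsumE (bigD1 F) // big1 => [|F' ne].
  rewrite lsumE (bigD1 G) // big1 => [|G' ne].
    by rewrite /= !tmapE /= !dproj_dinj !addr0.
  by rewrite /= !tmapE /= (dproj_dinj_ne _ (j := G)) 1?eq_sym // linear0 tpure0r !linear0.
rewrite lsumE big1 // => G' _.
by rewrite /= !tmapE /= (dproj_dinj_ne _ (j := F)) 1?eq_sym // linear0 tpure0l !linear0.
Qed.

Lemma free_mu_monom S T I (d : decomp S T I) (F : composition S) (G : composition T) a b c :
  transports (dl d) F a c -> transports (dr d) G b c ->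
  mu (free_monoid q) d (monom F a ⊠ monom G b) = monom (comp_cat d F G) c.
Proof.
move=> ha hb; rewrite free_mu_dinj (tens_img_pure _ ha) (tens_img_pure _ hb).
by rewrite tens_cat_pure.
Qed.

Lemma free_act_monom S I (u : bij S I) (F : composition S) a c : transports u F a c ->
  act (free_species q) u (monom F a) = monom (comp_img u F) c.
Proof. by move=> h; rewrite [LHS]free_act_dinj (tens_img_pure _ h). Qed.

Lemma free_iota_monom a : miota (free_monoid q) 1 = monom comp_nil a.
Proof. by []. Qed.
End Pure.

Lemma img_comp (S T I : finType) (i : S -> T) (j : T -> I) F :
  img j (img i F) = img (j \o i) F.
Proof. by rewrite /img -map_comp; apply: eq_map => A /=; rewrite -imset_comp. Qed.

Lemma eq_img (S I : finType) (i j : S -> I) F : i =1 j -> img i F = img j F.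
Proof. by move=> h; apply: eq_map => A; exact: eq_imset. Qed.

Lemma img_cat (S I : finType) (i : S -> I) F G : img i (F ++ G) = img i F ++ img i G.
Proof. exact: map_cat. Qed.

Lemma comp_void (F : composition void) : blocks F = [::].
Proof. by apply: size0nil; apply/eqP; rewrite -leqn0 -card_void size_composition. Qed.

Lemma comp_card0 (I : finType) (F : composition I) : #|I| = 0%N -> blocks F = [::].
Proof. by move=> h; apply: size0nil; apply/eqP; rewrite -leqn0 -h size_composition. Qed.

Section FreeMon.
Implicit Types I J R S T U V : finType.
Variables (K : fieldType) (q : species K).

Local Notation M := (free_monoid q).

Lemma transports_sub S I (i : S -> I) (F G : seq {set S}) (a : block_section q S) c :
  {subset F <= G} -> transports i G a c -> transports i F a c.
Proof. by move=> h hG A /h; exact: hG. Qed.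

Lemma transports_catl S I (i : S -> I) F G (a : block_section q S) c :
  transports i (F ++ G) a c -> transports i F a c.
Proof. by apply: transports_sub => x xF; rewrite mem_cat xF. Qed.
Lemma transports_catr S I (i : S -> I) F G (a : block_section q S) c :
  transports i (F ++ G) a c -> transports i G a c.
Proof. by apply: transports_sub => x xF; rewrite mem_cat xF orbT. Qed.

Lemma transports_id S (i : S -> S) F (a c : block_section q S) : i =1 id ->
  transports i F a c -> forall A, A \in F -> c A = a A.
Proof.
by move=> hi h A AF; rewrite (h A AF A (bij_id _)) ?act1 // => x; rewrite hi.
Qed.

Lemma free_mu_nat S T I S' T' I' (d : decomp S T I) (d' : decomp S' T' I') f g u :
  restricts d d' f g u -> forall x,
  act (free_species q) u (mu M d x) =
  mu M d' (tmap (act (free_species q) f) (act (free_species q) g) x).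
Proof.
case=> h1 h2; apply: monom_ext2 => [||F a G b]; [solve_linear|solve_linear|].
have [c [ac bc]] := glue_ex d F G a b.
have [c' cc'] := push_ex (comp_cat d F G) c (@inj_bij _ _ u).
have [fa hfa] := push_ex F a (@inj_bij _ _ f).
have [gb hgb] := push_ex G b (@inj_bij _ _ g).
have [e [fae gbe]] := glue_ex d' (comp_img f F) (comp_img g G) fa gb.
rewrite (free_mu_monom ac bc) (free_act_monom cc') tmapE (free_act_monom hfa) (free_act_monom hgb).
rewrite (free_mu_monom fae gbe).
have E1 := transports_comp (@dl_inj _ _ _ d) ac (transports_catl cc').
have E2 := transports_comp (@inj_bij _ _ f) hfa fae.
have E3 := transports_comp (@dr_inj _ _ _ d) bc (transports_catr cc').
have E4 := transports_comp (@inj_bij _ _ g) hgb gbe.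
have i1 : injective (u \o dl d) by apply: inj_comp; [exact: inj_bij|exact: dl_inj].
have i2 : injective (u \o dr d) by apply: inj_comp; [exact: inj_bij|exact: dr_inj].
apply: monom_eq => [|A /=].
  by rewrite /= img_cat !img_comp; congr (_ ++ _); apply: eq_img => x /=.
rewrite img_cat !img_comp mem_cat => /orP[].
- exact: (transports_uniq i1 h1 E1 E2).
- exact: (transports_uniq i2 h2 E3 E4).
Qed.

Lemma free_mu_assoc R S T U V I (d1 : decomp R S U) (d2 : decomp U T I)
    (e1 : decomp S T V) (e2 : decomp R V I) : dassoc d1 d2 e1 e2 -> forall x,
  mu M d2 (tmap (mu M d1) idfun x) = mu M e2 (tmap idfun (mu M e1) (tassoc _ _ _ x)).
Proof.
case=> h1 h2 h3; apply: tens_ext => [||t z]; [solve_linear|solve_linear|]; move: t.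
apply: monom_ext2 => [||F a G b]; [solve_linear|solve_linear|]; move: z.
apply: monom_ext => [||H c]; [solve_linear|solve_linear|].
have [ab [ha hb]] := glue_ex d1 F G a b.
have [l [hab hc]] := glue_ex d2 (comp_cat d1 F G) H ab c.
have [bc [hb' hc']] := glue_ex e1 G H b c.
have [r [ha' hbc]] := glue_ex e2 F (comp_cat e1 G H) a bc.
rewrite tmapE (free_mu_monom ha hb) (free_mu_monom hab hc).
rewrite tassocE tmapE (free_mu_monom hb' hc') (free_mu_monom ha' hbc).
have E1 := transports_comp (@dl_inj _ _ _ d1) ha (transports_catl hab).
have E2 := transports_comp (@dr_inj _ _ _ d1) hb (transports_catr hab).
have E3 := transports_comp (@dl_inj _ _ _ e1) hb' (transports_catl hbc).
have E4 := transports_comp (@dr_inj _ _ _ e1) hc' (transports_catr hbc).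
have i1 : injective (dl d2 \o dl d1) by apply: inj_comp; exact: dl_inj.
have i2 : injective (dl d2 \o dr d1) by apply: inj_comp; [exact: dl_inj|exact: dr_inj].
apply: monom_eq => [|A /=].
  rewrite /= !img_cat !img_comp -catA.
  by congr (_ ++ (_ ++ _)); apply: eq_img => x /=.
rewrite img_cat !img_comp !mem_cat => /orP[/orP[]|].
- exact: (transports_uniq i1 h1 E1 ha').
- exact: (transports_uniq i2 h2 E2 E3).
- exact: (transports_uniq (@dr_inj _ _ _ d2) h3 hc E4).
Qed.

Lemma free_unitl I x : mu M (dvoidl I) (miota M 1 ⊠ x) = x.
Proof.
move: x; apply: monom_ext => [||F a]; [solve_linear|by solve_linear|].
pose o : block_section q void := fun=> 0; rewrite (free_iota_monom o).
have [c [oc ac]] := glue_ex (dvoidl I) comp_nil F o a.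
rewrite (free_mu_monom oc ac).
have e : img (dr (dvoidl I)) F = F.
  by rewrite /img -[RHS]map_id; apply: eq_map => A /=; exact: imset_id.
by apply: monom_eq => //= A; rewrite e; exact: transports_id ac _.
Qed.

Lemma free_unitr I x : mu M (dvoidr I) (x ⊠ miota M 1) = x.
Proof.
move: x; apply: monom_ext => [||F a]; [solve_linear|by solve_linear|].
pose o : block_section q void := fun=> 0; rewrite (free_iota_monom o).
have [c [ac oc]] := glue_ex (dvoidr I) F comp_nil a o.
rewrite (free_mu_monom ac oc).
have e : img (dl (dvoidr I)) F = F.
  by rewrite /img -[RHS]map_id; apply: eq_map => A /=; exact: imset_id.
by apply: monom_eq => [|A] /=; rewrite cats0 e //; exact: transports_id ac _.
Qed.

Lemma miotaZ (p : species K) (m : monoid_ops p) (a : K^o) : miota m a = a *: miota m 1.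
Proof. by rewrite -linearZ; congr (miota m _); rewrite -[RHS]/(a * 1) mulr1. Qed.

Lemma free_is_monoid : is_monoid M.
Proof.
split; [exact: free_mu_nat|exact: free_mu_assoc|move=> I|move=> I].
- apply: tens_ext => [||a x]; [solve_linear|solve_linear|].
  by rewrite tmapE lunitE miotaZ tpureZl linearZ /= -/(mu M _) free_unitl.
- apply: tens_ext => [||x a]; [solve_linear|solve_linear|].
  by rewrite tmapE runitE miotaZ tpureZr linearZ /= -/(mu M _) free_unitr.
Qed.

(** Both sides list the same blocks, in the orders A, C, B, D and A, B, C, D; these
    agree since B or C contributes no block. *)
Lemma free_mu_cross A B C D S T S' T' I
    (d : decomp S T I) (d' : decomp S' T' I) (eS : decomp A B S) (eT : decomp C D T)
    (eS' : decomp A C S') (eT' : decomp B D T') : dcross d d' eS eT eS' eT' ->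
  (#|B| * #|C| = 0)%N -> forall x,
  mu M d' (tmap (mu M eS') (mu M eT') (tmid _ _ (tswap _ _) x)) =
  mu M d (tmap (mu M eS) (mu M eT) x).
Proof.
case=> h1 h2 h3 h4 BC.
have E t z : mu M d' (tmap (mu M eS') (mu M eT') (tmid _ _ (tswap _ _) (t ⊠ z))) =
  mu M d (tmap (mu M eS) (mu M eT) (t ⊠ z)); last first.
  by apply: tens_ext => [||t z]; [solve_linear|solve_linear|exact: E].
move: t; apply: monom_ext2 => [||F1 a1 F2 a2]; [solve_linear|solve_linear|]; move: z.
apply: monom_ext2 => [||F3 a3 F4 a4]; [solve_linear|solve_linear|].
have [l1 [p1 p3]] := glue_ex eS' F1 F3 a1 a3.
have [l2 [p2 p4]] := glue_ex eT' F2 F4 a2 a4.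
have [l [pl1 pl2]] := glue_ex d' (comp_cat eS' F1 F3) (comp_cat eT' F2 F4) l1 l2.
have [r1 [q1 q2]] := glue_ex eS F1 F2 a1 a2.
have [r2 [q3 q4]] := glue_ex eT F3 F4 a3 a4.
have [r [qr1 qr2]] := glue_ex d (comp_cat eS F1 F2) (comp_cat eT F3 F4) r1 r2.
rewrite tmid_swapE !tmapE (free_mu_monom p1 p3) (free_mu_monom p2 p4) (free_mu_monom pl1 pl2).
rewrite (free_mu_monom q1 q2) (free_mu_monom q3 q4) (free_mu_monom qr1 qr2).
have L1 := transports_comp (@dl_inj _ _ _ _) p1 (transports_catl pl1).
have L3 := transports_comp (@dr_inj _ _ _ _) p3 (transports_catr pl1).
have L2 := transports_comp (@dl_inj _ _ _ _) p2 (transports_catl pl2).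
have L4 := transports_comp (@dr_inj _ _ _ _) p4 (transports_catr pl2).
have R1 := transports_comp (@dl_inj _ _ _ _) q1 (transports_catl qr1).
have R2 := transports_comp (@dr_inj _ _ _ _) q2 (transports_catr qr1).
have R3 := transports_comp (@dl_inj _ _ _ _) q3 (transports_catl qr2).
have R4 := transports_comp (@dr_inj _ _ _ _) q4 (transports_catr qr2).
have e1 : img (dl d' \o dl eS') F1 = img (dl d \o dl eS) F1 by apply: eq_img => x /=.
have e2 : img (dr d' \o dl eT') F2 = img (dl d \o dr eS) F2 by apply: eq_img => x /=.
have e3 : img (dl d' \o dr eS') F3 = img (dr d \o dl eT) F3 by apply: eq_img => x /=.
have e4 : img (dr d' \o dr eT') F4 = img (dr d \o dr eT) F4 by apply: eq_img => x /=.
apply: monom_eq => [|Z] /=; rewrite !img_cat !img_comp.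
  rewrite e1 e2 e3 e4; move/eqP: BC; rewrite muln_eq0 => /orP[]/eqP/comp_card0 h.
  - by rewrite (h F2) /= cats0 catA.
  - by rewrite (h F3) /= cats0 catA.
have iA : injective (dl d' \o dl eS') by apply: inj_comp; exact: dl_inj.
have iB : injective (dr d' \o dl eT') by apply: inj_comp; [exact: dr_inj|exact: dl_inj].
have iC : injective (dl d' \o dr eS') by apply: inj_comp; [exact: dl_inj|exact: dr_inj].
have iD : injective (dr d' \o dr eT') by apply: inj_comp; exact: dr_inj.
rewrite !mem_cat => /orP[]/orP[].
- exact: (transports_uniq iA (fun x => esym (h1 x)) L1 R1).
- exact: (transports_uniq iC (fun x => esym (h3 x)) L3 R3).
- exact: (transports_uniq iB (fun x => esym (h2 x)) L2 R2).
- exact: (transports_uniq iD (fun x => esym (h4 x)) L4 R4).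
Qed.
End FreeMon.

(** * Deconcatenation *)

Section Initial.
Implicit Types I : finType.

(** [S] is initial in [F] when [F] lists the blocks inside [S] before those outside,
    and no block is cut by [S]. *)
Fixpoint initial I (S : {set I}) (F : seq {set I}) : bool :=
  if F is A :: F' then
    if A \subset S then initial S F' else all (fun B : {set I} => [disjoint B & S]) F
  else true.

Lemma initial_cat I (S : {set I}) F G : initial S (F ++ G) =
  if all (fun B : {set I} => B \subset S) F then initial S G
  else initial S F && all (fun B : {set I} => [disjoint B & S]) G.
Proof. by elim: F => //= A F ih; case: ifP => //= _; rewrite all_cat andbA. Qed.

Lemma initial_img (S I : finType) (i : S -> I) (X : {set I}) (F : seq {set S}) :
  initial X (img i F) = initial (i @^-1: X) F.
Proof.
have hd (A : {set S}) : [disjoint i @: A & X] = [disjoint A & i @^-1: X].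
  apply/pred0P/pred0P => h x; apply/negP => /=.
  - case/andP; rewrite inE => xA ixX; have := h (i x).
    by rewrite /= imset_f ?ixX.
  - case/andP=> /imsetP[y yA ->] iyX; have := h y.
    by rewrite /= yA inE iyX.
elim: F => //= A F ih; rewrite sub_imset_pre ih hd; case: ifP => // _.
by rewrite all_map; congr (_ && _); apply: eq_all => B /=; rewrite hd.
Qed.

Lemma all_sub_comp I (S : {set I}) (F : composition I) :
  all (fun B : {set I} => B \subset S) F = (S == setT).
Proof.
apply/allP/eqP => [h|-> B _]; last exact: subsetT.
apply/setP => x; rewrite inE; have [A AF xA] := comp_cover F x.
exact: (subsetP (h _ AF)).
Qed.

Lemma all_disjoint_comp I (S : {set I}) (F : composition I) :
  all (fun B : {set I} => [disjoint B & S]) F = (S == set0).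
Proof.
apply/allP/eqP => [h|-> B _]; last by rewrite disjoint_sym disjoints_subset sub0set.
apply/setP => x; rewrite inE; have [A AF xA] := comp_cover F x.
by have /pred0P/(_ x) := h _ AF; rewrite /= xA.
Qed.

Lemma initialT I (F : seq {set I}) : initial setT F.
Proof. by elim: F => //= A F ->; rewrite subsetT. Qed.

Lemma initial0 I (F : seq {set I}) : initial set0 F.
Proof.
elim: F => //= A F ->; case: ifP => // _.
by apply/andP; split; [|apply/allP => B _]; rewrite disjoint_sym disjoints_subset sub0set.
Qed.

(** The blocks of F come first. If X contains the whole left part, only the blocks of
    G remain to be tested; otherwise some block of F is not inside X, and all blocks
    of G must avoid X. *)
Lemma initial_comp_cat (S T I : finType) (d : decomp S T I) (X : {set I}) F G :
  initial X (comp_cat d F G) =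
  ((dl d @^-1: X == setT) || (dr d @^-1: X == set0)) &&
  (initial (dl d @^-1: X) F && initial (dr d @^-1: X) G).
Proof.
rewrite /= initial_cat !initial_img.
have -> : all (fun B : {set I} => B \subset X) (img (dl d) F) = (dl d @^-1: X == setT).
  by rewrite -(all_sub_comp _ F) all_map; apply: eq_all => A /=; rewrite sub_imset_pre.
have -> : all (fun B : {set I} => [disjoint B & X]) (img (dr d) G) = (dr d @^-1: X == set0).
  rewrite -(all_disjoint_comp _ G) all_map; apply: eq_all => A /=.
  apply/pred0P/pred0P => h x; apply/negP => /=.
  - case/andP; rewrite inE => xA ixX; have := h (dr d x).
    by rewrite /= imset_f ?ixX.
  - case/andP=> /imsetP[y yA ->] iyX; have := h y.
    by rewrite /= yA inE iyX.
case: eqP => [->|_]; first by rewrite initialT.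
by case: eqP => [->|_] /=; rewrite ?initial0 ?andbT ?andbF.
Qed.

Lemma initial_split I (S : {set I}) F : initial S F -> exists F1 F2,
  [/\ F = F1 ++ F2, all (fun B : {set I} => B \subset S) F1
    & all (fun B : {set I} => [disjoint B & S]) F2].
Proof.
elim: F => [|A F ih]; first by exists [::], [::].
rewrite /=; case: ifP => [AS /ih [F1 [F2 [-> h1 h2]]]|_ h].
  by exists (A :: F1), F2; rewrite /= AS.
by exists [::], (A :: F).
Qed.

Lemma img_preim (S I : finType) (i : S -> I) (F : seq {set I}) :
  all (fun B : {set I} => B \subset i @: [set: S]) F ->
  img i [seq i @^-1: B | B : {set I} <- F] = F.
Proof.
move/allP=> h; rewrite /img -map_comp -[RHS]map_id; apply/eq_in_map => B /h /subsetP hB.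
apply/setP => y; apply/imsetP/idP => [[x]|yB]; first by rewrite inE => ? ->.
by have /imsetP[x _ e] := hB _ yB; exists x; rewrite // inE -e.
Qed.

(** The blocks inside the left part of [d] come first in H, and pulling back both
    halves along the two injections gives F and G. *)
Lemma comp_cat_ex (S T I : finType) (d : decomp S T I) (H : composition I) :
  initial (left_part d) H -> exists F G, H = comp_cat d F G.
Proof.
case/initial_split => F1 [F2 [e h1 h2]].
have e1 := img_preim h1.
have {}h2 : all (fun B : {set I} => B \subset dr d @: [set: T]) F2.
  apply: sub_all h2 => B /pred0P hB; apply/subsetP => y yB.
  case: (decomp_cover d y) => -[x yx]; last by rewrite yx imset_f.
  by have := hB y; rewrite /= yB yx mem_dl.
have e2 := img_preim h2.
have cH0 := comp_set0 H; have cHd := comp_disjoint H.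
rewrite e mem_cat negb_or -e1 -e2 !img_set0 in cH0; case/andP: cH0 => F10 F20.
rewrite e pairwise_cat -e1 -e2 !img_disjoint in cHd; [|exact: dr_inj|exact: dl_inj].
case/and3P: cHd => _ F1d F2d.
have cF : is_composition [seq dl d @^-1: B | B : {set I} <- F1].
  rewrite /is_composition F10 F1d /=; apply/forallP => x; rewrite has_map.
  have [A] := comp_cover H (dl d x); rewrite e mem_cat => /orP[AF xA|AF xA].
    by apply/hasP; exists A; rewrite //= inE.
  have /imsetP[t _ /eqP] := subsetP (allP h2 _ AF) _ xA.
  by rewrite (negbTE (dlr_neq d _ _)).
have cG : is_composition [seq dr d @^-1: B | B : {set I} <- F2].
  rewrite /is_composition F20 F2d /=; apply/forallP => x; rewrite has_map.
  have [A] := comp_cover H (dr d x); rewrite e mem_cat => /orP[AF xA|AF xA].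
    have /imsetP[t _ /esym/eqP] := subsetP (allP h1 _ AF) _ xA.
    by rewrite (negbTE (dlr_neq d _ _)).
  by apply/hasP; exists A; rewrite //= inE.
by exists (Composition cF), (Composition cG); apply: val_inj; rewrite /= e1 e2.
Qed.

Lemma comp_cat_inj (S T I : finType) (d : decomp S T I) F G F' G' :
  comp_cat d F G = comp_cat d F' G' -> F = F' /\ G = G'.
Proof.
move/(congr1 val) => /= e.
have hF F0 G0 :
    [seq B : {set I} <- img (dl d) (blocks F0) ++ img (dr d) (blocks G0)
       | B \subset left_part d] =
    img (dl d) F0 :> seq {set I}.
  rewrite filter_cat (_ : filter _ (img (dr d) _) = [::]) ?cats0.
    apply/all_filterP/allP => _ /mapP[A _ ->]; exact: (imsetS _ (subsetT _)).
  apply/eqP; rewrite -size_eq0 size_filter -leqn0 leqNgt -has_count.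
  apply/hasP => -[_ /mapP[A AG ->]] /subsetP h.
  have /set0Pn[x xA] : A != set0 by apply: contraNneq (comp_set0 G0) => <-.
  by have := h _ (imset_f (dr d) xA); rewrite mem_dr.
have eF : img (dl d) F = img (dl d) F' by rewrite -(hF F G) e hF.
have eG : img (dr d) G = img (dr d) G'.
  have : size (img (dl d) F) = size (img (dl d) F') by rewrite eF.
  by move/eqP: e => + s; rewrite eqseq_cat // => /andP[_ /eqP].
split; apply: val_inj; [move: eF|move: eG]; apply: inj_map; apply: imset_inj;
  [exact: dl_inj|exact: dr_inj].
Qed.
End Initial.

Section Mask.
Implicit Types I J R S T U V : finType.
Variables (K : fieldType) (q : species K).

Local Notation M := (free_monoid q).
Local Notation Q := (free_species q).

(** This will turn out to be cutting along X followed by multiplying ([mu_deconcat]). *)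
Definition initproj I (X : {set I}) : {linear Q I -> Q I} :=
  lsum (fun F : composition I =>
    if initial X F then (dinj (fun G : composition I => tens q G) F \o
      dproj (fun G : composition I => tens q G) F : {linear Q I -> Q I}) else \0).

Lemma initproj_dinj I (X : {set I}) F v :
  initproj X (dinj (fun G : composition I => tens q G) F v) =
  if initial X F then dinj (fun G : composition I => tens q G) F v else 0.
Proof.
rewrite /initproj lsumE (bigD1 F) //= big1 => [|G ne].
  by case: ifP => _ /=; rewrite ?dproj_dinj addr0.
by case: ifP => _ //=; rewrite dproj_dinj_ne ?linear0 // eq_sym.
Qed.

Lemma initproj_monom I (X : {set I}) F (a : block_section q I) :
  initproj X (monom F a) = if initial X F then monom F a else 0.
Proof. exact: initproj_dinj. Qed.

Lemma initproj_comm I (X Y : {set I}) x : initproj X (initproj Y x) = initproj Y (initproj X x).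
Proof.
move: x; apply: monom_ext => [||F a]; [solve_linear|solve_linear|].
by rewrite !initproj_monom; case hX: (initial X F); case hY: (initial Y F);
  rewrite ?linear0 ?initproj_monom ?hX ?hY.
Qed.

Lemma initprojT I x : initproj [set: I] x = x.
Proof.
by move: x; apply: monom_ext => [||F a];
  [solve_linear|solve_linear|rewrite initproj_monom initialT].
Qed.

Lemma initproj0 I x : initproj (set0 : {set I}) x = x.
Proof.
by move: x; apply: monom_ext => [||F a];
  [solve_linear|solve_linear|rewrite initproj_monom initial0].
Qed.

Lemma initproj_act I J (u : bij I J) (X : {set J}) x :
  initproj X (act Q u x) = act Q u (initproj (u @^-1: X) x).
Proof.
move: x; apply: monom_ext => [||F a]; [solve_linear|solve_linear|].
have [c h] := push_ex F a (@inj_bij _ _ u).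
rewrite initproj_monom (free_act_monom h) initproj_monom initial_img.
case: ifP => _; last by rewrite linear0.
by rewrite (free_act_monom h).
Qed.

Lemma initproj_mu S T I (d : decomp S T I) (X : {set I}) x :
  initproj X (mu M d x) = if (dl d @^-1: X == setT) || (dr d @^-1: X == set0)
    then mu M d (tmap (initproj (dl d @^-1: X)) (initproj (dr d @^-1: X)) x) else 0.
Proof.
case XE: (_ || _); move: x; last first.
  apply: (@monom_ext2 _ _ _ _ _ _ (fun=> 0)) => [||F a G b]; [solve_linear| |].
    by move=> a x y; rewrite scaler0 addr0.
  have [c [ha hb]] := glue_ex d F G a b.
  by rewrite (free_mu_monom ha hb) initproj_monom initial_comp_cat XE.
apply: monom_ext2 => [||F a G b]; [solve_linear|solve_linear|].
have [c [ha hb]] := glue_ex d F G a b.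
rewrite (free_mu_monom ha hb) initproj_monom initial_comp_cat tmapE !initproj_monom XE /=.
case: (initial _ F) => /=; last by rewrite tpure0l linear0.
by case: ifP => _; rewrite ?tpure0r ?linear0 // (free_mu_monom ha hb).
Qed.

Fixpoint tens_img_inv S I (i : S -> I) (hi : injective i) (F : seq {set S}) :
    {linear tens q (img i F) -> tens q F} :=
  match F return {linear tens q (img i F) -> tens q F} with
  | [::] => idfun
  | A :: F' => tmap (act q (bij_inv (sset_img hi A))) (tens_img_inv hi F')
  end.

Lemma tens_imgK S I (i : S -> I) (hi : injective i) (F : seq {set S}) :
  cancel (tens_img q hi F) (tens_img_inv hi F).
Proof.
elim: F => //= A F ih; apply: tens_ext => [||a v]; [by solve_linear|by solve_linear|].
by rewrite !tmapE ih act_cancel //; exact: bij_invK.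
Qed.

Fixpoint tens_uncat I (F G : seq {set I}) :
    {linear tens q (F ++ G) -> tens q F ⊗ tens q G} :=
  match F return {linear tens q (F ++ G) -> tens q F ⊗ tens q G} with
  | [::] => lunitV (tens q G)
  | A :: F' => tassocV (q (sset A)) (tens q F') (tens q G) \o tmap idfun (tens_uncat F' G)
  end.

Lemma tens_catK I (F G : seq {set I}) : cancel (tens_cat q F G) (tens_uncat F G).
Proof.
elim: F => [|A F ih] /=.
  apply: tens_ext => [||a v]; [by solve_linear|by solve_linear|].
  by rewrite lunitE linearZ /= lunitVE -tpureZl -[a in RHS]mulr1.
apply: tens_ext3 => [||a v w]; [by solve_linear|by solve_linear|].
rewrite /= tassocE !tmapE ih; by rewrite tassocVE.
Qed.

(** The left inverse of the product that kills the compositions not of the form F . G. *)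
Definition deconcat S T I (d : decomp S T I) : {linear Q I -> Q S ⊗ Q T} :=
  lsum (fun F : composition S => lsum (fun G : composition T =>
    tmap (dinj (fun H : composition S => tens q H) F \o tens_img_inv (@dl_inj _ _ _ d) F)
         (dinj (fun H : composition T => tens q H) G \o tens_img_inv (@dr_inj _ _ _ d) G) \o
    tens_uncat (img (dl d) F) (img (dr d) G) \o
    dproj (fun H : composition I => tens q H) (comp_cat d F G))).

Lemma deconcatE S T I (d : decomp S T I) x : deconcat d x =
  \sum_(F : composition S) \sum_(G : composition T)
    tmap (dinj (fun H : composition S => tens q H) F \o tens_img_inv (@dl_inj _ _ _ d) F)
         (dinj (fun H : composition T => tens q H) G \o tens_img_inv (@dr_inj _ _ _ d) G)
    (tens_uncat (img (dl d) F) (img (dr d) G)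
      (dproj (fun H : composition I => tens q H) (comp_cat d F G) x)).
Proof. by rewrite /deconcat lsumE; apply: eq_bigr => F _; rewrite lsumE. Qed.

Lemma deconcat_mu S T I (d : decomp S T I) : cancel (mu M d) (deconcat d).
Proof.
apply: monom_ext2 => [||F a G b]; [by solve_linear|by solve_linear|].
rewrite /monom free_mu_dinj deconcatE pair_big (bigD1 (F, G)) // big1 => [|[F' G'] ne] /=.
  by rewrite dproj_dinj tens_catK tmapE /= !tens_imgK addr0.
rewrite (_ : dproj _ _ _ = 0) ?linear0 //; apply: dproj_dinj_ne.
by apply: contraTneq ne => /comp_cat_inj[-> ->]; rewrite eqxx.
Qed.

(** Multiplying after cutting recovers the compositions that can be cut. Together with
    [deconcat_mu] this reduces the laws of deconcatenation to identities between the
    projections [initproj]. *)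
Lemma mu_deconcat S T I (d : decomp S T I) x : mu M d (deconcat d x) = initproj (left_part d) x.
Proof.
move: x; apply: monom_ext => [||H c]; [by solve_linear|by solve_linear|].
rewrite initproj_monom; case: ifP => hH.
  have [F [G e]] := comp_cat_ex hH; subst H.
  have [a ha] := pull_ex F c (@dl_inj _ _ _ d).
  have [b hb] := pull_ex G c (@dr_inj _ _ _ d).
  by rewrite -(free_mu_monom ha hb) deconcat_mu.
rewrite deconcatE big1 ?linear0 // => F _; rewrite big1 // => G _.
rewrite (_ : dproj _ _ _ = 0) ?linear0 //; apply: dproj_dinj_ne.
apply: contraFneq hH => ->; rewrite initial_comp_cat.
have -> : dl d @^-1: left_part d = setT by apply/setP => x; rewrite !inE mem_dl.
have -> : dr d @^-1: left_part d = set0 by apply/setP => x; rewrite !inE mem_dr.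
by rewrite eqxx initialT initial0.
Qed.
End Mask.

Section FreeZeroBimonoid.
Implicit Types I J R S T U V : finType.
Variables (K : fieldType) (q : species K).

Local Notation M := (free_monoid q).
Local Notation Q := (free_species q).

Definition free_eps : {linear Q void -> K^o} :=
  dproj (fun F : composition void => tens q F) comp_nil.

Definition free_comonoid : comonoid_ops Q :=
  @ComonoidOps K Q (fun S T I d => deconcat q d) free_eps.

Local Notation C := free_comonoid.

Lemma free_mu_inj S T I (d : decomp S T I) : injective (mu M d).
Proof. exact: can_inj (@deconcat_mu K q S T I d). Qed.

Lemma free_eps_iota a : eps C (miota M a) = a.
Proof. exact: dproj_dinj. Qed.

Lemma free_unital : unital C M (smorph_id Q).
Proof.
move=> x; rewrite /smorph_id /=; move: x.
apply: monom_ext => [||F a]; [by solve_linear|by solve_linear|].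
have e : F = comp_nil by apply: val_inj; exact: comp_void.
by subst F; rewrite -[monom _ a]/(miota M 1) -[free_eps _]/(eps C (miota M 1)) free_eps_iota.
Qed.

Lemma free_Delta_nat S T I S' T' I' (d : decomp S T I) (d' : decomp S' T' I') f g u :
  restricts d d' f g u -> forall x,
  Delta C d' (act Q u x) = tmap (act Q f) (act Q g) (Delta C d x).
Proof.
move=> h x; apply: (@free_mu_inj _ _ _ d').
rewrite -(free_mu_nat h) /= !mu_deconcat initproj_act; congr (act _ _ (initproj _ _ _)).
case: h => h1 h2; apply/setP => i; rewrite inE.
case: (decomp_cover d i) => -[y ->]; last by rewrite h2 !mem_dr.
by rewrite h1 !mem_dl.
Qed.

Lemma tmap_inj_mu R S T V (e : decomp S T V) :
  injective (tmap (idfun : {linear Q R -> Q R}) (mu M e)).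
Proof.
apply: (can_inj (g := tmap idfun (deconcat q e))) => t.
by rewrite tmap_comp -[RHS]tmap_id; apply: tmap_ext => y //=; exact: deconcat_mu.
Qed.

(** After multiplying, both sides become the projection onto the compositions in which
    both R and R + S are initial. *)
Lemma free_coassoc R S T U V I (d1 : decomp R S U) (d2 : decomp U T I)
    (e1 : decomp S T V) (e2 : decomp R V I) : dassoc d1 d2 e1 e2 -> forall x,
  tassoc _ _ _ (tmap (Delta C d1) idfun (Delta C d2 x)) =
  tmap idfun (Delta C e1) (Delta C e2 x).
Proof.
move=> hd x; apply: (tmap_inj_mu (R := R) (e := e1)); apply: (@free_mu_inj _ _ _ e2).
rewrite -(free_mu_assoc hd) !tmap_comp.
have -> : tmap (mu M d1 \o Delta C d1) (idfun \o idfun) (Delta C d2 x) =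
    tmap (initproj q (left_part d1)) (initproj q set0) (Delta C d2 x).
  by apply: tmap_ext => y /=; [exact: mu_deconcat|rewrite initproj0].
have -> : tmap (idfun \o idfun) (mu M e1 \o Delta C e1) (Delta C e2 x) =
    tmap (initproj q setT) (initproj q (left_part e1)) (Delta C e2 x).
  by apply: tmap_ext => y /=; [rewrite initprojT|exact: mu_deconcat].
case: hd => h1 h2 h3.
have := initproj_mu d2 (left_part e2) (Delta C d2 x).
have -> : dl d2 @^-1: left_part e2 = left_part d1.
  apply/setP => u; rewrite inE; case: (decomp_cover d1 u) => -[y ->].
    by rewrite h1 !mem_dl.
  by rewrite h2 !mem_dr.
have -> : dr d2 @^-1: left_part e2 = set0.
  by apply/setP => y; rewrite !inE h3 mem_dr.
rewrite eqxx orbT => E2.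
have := initproj_mu e2 (left_part d2) (Delta C e2 x).
have -> : dl e2 @^-1: left_part d2 = setT.
  by apply/setP => y; rewrite !inE -h1 mem_dl.
have -> : dr e2 @^-1: left_part d2 = left_part e1.
  apply/setP => u; rewrite inE; case: (decomp_cover e1 u) => -[y ->].
    by rewrite -h2 !mem_dl.
  by rewrite -h3 !mem_dr.
by rewrite eqxx /= => <-; rewrite -E2 !mu_deconcat initproj_comm.
Qed.

Lemma free_is_comonoid : is_comonoid C.
Proof.
split; [exact: free_Delta_nat|exact: free_coassoc|move=> I x|move=> I x].
- have -> : Delta C (dvoidl I) x = miota M 1 ⊠ x.
    by rewrite -[in LHS](free_unitl x) /= deconcat_mu.
  by rewrite tmapE lunitE free_eps_iota scale1r.
- have -> : Delta C (dvoidr I) x = x ⊠ miota M 1.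
    by rewrite -[in LHS](free_unitr x) /= deconcat_mu.
  by rewrite tmapE runitE free_eps_iota scale1r.
Qed.

(** After multiplying, the left side is the projection [initproj] of a product, which
    [initproj_mu] computes. It vanishes when the pieces B and C are nonempty, as does
    the power of 0 on the right; otherwise [free_mu_cross] identifies the two sides. *)
Lemma free_Delta_mu A B C' D S T S' T' I (d : decomp S T I) (d' : decomp S' T' I)
    (eS : decomp A B S) (eT : decomp C' D T) (eS' : decomp A C' S') (eT' : decomp B D T') :
  dcross d d' eS eT eS' eT' -> forall x,
  Delta C d' (mu M d x) = tmap (mu M eS') (mu M eT')
    (tmid (Q A) (Q D) (beta Q 0 B C') (tmap (Delta C eS) (Delta C eT) x)).
Proof.
move=> hd x; apply: (@free_mu_inj _ _ _ d').
have betaE t : tmid (Q A) (Q D) (beta Q 0 B C') t =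
    (0 ^+ (#|B| * #|C'|)) *: tmid (Q A) (Q D) (tswap _ _) t.
  move: t; apply: tens_ext4 => [||a b c e]; [solve_linear| |by rewrite tmid_betaE tmid_swapE].
  by move=> a y z; rewrite linearP scalerDr !scalerA mulrC.
rewrite betaE !linearZ /= mu_deconcat initproj_mu.
have [h1 h2 h3 h4] := hd.
have e1 : dl d @^-1: left_part d' = left_part eS.
  apply/setP => u; rewrite inE; case: (decomp_cover eS u) => -[y ->].
    by rewrite h1 !mem_dl.
  by rewrite h2 !mem_dr.
have e2 : dr d @^-1: left_part d' = left_part eT.
  apply/setP => u; rewrite inE; case: (decomp_cover eT u) => -[y ->].
    by rewrite h3 !mem_dl.
  by rewrite h4 !mem_dr.
have BC : (left_part eS == setT) || (left_part eT == set0) = (#|B| * #|C'| == 0)%N.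
  rewrite muln_eq0; congr (_ || _).
    rewrite eqEcard subsetT cardsT (card_imset _ (@dl_inj _ _ _ eS)) cardsT.
    by rewrite (card_decomp eS) -{2}[#|A|]addn0 leq_add2l leqn0.
  by rewrite -cards_eq0 (card_imset _ (@dl_inj _ _ _ eT)) cardsT.
rewrite e1 e2 BC expr0n; case: eqP => [bc|_]; last by rewrite scale0r.
rewrite scale1r (free_mu_cross hd bc) tmap_comp; apply: (congr1 (mu M d)).
by apply: tmap_ext => y /=; rewrite mu_deconcat.
Qed.

Lemma free_connected_0bimonoid : connected_0bimonoid M C.
Proof.
split; last exact: free_unital.
split; [exact: free_is_monoid|exact: free_is_comonoid|exact: free_Delta_mu
       |exact: free_eps_iota| |].
- apply: tens_ext => [||x y]; [solve_linear|solve_linear|].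
  have ex : x = eps C x *: miota M 1 by rewrite -miotaZ; exact: free_unital.
  transitivity (eps C (mu M (dvoidl void) (eps C x *: (miota M 1 ⊠ y)))).
    by congr (eps C (mu M _ _)); rewrite {1}ex; exact: tpureZl.
  by rewrite !linearZ free_unitl tmapE lunitE.
- apply: tens_ext => [||a b]; [solve_linear|solve_linear|].
  transitivity (Delta C (dvoidl void) (mu M (dvoidl void) (miota M a ⊠ miota M b))).
    by rewrite lunitE (miotaZ M a) tpureZl !linearZ free_unitl.
  by rewrite tmapE; exact: deconcat_mu.
Qed.

End FreeZeroBimonoid.

(** * The primitive elements of the free monoid *)

Lemma comp_one_subproof (I : finType) : (0 < #|I|)%N -> is_composition [:: [set: I]].
Proof.
move=> I0; apply/and3P; split=> //; last by apply/forallP => x; rewrite /= inE.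
by rewrite inE eq_sym -card_gt0 cardsT.
Qed.

Definition comp_one (I : finType) (I0 : (0 < #|I|)%N) : composition I :=
  Composition (comp_one_subproof I0).

Lemma setT_bij_subproof (I : finType) : bijective (fun x : I => Sub x (in_setT x) : sset [set: I]).
Proof. by exists val => x //; apply: val_inj. Qed.

Definition setT_bij (I : finType) : bij I (sset [set: I]) := Bij (@setT_bij_subproof I).

(** The first block of F cuts it properly, since F has further blocks and these are
    disjoint from the first. *)
Lemma comp_first (I : finType) (I0 : (0 < #|I|)%N) (F : composition I) : F <> comp_one I0 ->
  exists A : {set I}, [/\ A != set0, A != setT & initial A F].
Proof.
case: F => -[|A s] Fc ne; have := Fc; case/and3P.
  by move=> _ _ /forallP h; case/card_gt0P: (I0) => x _; have := h x.
rewrite inE negb_or eq_sym => /andP[A0 s0] /= /andP[/allP dA _] _; exists A; split=> //.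
- apply/eqP => AT; apply: ne; apply: val_inj => /=; rewrite AT; congr (_ :: _).
  case: s s0 dA {Fc} => // B s; rewrite inE negb_or eq_sym => /andP[B0 _] /(_ B (mem_head _ _)).
  by rewrite AT -setI_eq0 setTI (negbTE B0).
- rewrite subxx; case: s s0 dA {Fc ne} => //= B s; rewrite inE negb_or => /andP[B0 _] dA.
  rewrite ifN; last first.
    apply/negP => BA; have := dA B (mem_head _ _).
    by rewrite -setI_eq0 (setIidPr BA) eq_sym (negbTE B0).
  apply/andP; split; first by rewrite disjoint_sym dA ?mem_head.
  by apply/allP => Z Zs; rewrite disjoint_sym dA // inE Zs orbT.
Qed.

Section Generators.
Implicit Types I J S T U V : finType.
Variables (K : fieldType) (q : species K).
Hypothesis (q0 : positive q).

Local Notation M := (free_monoid q).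
Local Notation Q := (free_species q).
Local Notation C := (free_comonoid q).

Definition free_gen_fun I : {linear q I -> Q I} :=
  match @idP (0 < #|I|)%N with
  | ReflectT I0 => dinj (fun F : composition I => tens q F) (comp_one I0) \o
      tswap K^o (q (sset setT)) \o lunitV (q (sset setT)) \o act q (setT_bij I)
  | ReflectF _ => \0
  end.

Lemma free_gen_dinj I (I0 : (0 < #|I|)%N) a : free_gen_fun I a =
  dinj (fun F : composition I => tens q F) (comp_one I0) (act q (setT_bij I) a ⊠ (1 : K^o)).
Proof.
rewrite /free_gen_fun; case: {-}_ / idP => // I0'; rewrite (bool_irrelevance I0' I0) /=.
by rewrite lunitVE tswapE.
Qed.

Lemma free_gen_fun_el I (I0 : (0 < #|I|)%N) a (c : block_section q I) :
  c setT = act q (setT_bij I) a -> free_gen_fun I a = monom (comp_one I0) c.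
Proof. by rewrite /monom /= => ->; exact: free_gen_dinj. Qed.

Lemma free_gen_nat S T (u : bij S T) a : free_gen_fun T (act q u a) = act Q u (free_gen_fun S a).
Proof.
have [S0|S0] := posnP #|S|; first by rewrite (positive0 a q0 S0) !linear0.
have T0 : (0 < #|T|)%N by rewrite -(bij_card u).
pose z I : block_section q I := fun=> 0.
rewrite (free_gen_fun_el T0 (section_upd_eq (z T) _)) (free_gen_fun_el S0 (section_upd_eq (z S) _)).
have [c hc] := push_ex (comp_one S0) (section_upd (z S) (act q (setT_bij S) a)) (@inj_bij _ _ u).
have uT : u @: [set: S] = setT.
  apply/setP => y; rewrite inE; apply/imsetP.
  by exists (bij_inv u y); rewrite ?inE ?bij_invVK.
rewrite (free_act_monom hc); apply: monom_eq; first by rewrite /= uT.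
move=> A; rewrite inE => /eqP ->; rewrite section_upd_eq.
pose g := bij_o (setT_bij T) (bij_o u (bij_inv (setT_bij S))).
rewrite (hc _ (mem_head _ _) _ g) => [|x].
  by rewrite section_upd_eq !act_o; congr (act q _ _); apply: Defs.bij_eq => x /=; rewrite bij_invK.
by rewrite /= -[in RHS](bij_invVK (setT_bij S) x).
Qed.

Definition free_gen : smorph q Q := Smorph free_gen_nat.

(** A one-block composition has no proper initial subset, so the generators are
    primitive. Conversely a primitive element has no component at any other
    composition, which would be detected by cutting after the first block. *)
Lemma free_gen_primitives : is_primitives C free_gen.
Proof.
split=> // [I a b|U V I d a U0 V0|I x I0 h] /=.
- have [I0|I0] := posnP #|I|; first by rewrite (positive0 a q0 I0) (positive0 b q0 I0).
  rewrite !(free_gen_dinj I0) => /(congr1 (dproj _ (comp_one I0))).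
  rewrite !dproj_dinj => /(congr1 (runit _)); rewrite !runitE !scale1r.
  exact: (can_inj (act_cancel (bij_invK (setT_bij I)))).
- have I0 := decomp_gt0 d U0; rewrite (free_gen_dinj I0).
  rewrite -[LHS](deconcat_mu d) mu_deconcat initproj_dinj /= ifF ?linear0 //.
  case: ifP => [/subsetP hT|_].
    by case/card_gt0P: V0 => v _; have := hT (dr d v); rewrite inE mem_dr => /(_ isT).
  rewrite andbT -setI_eq0 setTI; apply/negbTE; case/card_gt0P: U0 => u _.
  by apply/set0Pn; exists (dl d u); exact: mem_dl.
- have hx (F : composition I) : F <> comp_one I0 ->
      dproj (fun F : composition I => tens q F) F x = 0.
    case/comp_first => A [A0 AT AF].
    have : initproj q A x = 0.
      rewrite -[A]left_part_dset -mu_deconcat h ?linear0 // card_sset card_gt0 //.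
      by apply: contra AT => /eqP e; rewrite -(setCK A) e setC0.
    rewrite /initproj lsumE => /(congr1 (dproj (fun F : composition I => tens q F) F)).
    rewrite linear0 linear_sum (bigD1 F) //= big1 => [|G ne].
      by rewrite AF /= dproj_dinj addr0.
    by case: ifP => _ /=; rewrite ?linear0 // dproj_dinj_ne.
  pose t : q (sset setT) ⊗ K^o := dproj (fun F : composition I => tens q F) (comp_one I0) x.
  exists (act q (bij_inv (setT_bij I)) (runit _ t)).
  rewrite (free_gen_dinj I0) act_cancel; last exact: bij_invVK.
  have -> : runit _ t ⊠ (1 : K^o) = t.
    move: t; apply: tens_ext => [||v c]; [solve_linear|by solve_linear|].
    by rewrite runitE tpureZl -tpureZr; congr (_ ⊠ _); rewrite -[LHS]/(c * 1) mulr1.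
  rewrite [RHS](dsum_dec x) (bigD1 (comp_one I0)) //= big1 ?addr0 // => F ne.
  by rewrite hx ?linear0 //; apply/eqP.
Qed.
End Generators.

(** * Freeness of the Hadamard product *)

Section Final.
Variable K : fieldType.

Lemma unital_connected (p : species K) (m : monoid_ops p) (c : comonoid_ops p) :
  (forall a, eps c (miota m a) = a) -> unital c m (smorph_id p) -> connected p.
Proof.
move=> ei h; exists (miota m 1) => [|x].
  apply/eqP => e; have := ei 1; rewrite e linear0 => /esym/eqP; apply/negP.
  exact: oner_neq0.
by exists (eps c x); rewrite -miotaZ; exact: h.
Qed.

(** The isomorphism carries units to units, so that k is connected because the free
    monoid is. *)
Lemma iso_unital (k l : species K) (m : monoid_ops k) (c : comonoid_ops k)
    (n : monoid_ops l) (c' : comonoid_ops l) : (forall a, eps c (miota m a) = a) ->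
  monoid_iso m n -> unital c' n (smorph_id l) -> unital c m (smorph_id k).
Proof.
move=> ei [f [g [_ [_ g1] fK _]]] hl x.
have e : x = miota m (eps c' (f void x)) by rewrite -g1 -(hl (f void x)) fK.
by rewrite /smorph_id /= {2}e ei.
Qed.

Lemma monoid_iso_trans (k1 k2 k3 : species K) (m1 : monoid_ops k1) (m2 : monoid_ops k2)
    (m3 : monoid_ops k3) : monoid_iso m1 m2 -> monoid_iso m2 m3 -> monoid_iso m1 m3.
Proof.
case=> f [g [[fM f1] [gM g1] fK gK]] [f' [g' [[fM' f1'] [gM' g1'] fK' gK']]].
exists (smorph_comp f' f), (smorph_comp g g'); split=> [||I x|I x] /=.
- by split=> [S T I d x|a] /=; rewrite ?fM ?fM' ?tmap_comp ?f1 ?f1'.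
- by split=> [S T I d x|a] /=; rewrite ?gM' ?gM ?tmap_comp ?g1' ?g1.
- by rewrite fK' fK.
- by rewrite gK gK'.
Qed.

Section HadamardRight.
Variables (h k l : species K).

Lemma had_right_nat (f : smorph k l) S T (u : bij S T) x :
  tmap idfun (f T) (act (had h k) u x) = act (had h l) u (tmap idfun (f S) x).
Proof.
move: x; apply: tens_ext => [||a b]; [solve_linear|solve_linear|].
by rewrite had_actE !tmapE smap_nat.
Qed.

Definition had_right (f : smorph k l) : smorph (had h k) (had h l) :=
  @Smorph K (had h k) (had h l) (fun I => tmap idfun (f I)) (had_right_nat f).

Lemma had_right_morph (mh : monoid_ops h) (m : monoid_ops k) (n : monoid_ops l)
    (f : smorph k l) : is_monoid_morph m n f ->
  is_monoid_morph (had_monoid mh m) (had_monoid mh n) (had_right f).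
Proof.
case=> fM f1; split=> [S T I d|a].
  apply: tens_ext4 => [||a b x y]; [solve_linear|solve_linear|].
  by rewrite had_muE [LHS]tmapE fM !tmapE had_muE.
by rewrite !had_iotaE linearZ [had_right f void _]tmapE f1.
Qed.
End HadamardRight.

Lemma had_iso_right (h k l : species K) (mh : monoid_ops h) (m : monoid_ops k)
    (n : monoid_ops l) : monoid_iso m n ->
  monoid_iso (had_monoid mh m) (had_monoid mh n).
Proof.
case=> f [g [fM gM fK gK]]; exists (had_right h f), (had_right h g).
split=> [||I x|I x]; try exact: had_right_morph.
- rewrite [LHS]tmap_comp -[RHS]tmap_id; apply: tmap_ext => y //=; exact: fK.
- rewrite [LHS]tmap_comp -[RHS]tmap_id; apply: tmap_ext => y //=; exact: gK.
Qed.

Lemma had_unital (h k : species K) (mh : monoid_ops h) (ch : comonoid_ops h)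
    (mk : monoid_ops k) (ck : comonoid_ops k) : unital ch mh (smorph_id h) ->
  unital ck mk (smorph_id k) ->
  unital (had_comonoid ch ck) (had_monoid mh mk) (smorph_id (had h k)).
Proof.
move=> Hh Hk; rewrite /unital; apply: tens_ext => [||x y]; [by solve_linear|by solve_linear|].
transitivity (miota mh (eps ch x) ⊠ miota mk (eps ck y)).
  by congr (_ ⊠ _); [exact: Hh|exact: Hk].
rewrite had_epsE had_iotaE (miotaZ mh (eps ch x)) (miotaZ mk (eps ck y)).
by rewrite tpureZl tpureZr scalerA.
Qed.

(** The free monoid on the primitive elements is, with deconcatenation, another
    connected 0-bimonoid with the same primitive elements. For graded algebras this is
    a theorem of Loday and Ronco. *)
Lemma connected_0bimonoid_free (k : species K) (m : monoid_ops k) (c : comonoid_ops k) :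
  connected_0bimonoid m c -> is_free m.
Proof.
move=> Hk; have [r [i Hi]] := primitives_ex (bimon_comonoid (conn0_bimonoid Hk)).
exists r; split; first exact: prim_pos Hi.
exact: connected_0bimonoid_iso Hk (free_connected_0bimonoid r) Hi
  (free_gen_primitives (prim_pos Hi)).
Qed.
End Final.

Unset Implicit Arguments.

Theorem theorem3p2 (K : fieldType) (p q : K)
    (h : species K) (mh : monoid_ops h) (ch : comonoid_ops h)
    (k : species K) (mk : monoid_ops k) (ck : comonoid_ops k) :
  is_hopf_monoid p mh ch -> connected h ->
  is_hopf_monoid q mk ck -> is_free mk ->
  [/\ is_hopf_monoid (p * q) (had_monoid mh mk) (had_comonoid ch ck),
      connected (had h k)
    & is_free (had_monoid mh mk)].
Proof.
move=> [Hh _] conn_h [Hk _] [g [_ iso_k]].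
have uh : unital ch mh (smorph_id h) by exact: connected_unital (eps_iota Hh) conn_h.
have uk : unital ck mk (smorph_id k) by exact: iso_unital (eps_iota Hk) iso_k (@free_unital K g).
have Hhk := had_bimonoid Hh Hk; have uhk := had_unital uh uk.
split.
- split=> //; have [s [hs _]] :=
    antipode_ex (bimon_comonoid Hhk) (bimon_monoid Hhk) uhk.
  by exists s.
- exact: unital_connected (eps_iota Hhk) uhk.
- have Hg := free_connected_0bimonoid g.
  have [|r [r0 iso_r]] := @connected_0bimonoid_free K (had h (free_species g))
      (had_monoid mh (free_monoid g)) (had_comonoid ch (free_comonoid g)).
    split; last exact: had_unital uh (conn0_unit Hg).
    (* Whatever p is, the product has parameter p * 0. *)
    by rewrite -(mulr0 p); exact: had_bimonoid Hh (conn0_bimonoid Hg).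
  exists r; split=> //; apply: monoid_iso_trans iso_r.
  exact: had_iso_right.
Qed.
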